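(* Let $l,m\ge 1$ be integers, let $p$ be a prime with $p>m$, and let $k$ be a field of characteristic $p$. Then the quotient complex $\Delta(B_{lm})/S_l\wr S_m$ is Cohen-Macaulay over $k$, and consequently the ring of invariants $k[x_1,\dots,x_{lm}]^{S_l\wr S_m}$ is a Cohen-Macaulay ring.
   Context: $B_n$ is the Boolean algebra of all subsets of $\{1,\dots,n\}$ ordered by inclusion, and $\Delta(B_n)$ is the simplicial complex whose faces are the chains $u_0<\dots<u_i$ of elements of $B_n\setminus\{\emptyset,\{1,\dots,n\}\}$ (the empty chain being the empty face). The wreath product $S_l\wr S_m\subset S_{lm}$ is the subgroup of order $(l!)^m m!$ consisting of the permutations of $\{1,\dots,lm\}$ that preserve the partition of $\{1,\dots,lm\}$ into the $m$ sets (''rows'') $\{il+1,\dots,(i+1)l\}$, $0\le i<m$; that is, it permutes the elements within each row and permutes the rows wholesale. It acts on $B_{lm}$, hence on $\Delta(B_{lm})$, and on the polynomial ring $k[x_1,\dots,x_{lm}]$ by permuting the subscripts of the variables. The quotient complex $\Delta(B_{lm})/S_l\wr S_m$ is the regular cell complex whose cells (faces) are the $S_l\wr S_m$-orbits of faces of $\Delta(B_{lm})$, with an orbit contained in another if some representative of the first is contained in a representative of the second. (It is in general not the order complex of the quotient poset.) It is a boolean cell complex: every lower interval in its face poset, which includes the empty face, is a Boolean algebra. The link $\mathrm{lk}(F)$ of a face $F$ is the boolean cell complex whose face poset (including the empty face, which corresponds to $F$) is $\{H : H\supseteq F\}$. A boolean cell complex is Cohen-Macaulay over a field $k$ if for every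 face $F$ (including the empty face) the reduced homology $\tilde H_i(\mathrm{lk}(F);k)$ vanishes for all $i<\dim \mathrm{lk}(F)$. *)

(* Defs.v *)
From HB Require Import structures.
From mathcomp Require Import all_boot all_order all_fingroup all_algebra.
From mathcomp Require Import mpoly.

Set Implicit Arguments.
Unset Strict Implicit.
Unset Printing Implicit Defensive.

Import GRing.Theory.
Local Open Scope ring_scope.

(** * Boolean cell complexes

  A boolean cell complex is given by its face poset: a finite set [X] of faces,
  ordered by [le], with a least element (the empty face) and all of whose lower
  intervals are Boolean algebras. *)

Section BooleanComplex.

Variables (T : finType) (le : rel T).

(* The least element of [link X F] is [F], its empty face. *)
Definition link (X : {set T}) (F : T) : {set T} := [set H in X | le F H].

(* A vertex lies above exactly two faces: itself and the empty face. *)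
Definition vertices (X : {set T}) : {set T} :=
  [set v in X | #|[set u in X | le u v]| == 2%N].

Definition vertices_of (X : {set T}) (H : T) : {set T} :=
  [set v in vertices X | le v H].

(* The rank of a face is its dimension plus one, so the empty face has rank 0
   and the complex has dimension [(complex_rank X)%:Z - 1]. *)
Definition face_rank (X : {set T}) (H : T) : nat := #|vertices_of X H|.

Definition complex_rank (X : {set T}) : nat := \max_(H in X) face_rank X H.

Definition faces_of_rank (X : {set T}) (r : nat) : {set T} :=
  [set H in X | face_rank X H == r].

(* For a facet [K] of [H], the number of vertices of [H] preceding, in the
   total order [enum_rank], the unique vertex of [H] that is not in [K]. *)
Definition facet_position (X : {set T}) (H K : T) : nat :=
  #|[set w in vertices_of X H |
      [exists v in vertices_of X H :\: vertices_of X K,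
         (enum_rank w < enum_rank v)%N]]|.

Variable k : fieldType.

(* The boundary map from chains of dimension [r] to chains of dimension
   [r - 1]: the augmented cellular chain complex for the usual simplicial signs.
   Matrices act on row vectors, on the right. *)
Definition boundary (X : {set T}) (r : nat) :
    'M[k]_(#|faces_of_rank X r.+1|, #|faces_of_rank X r|) :=
  \matrix_(i, j)
    (if le (enum_val j) (enum_val i)
     then (-1) ^+ facet_position X (enum_val i) (enum_val j) else 0).

Definition cycles (X : {set T}) (r : nat) : 'M[k]_#|faces_of_rank X r| :=
  if r is r'.+1 return 'M[k]_#|faces_of_rank X r|
  then kermx (boundary X r') else 1%:M.

(* Vanishing of the reduced homology group of degree [r - 1]. *)
Definition reduced_homology_vanishes (X : {set T}) (r : nat) : bool :=
  (cycles X r <= boundary X r)%MS.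

Definition cohen_macaulay_complex (X : {set T}) : Prop :=
  forall F, F \in X ->
  forall r, (r < complex_rank (link X F))%N ->
  reduced_homology_vanishes (link X F) r.

End BooleanComplex.

(** * The quotient complexes of the Boolean algebra *)

Section Quotient.

Variable n : nat.

Definition is_chain (F : {set {set 'I_n}}) : bool :=
  [forall A in F, (A != set0) && (A != setT)] &&
  [forall A in F, forall B in F, (A \subset B) || (B \subset A)].

Definition boolean_order_complex : {set {set {set 'I_n}}} :=
  [set F | is_chain F].

Variable G : {group 'S_n}.

Definition quotient_complex : {set {set {set {set 'I_n}}}} :=
  [set orbit ('P^*)^*%act G F | F in boolean_order_complex].

Definition quotient_le : rel {set {set {set 'I_n}}} :=
  fun O1 O2 => [exists F1 in O1, exists F2 in O2, F1 \subset F2].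

End Quotient.

(** * The wreath product, with [{1, ..., lm}] shifted to ['I_(l * m)] *)

Definition wreath_rows (l m : nat) : {set {set 'I_(l * m)}} :=
  [set [set j : 'I_(l * m) | j %/ l == i]%N | i : 'I_m].

Definition wreath (l m : nat) : {group 'S_(l * m)} :=
  'N(wreath_rows l m | 'P^*)%G.

(** * Rings of invariants *)

Section Invariants.

Variables (n : nat) (k : fieldType) (G : {group 'S_n}).

Definition invariant_pred : pred {mpoly k[n]} :=
  fun p => [forall s in G, msym s p == p].

Lemma invariantP p :
  reflect (forall s, s \in G -> msym s p = p) (p \in invariant_pred).
Proof. by apply: (iffP forall_inP) => h s /h => [/eqP|->]. Qed.

Lemma invariant_subring_closed : subring_closed invariant_pred.
Proof.
split=> [|p q|p q]; first by apply/invariantP => s _; rewrite msym1.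
- by move=> /invariantP hp /invariantP hq; apply/invariantP => s sG;
    rewrite msymB hp ?hq.
- by move=> /invariantP hp /invariantP hq; apply/invariantP => s sG;
    rewrite msymM hp ?hq.
Qed.

HB.instance Definition _ := GRing.isSubringClosed.Build {mpoly k[n]}
  invariant_pred invariant_subring_closed.

Record invariant_ring := InvariantRing {
  invariant_val :> {mpoly k[n]};
  _ : invariant_val \in invariant_pred }.

HB.instance Definition _ := [isSub for invariant_val].
HB.instance Definition _ := [Choice of invariant_ring by <:].
HB.instance Definition _ := [SubChoice_isSubComNzRing of invariant_ring by <:].

End Invariants.

(** * Cohen-Macaulay rings *)

Section CohenMacaulayRing.

Variable R : comNzRingType.

Implicit Types (I J P Q : R -> Prop) (s : seq R).

Definition ideal I : Prop :=
  [/\ I 0, forall x y, I x -> I y -> I (x + y) & forall a x, I x -> I (a * x)].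

Definition ideal_le I J : Prop := forall x, I x -> J x.

Definition prime_ideal P : Prop :=
  [/\ ideal P, ~ P 1 & forall x y, P (x * y) -> P x \/ P y].

Definition maximal_ideal P : Prop :=
  [/\ ideal P, ~ P 1 &
      forall J, ideal J -> ~ J 1 -> ideal_le P J -> ideal_le J P].

Definition generated_ideal s : R -> Prop :=
  fun x => exists c : 'I_(size s) -> R, x = \sum_(i < size s) c i * s`_i.

Definition noetherian : Prop :=
  forall I, ideal I -> exists s, forall x, I x <-> generated_ideal s x.

Definition regular_sequence s : Prop :=
  (forall i y, (i < size s)%N ->
     generated_ideal (take i s) (s`_i * y) -> generated_ideal (take i s) y) /\
  ~ generated_ideal s 1.

Definition regular_sequence_in P (d : nat) : Prop :=
  exists s, [/\ size s = d, regular_sequence s & forall x, x \in s -> P x].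

Definition prime_chain_below P (d : nat) : Prop :=
  exists Q : nat -> R -> Prop,
    [/\ forall i, (i <= d)%N -> prime_ideal (Q i),
        forall i, (i < d)%N -> ideal_le (Q i) (Q i.+1) /\
                               ~ ideal_le (Q i.+1) (Q i)
      & forall x, Q d x <-> P x].

Definition is_greatest (A : nat -> Prop) (d : nat) : Prop :=
  A d /\ forall e, A e -> (e <= d)%N.

Definition has_height P (d : nat) : Prop := is_greatest (prime_chain_below P) d.

Definition has_depth P (d : nat) : Prop := is_greatest (regular_sequence_in P) d.

(* The definition of Kaplansky (Commutative Rings) and Eisenbud (Commutative
   Algebra): depth equals height at every maximal ideal.  Both numbers are
   finite because the ring is noetherian. *)
Definition cohen_macaulay_ring : Prop :=
  noetherian /\
  forall P, maximal_ideal P -> exists d, has_height P d /\ has_depth P d.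

End CohenMacaulayRing.

(* Main.v *)
From HB Require Import structures.
Require Import Defs.
From mathcomp Require Import all_boot all_order all_fingroup all_solvable all_algebra.
From mathcomp Require Import ring_quotient zify.
From mathcomp Require Import ssrcomplements mpoly boolp.
From mathcomp Require classical_sets.

(** Both halves exploit that the wreath product [G] is an extension of a group
    permuting the rows, of order prime to [p] because [m < p], by the product
    [S_l ^ m] of symmetric groups acting inside the rows, whose quotients behave
    well in every characteristic.

    The complex.  Call a set row-initial when it meets each row in an initial
    segment.  Row-initial sets form a distributive lattice [W], a product of [m]
    chains, and every chain of subsets can be sorted into [W] by [G]
    ([sort_into_row_initial]).  Two chains of [W] in the same [G]-orbit are
    conjugate under the group [H] of row permutations that preserve the positions
    in the rows ([row_initial_transport]).  So the link of the orbit of a chain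
    [c] of [W] is the quotient, by the stabiliser of [c] in [H], of the complex of
    the chains of [W] that refine [c].  The latter has no cohomology below its
    top dimension: in a gap [x < y] of [c] choose an element [i] that can be added
    to [x]; the elements that stay below [y] after [i] is added retract onto
    [i |: x], and at most one element is left, [y] without [i], whose link is
    smaller ([refiners_exact]).  The order of [H] is invertible in [k]
    ([position_group_card]), so averaging a primitive of an invariant cocycle
    carries the vanishing to the quotient ([quotient_homology_vanishes]).  Duality
    over a field turns this cohomological statement into one on homology.

    The ring.  Write [R] for the polynomial ring and [A] for its invariants.  The
    antisymmetrisation [row_antisym] over [G] produces multiples of the product
    [a] of the Vandermonde determinants of the rows, and it maps the monomial
    whose exponents are the positions to [c *: a], where [c] is nonzero because
    the order of [H] is.  Multiplication by that monomial, antisymmetrisation and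
    division by [c *: a] form an [A]-linear retraction of [R] onto [A], the
    divided-difference operator of the rows followed by an average.  Hence ideals
    of [A] are contracted from [R] ([wreath_purity]), and this purity suffices, as
    follows, for any permutation group ([pure_invariants_cohen_macaulay]).

    Hilbert's basis theorem descends from [R] to [A].  A chain of primes in [A]
    has length at most [n], because [n + 1] elements are algebraically dependent
    ([invariant_chain_length]), and a regular sequence in a prime yields a chain of
    primes of the same length below it ([regular_chain]).  So it is enough that
    each maximal ideal [P] of [A] contains a regular sequence of length [n].
    Purity gives a maximal ideal [M] of [R] over [P], and Zariski's lemma a monic
    polynomial [q] in one variable with [q(x_i)] in [M] for all [i].  The elementary
    symmetric polynomials in the [q(x_i)] are invariant under all permutations and
    lie in [P].  They are a regular sequence in [R] since [R] has a basis on which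
    they act as the shifts by the powers [x_i ^ D_i] act on monomials
    ([std_map_shift], [std_map_surj], [std_map_inj]), and by purity they are one
    in [A]. *)

Set Implicit Arguments.
Unset Strict Implicit.
Unset Printing Implicit Defensive.

Import GRing.Theory.
Local Open Scope ring_scope.

(** * Cohomology of flag complexes *)

Section FlagCohomology.

Variables (V : finType) (adj : rel V) (key : V -> nat) (k : fieldType).
Implicit Types (e : {set V}) (f g : {set V} -> k) (s t v a : V) (Q U : {set V}).

Definition clique Q e : bool :=
  (e \subset Q) && [forall s in e, forall t in e, (s != t) ==> adj s t].

Lemma cliqueP Q e : reflect
  ({subset e <= Q} /\ forall s t, s \in e -> t \in e -> s != t -> adj s t)
  (clique Q e).
Proof.
apply: (iffP andP) => [[/subsetP eQ /forall_inP h]|[eQ h]]; split=> //.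
- by move=> s t se te st; have /forall_inP/(_ t te)/implyP/(_ st) := h s se.
- exact/subsetP.
- by apply/forall_inP => s se; apply/forall_inP => t te; apply/implyP; apply: h.
Qed.

Lemma clique_sub Q Q' e e' :
  clique Q e -> e' \subset e -> e' \subset Q' -> clique Q' e'.
Proof.
move=> /cliqueP[eQ h] /subsetP e'e /subsetP e'Q; apply/cliqueP; split=> //.
by move=> s t /e'e se /e'e te; apply: h.
Qed.

Lemma clique_subset Q Q' e : Q \subset Q' -> clique Q e -> clique Q' e.
Proof.
move=> sQ cl; apply: (clique_sub cl) => //; apply: subset_trans sQ.
by case/andP: cl.
Qed.

Lemma cliqueD1 Q e t : clique Q e -> clique Q (e :\ t).
Proof.
move=> cl; apply: (clique_sub cl); first exact: subD1set.
by apply: subset_trans (subD1set _ _) _; case/andP: cl.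
Qed.

(** The vertices of a clique are ordered by [key], which has to separate adjacent
    vertices only.  This allows orders pulled back from a quotient complex. *)
Definition sgn t e : k := (-1) ^+ #|[set w in e | key w < key t]%N|.

(** Cochains are functions on all sets of vertices; only their values on cliques
    matter. *)
Definition coboundary f e : k := \sum_(t in e) sgn t e * f (e :\ t).

(** Cohomology is easier than homology to transfer to a quotient: a cochain of the
    quotient pulls back to an invariant cochain, and no sizes of orbits occur. *)
Definition exact_at Q r : Prop := forall f,
  (forall e, clique Q e -> #|e| = r.+1 -> coboundary f e = 0) ->
  exists g, forall e, clique Q e -> #|e| = r -> f e = coboundary g e.

Definition exact_below Q d : Prop := forall r, (r < d)%N -> exact_at Q r.

Lemma sgn_sqr t e : sgn t e * sgn t e = 1.
Proof. by rewrite /sgn -signr_odd -expr2 sqrr_sign. Qed.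

Lemma card_lowerD1 s t e : t \in e ->
  #|[set w in e | key w < key s]%N| =
  ((key t < key s) + #|[set w in e :\ t | key w < key s]|)%N.
Proof.
move=> te; rewrite (cardsD1 t) !inE te /=; congr (_ + _)%N.
by apply: eq_card => w; rewrite !inE andbA.
Qed.

(** Deleting a vertex shifts the position of exactly one of the two. *)
Lemma sgn_swap e s t : s \in e -> t \in e -> key s != key t ->
  sgn s e * sgn t (e :\ s) = - (sgn t e * sgn s (e :\ t)).
Proof.
move=> se te kst; rewrite /sgn (card_lowerD1 s te) (card_lowerD1 t se).
by case: (ltngtP (key s) (key t)) kst => //= _ _;
  rewrite !add0n !add1n !exprS mulN1r ?mulrN ?mulNr ?opprK mulrC.
Qed.

Section InUniverse.

Variable U : {set V}.
Hypothesis key_inj : forall s t, s \in U -> t \in U -> s != t -> adj s t ->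
  key s != key t.
Hypothesis adj_sym : ssrbool.symmetric adj.

Lemma clique_key e s t : clique U e -> s \in e -> t \in e -> s != t ->
  key s != key t.
Proof.
by case/cliqueP => eU h se te st; apply: key_inj => //; [apply: eU..|apply: h].
Qed.

(** The terms of the double sum cancel in pairs, so the pairs are split by the order
    of their keys; halving the sum would fail in characteristic 2. *)
Lemma coboundary_coboundary g e : clique U e -> coboundary (coboundary g) e = 0.
Proof.
move=> cl; rewrite /coboundary.
pose a s t := sgn s e * sgn t (e :\ s) * g (e :\ s :\ t).
transitivity (\sum_(s in e) \sum_(t in e | t != s) a s t).
  apply: eq_bigr => s se; rewrite mulr_sumr; apply: eq_big => [t|t _].
    by rewrite !inE andbC.
  by rewrite /a mulrA.
have split_lt: forall s, s \in e -> \sum_(t in e | t != s) a s t =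
   \sum_(t in e | (key s < key t)%N) a s t + \sum_(t in e | (key t < key s)%N) a s t.
  move=> s se; rewrite (bigID (fun t => key s < key t)%N) /=.
  congr (_ + _); apply: eq_bigl => t; case te: (t \in e) => //=.
    case: eqP => [->|/eqP ts] /=; first by rewrite ltnn.
    by [].
  case: (eqVneq t s) => [->|ts] /=; first by rewrite ltnn.
  by rewrite -leqNgt ltn_neqAle (clique_key cl te se ts).
rewrite (eq_bigr _ split_lt) big_split /=.
rewrite [X in _ + X](exchange_big_dep (mem e)) //=; last by move=> s t _ /andP[].
rewrite -big_split /= big1 // => s se.
rewrite [X in _ + X](eq_bigl (fun t => (t \in e) && (key s < key t)%N)); last first.
  by move=> t; rewrite /= se.
rewrite -big_split /= big1 // => t /andP[te kst].
have kst' : key s != key t by rewrite neq_ltn kst.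
have -> : a s t = - (sgn t e * sgn s (e :\ t) * g (e :\ s :\ t)).
  by rewrite /a (sgn_swap se te kst') mulNr.
by rewrite /a !setDDl [[set s] :|: _]setUC addNr.
Qed.

(** Evaluation on [a |: e] is a contracting homotopy of the cone with apex [a]. *)
Lemma exact_cone Q a r : Q \subset U -> a \in Q ->
  (forall t, t \in Q -> t != a -> adj a t) -> exact_at Q r.
Proof.
move=> QU aQ adja f fcyc.
exists (fun e => if a \in e then 0 else sgn a (a |: e) * f (a |: e)) => e cl er.
have [ae|ae] := boolP (a \in e).
  rewrite /coboundary (big_setD1 a) //= big1 ?addr0 => [|t /setD1P[ta te]].
    by rewrite !inE eqxx /= setD1K // mulrA sgn_sqr mul1r.
  by rewrite !inE eq_sym ta ae mulr0.
have cla : clique Q (a |: e).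
  case/cliqueP: cl => eQ eadj; apply/cliqueP; split.
    by move=> x /setU1P[->//|/eQ].
  move=> s t /setU1P[->|se] /setU1P[->|te] st; rewrite ?eqxx // in st *.
  - by apply: adja; rewrite 1?eq_sym //; apply: eQ.
  - by rewrite adj_sym; apply: adja => //; apply: eQ.
  - exact: eadj.
have /(fcyc _ cla) : #|a |: e| = r.+1 by rewrite cardsU1 ae er.
rewrite /coboundary (big_setD1 a) ?setU11 //= setU1K // => /eqP.
rewrite addr_eq0 => /eqP /(congr1 (fun x => sgn a (a |: e) * x)).
rewrite mulrA sgn_sqr mul1r => ->; rewrite mulrN mulr_sumr -sumrN.
apply: eq_bigr => t te; have ta : t != a by apply: contraNneq ae => <-.
rewrite !inE eq_sym (negPf ta) (negPf ae) /=.
have -> : a |: (e :\ t) = (a |: e) :\ t.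
  by apply/setP => x; rewrite !inE; case: (eqVneq x a) => [->|] //=; rewrite 1?eq_sym 1?ta.
apply/esym; rewrite mulrA -mulNr [RHS]mulrA; congr (_ * _).
have := @sgn_swap (a |: e) a t (setU11 _ _) (setU1r a te).
rewrite setU1K // => swp.
have kat: key a != key t.
  by rewrite (clique_key (clique_subset QU cla)) ?setU11 ?setU1r // eq_sym.
rewrite -[sgn t e]mul1r -(sgn_sqr a (a |: e)) -[_ * _ * sgn t e]mulrA (swp kat).
by rewrite mulrN !mulNr -!mulrA sgn_sqr mulr1.
Qed.

(** Adding [v] glues a cone over the link of [v] along this link.  A cocycle is first
    made to vanish on the cliques of [Q] by a primitive extended by zero; what
    remains lives on the cliques through [v], that is, on the link, one degree
    lower. *)
Lemma exact_add Q v d : v |: Q \subset U -> v \notin Q ->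
  exact_below Q d.+1 -> exact_below [set t in Q | adj v t] d ->
  exact_below (v |: Q) d.+1.
Proof.
move=> QU vQ exQ exL r rd f fcyc; set L := [set t in Q | adj v t] in exL.
have sQ : Q \subset v |: Q by apply: subsetUr.
have [g fg] : exists g, forall e, clique Q e -> #|e| = r -> f e = coboundary g e.
  by apply: exQ => // e cl; apply: fcyc; apply: clique_subset cl.
pose g1 e := if v \in e then 0 else g e.
have fg1 e : clique Q e -> #|e| = r -> f e = coboundary g1 e.
  move=> cl er; rewrite fg //; apply: eq_bigr => t te; rewrite /g1 ifN //.
  by case/cliqueP: cl => eQ _; apply: contra vQ => /setD1P[_ /eQ].
pose f1 e := f e - coboundary g1 e.
have f1Q e : clique Q e -> #|e| = r -> f1 e = 0.
  by move=> cl er; rewrite /f1 fg1 // subrr.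
have f1cyc e : clique (v |: Q) e -> #|e| = r.+1 -> coboundary f1 e = 0.
  move=> cl er; have : coboundary f1 e = coboundary f e - coboundary (coboundary g1) e.
    by rewrite /coboundary -sumrB; apply: eq_bigr => t _; rewrite -mulrBr.
  by rewrite (coboundary_coboundary _ (clique_subset QU cl)) fcyc // subr0.
have linkP e : clique (v |: Q) e -> v \in e -> clique L (e :\ v).
  move=> /cliqueP[eQ eadj] ve; apply/cliqueP; split=> [t|s t] /setD1P[tv te].
    rewrite inE; have /setU1P[tv'|->] := eQ t te; first by rewrite tv' eqxx in tv.
    by apply: eadj; rewrite // eq_sym.
  by case/setD1P=> _ te' st; apply: eadj.
have linkU e : clique L e -> (v \notin e) * clique (v |: Q) (v |: e).
  move=> /cliqueP[eL eadj]; split.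
    by apply: contra vQ => /eL; rewrite inE => /andP[].
  apply/cliqueP; split=> [t /setU1P[->|/eL]|]; rewrite ?setU11 //.
    by rewrite inE => /andP[tQ _]; rewrite setU1r.
  move=> s t /setU1P[->|se] /setU1P[->|te] st; rewrite ?eqxx // in st *.
  - by have := eL t te; rewrite inE => /andP[].
  - by have := eL s se; rewrite inE adj_sym => /andP[].
  - exact: eadj.
case: r rd fcyc fg fg1 f1Q f1cyc => [|r] rd fcyc fg fg1 f1Q f1cyc.
  exists g1 => e cl /eqP; rewrite cards_eq0 => /eqP e0; apply: fg1.
    by apply: (clique_sub cl); rewrite e0 sub0set.
  by rewrite e0 cards0.
(* The difference [f1] vanishes on the cliques avoiding [v], so it is a cochain [u]
of the link. *)
pose u e := sgn v (v |: e) * f1 (v |: e).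
have key_v e t : v \notin e -> t \in e -> clique (v |: Q) (v |: e) ->
    sgn t (v |: e) * sgn v (v |: (e :\ t)) = - (sgn v (v |: e) * sgn t e).
  move=> ve te cl; have tv : t != v by apply: contraNneq ve => <-.
  have := @sgn_swap (v |: e) v t (setU11 _ _) (setU1r v te).
  rewrite setU1K // => ->; last first.
    by rewrite (clique_key (clique_subset QU cl)) ?setU11 ?setU1r // eq_sym.
  rewrite opprK; congr (_ * sgn _ _); apply/setP => x; rewrite !inE.
  by case: (eqVneq x v) => [->|] //=; rewrite eq_sym tv.
have ucyc e : clique L e -> #|e| = r.+1 -> coboundary u e = 0.
  move=> cl er; have [ve clv] := linkU e cl.
  have /(f1cyc _ clv) : #|v |: e| = r.+2 by rewrite cardsU1 ve er.
  rewrite /coboundary (big_setD1 v) ?setU11 //= setU1K // f1Q ?er //; last first.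
    by apply: (clique_sub clv); [exact: subsetUr | apply/subsetP => t te;
       case/cliqueP: cl => /(_ _ te); rewrite inE => /andP[]].
  rewrite mulr0 add0r => /(congr1 (fun x => - (sgn v (v |: e) * x))).
  rewrite mulr0 oppr0 => h0; rewrite -[RHS]h0 mulr_sumr -sumrN; apply: eq_bigr => t te.
  have tv : t != v by apply: contraNneq ve => <-.
  have -> : (v |: e) :\ t = v |: (e :\ t).
    by apply/setP => x; rewrite !inE; case: (eqVneq x v) => [->|] //=; rewrite eq_sym tv.
  rewrite /u mulrA mulrA -mulNr; congr (_ * _).
  rewrite -[sgn t e]mul1r -(sgn_sqr v (v |: e)) -[_ * _ * sgn t e]mulrA.
  rewrite -[sgn v (v |: e) * sgn t e]opprK -key_v // mulrN mulNr; congr (- _).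
  by rewrite -!mulrA sgn_sqr mulr1.
have [w uw] := exL r rd u ucyc.
pose g2 e := if v \in e then sgn v e * - w (e :\ v) else 0.
have g2N e : v \notin e -> coboundary g2 e = 0.
  move=> ve; rewrite /coboundary big1 // => t te; rewrite /g2 ifN ?mulr0 //.
  by apply: contra ve => /setD1P[].
exists (fun e => g1 e + g2 e) => e cl er.
have -> : coboundary (fun e => g1 e + g2 e) e = coboundary g1 e + coboundary g2 e.
  by rewrite /coboundary -big_split; apply: eq_bigr => t _; rewrite mulrDr.
have [ve|ve] := boolP (v \in e); last first.
  rewrite g2N // addr0 fg1 //; apply: (clique_sub cl) => //.
  apply/subsetP => t te; case/cliqueP: cl => /(_ t te) /setU1P[tv|//].
  by rewrite -tv te in ve.
apply: (@addIr _ (- coboundary g1 e)); rewrite addrAC subrr add0r.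
rewrite -[LHS]/(f1 e) -{1}(setD1K ve).
have cle := linkP e cl ve; have vD : v \notin e :\ v by rewrite setD11.
have er' : #|e :\ v| = r by apply/eqP; rewrite -eqSS -er (cardsD1 v e) ve.
have := uw _ cle er'; rewrite /u setD1K // => /(congr1 (fun x => sgn v e * x)).
rewrite mulrA sgn_sqr mul1r => ->.
rewrite {2}/coboundary (big_setD1 v) //= {1}/g2 setD11 mulr0 add0r mulr_sumr.
apply: eq_bigr => t /setD1P[tv te]; rewrite /g2 !inE eq_sym tv ve /= mulrA mulrN.
have -> : e :\ t = v |: (e :\ v :\ t).
  by apply/setP => x; rewrite !inE; case: (eqVneq x v) => [->|] //=; rewrite eq_sym tv.
rewrite mulrN mulrA -mulNr.
have := @key_v (e :\ v) t vD; rewrite !inE tv te setD1K // => -> //.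
by rewrite opprK setU1K // !inE eqxx andbF.
Qed.

End InUniverse.
End FlagCohomology.

(** * Homology of a quotient of a flag complex *)

(** The map [face] presents the faces of a boolean complex [X] as classes of cliques.
    By [face_inj] a clique is not folded, so the classes below [face e]
    correspond to the subsets of [e]. *)
Section QuotientOfFlagComplex.

Variables (T V : finType) (le : rel T) (adj : rel V) (k : fieldType).
Variables (X : {set T}) (Q : {set V}) (face : {set V} -> T).
Hypothesis X_def : X = [set face e | e in clique adj Q].
Hypothesis face_le : forall e O, clique adj Q e -> O \in X ->
  le O (face e) = (O \in face @: powerset e).
Hypothesis face_inj : forall e, clique adj Q e -> {in powerset e &, injective face}.
Hypothesis adj_sym : ssrbool.symmetric adj.

Let key t : nat := enum_rank (face [set t]).

Lemma face_key s t : s \in Q -> t \in Q -> s != t -> adj s t -> key s != key t.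
Proof.
move=> sQ tQ st ast.
have cl : clique adj Q [set s; t].
  apply/cliqueP; split=> [x /set2P[]-> //|x y /set2P[]-> /set2P[]->] //.
  - by rewrite eqxx.
  - by move=> _; rewrite adj_sym.
  - by rewrite eqxx.
apply/negP => /eqP/ord_inj/enum_rank_inj/(face_inj cl).
rewrite !inE !sub1set !inE !eqxx orbT => /(_ isT isT)/set1_inj st'.
by rewrite st' eqxx in st.
Qed.

Lemma faceX e : clique adj Q e -> face e \in X.
Proof. by move=> cl; rewrite X_def; apply: imset_f. Qed.

Lemma lower_faces e : clique adj Q e ->
  [set u in X | le u (face e)] = face @: powerset e.
Proof.
move=> cl; apply/setP => O; rewrite inE.
have [OX|OX] /= := boolP (O \in X); first exact: face_le.
apply/esym/negP => /imsetP[e']; rewrite inE => e'e Oe'; case/negP: OX.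
rewrite Oe'; apply: faceX; apply: (clique_sub cl e'e).
by apply: (subset_trans e'e); case/andP: cl.
Qed.

Lemma verticesE e : clique adj Q e -> (face e \in vertices le X) = (#|e| == 1%N).
Proof.
move=> cl; rewrite inE faceX //= lower_faces // card_in_imset; last exact: face_inj.
by rewrite card_powerset -(eqn_exp2l #|e| 1 (isT : (1 < 2)%N)).
Qed.

Lemma vertices_ofE e : clique adj Q e ->
  vertices_of le X (face e) = [set face [set t] | t in e].
Proof.
move=> cl; apply/setP => O; rewrite inE; apply/andP/imsetP => [[OV Oe]|[t te ->]].
  have OX : O \in X by case/setIdP: OV.
  move: Oe; rewrite face_le // => /imsetP[e']; rewrite inE => e'e Oe'.
  have cl' : clique adj Q e'.
    by apply: (clique_sub cl e'e); apply: (subset_trans e'e); case/andP: cl.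
  move: OV; rewrite Oe' verticesE // => /cards1P[t e't]; exists t.
    by rewrite (subsetP e'e) // e't set11.
  by rewrite e't.
have te' : [set t] \subset e by rewrite sub1set.
have cl' : clique adj Q [set t].
  by apply: (clique_sub cl te'); apply: (subset_trans te'); case/andP: cl.
by rewrite verticesE // cards1 face_le ?faceX //; split=> //; apply: imset_f; rewrite inE.
Qed.

Lemma face1_inj e : clique adj Q e -> {in e &, injective (fun t => face [set t])}.
Proof.
move=> cl s t se te /(face_inj cl); rewrite !inE !sub1set => /(_ se te)/set1_inj.
exact.
Qed.

Lemma face_rankE e : clique adj Q e -> face_rank le X (face e) = #|e|.
Proof.
by move=> cl; rewrite /face_rank vertices_ofE // card_in_imset //; apply: face1_inj.
Qed.

Lemma faces_of_rankE r :
  faces_of_rank le X r = [set face e | e in [set e | clique adj Q e & #|e| == r]].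
Proof.
apply/setP => O; rewrite inE; apply/andP/imsetP => [[OX Or]|[e]].
  move: OX Or; rewrite {1}X_def => /imsetP[e cl ->]; rewrite face_rankE // => er.
  by exists e; rewrite // inE er andbT.
by rewrite inE => /andP[cl er] ->; rewrite face_rankE // faceX.
Qed.

Lemma enum_faceP r (a : 'I_#|faces_of_rank le X r|) :
  exists e, [/\ clique adj Q e, #|e| = r & enum_val a = face e].
Proof.
have : enum_val a \in [set face e | e in [set e | clique adj Q e & #|e| == r]].
  by rewrite -faces_of_rankE enum_valP.
by case/imsetP => e; rewrite inE => /andP[cl /eqP er] ->; exists e.
Qed.

Lemma complex_rank_le d :
  (forall e, clique adj Q e -> #|e| <= d)%N -> (complex_rank le X <= d)%N.
Proof.
move=> h; apply/bigmax_leqP => O; rewrite {1}X_def => /imsetP[e cl ->].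
by rewrite face_rankE // h.
Qed.

Lemma facet_positionE e t : clique adj Q e -> t \in e ->
  facet_position le X (face e) (face (e :\ t)) = #|[set w in e | key w < key t]%N|.
Proof.
move=> cl te; have cl' := cliqueD1 t cl.
rewrite /facet_position !vertices_ofE //.
have -> : [set face [set t0] | t0 in e] :\: [set face [set t0] | t0 in e :\ t]
    = [set face [set t]].
  apply/setP => O; rewrite !inE; apply/andP/eqP => [[/negP nO /imsetP[s se Os]]|->].
    have [<- //|st] := eqVneq s t; case: nO; rewrite Os.
    by apply: (imset_f (fun x => face [set x])); rewrite !inE st.
  split; last exact: (imset_f (fun x => face [set x])).
  apply/negP => /imsetP[s]; rewrite !inE => /andP[st se] /(face1_inj cl te se) ts.
  by rewrite ts eqxx in st.
rewrite -(@card_in_imset _ _ (fun t => face [set t])); last first.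
  by move=> x y; rewrite !inE => /andP[xe _] /andP[ye _]; apply: (face1_inj cl).
apply: eq_card => O; rewrite !inE; apply/andP/imsetP => [[/imsetP[s se ->]]|].
  case/exists_inP => O'; rewrite inE => /eqP-> lt_s; exists s => //.
  by rewrite inE se.
case=> s; rewrite inE => /andP[se lt_s] ->; split.
  exact: (imset_f (fun x => face [set x])).
by apply/exists_inP; exists (face [set t]); rewrite ?inE.
Qed.

(** The order of the vertices of a face by [enum_rank] is, through [face], the order
    by [key]. *)
Lemma boundary_coboundary r (f : 'cV[k]_#|faces_of_rank le X r|) (F : T -> k) e :
  (forall j, F (enum_val j) = f j 0) ->
  forall i : 'I_#|faces_of_rank le X r.+1|, enum_val i = face e ->
  clique adj Q e ->
  (boundary le k X r *m f) i 0 = coboundary key (fun e => F (face e)) e.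
Proof.
move=> Ff i ie cl.
have er : #|e| = r.+1.
  by have := enum_valP i; rewrite ie inE face_rankE // => /andP[_ /eqP].
rewrite mxE (eq_bigr (fun j => (if le (enum_val j) (face e) then
   (-1) ^+ facet_position le X (face e) (enum_val j) else 0) * F (enum_val j))); last first.
  by move=> j _; rewrite !mxE ie Ff.
rewrite -(big_enum_val (fun O => (if le O (face e) then
   (-1) ^+ facet_position le X (face e) O else 0) * F O)) /=.
rewrite (bigID (fun O => le O (face e))) /= [X in _ + X]big1 ?addr0; last first.
  by move=> O /andP[_ /negPf->]; rewrite mul0r.
have sub t : t \in e -> e :\ t \in powerset e by rewrite inE subD1set.
rewrite (eq_bigl (mem [set face (e :\ t) | t in e])); last first.
  move=> O; apply/andP/imsetP => [[]|[t te ->]].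
    rewrite inE => /andP[OX Or]; rewrite face_le // => /imsetP[e'].
    rewrite inE => e'e Oe'.
    have cl' : clique adj Q e'.
      by apply: (clique_sub cl e'e); apply: (subset_trans e'e); case/andP: cl.
    move: Or; rewrite Oe' face_rankE // => /eqP er'.
    have /cards1P[t et] : #|e :\: e'| == 1%N by rewrite cardsDS // er er' subSnn.
    exists t; first by have := set11 t; rewrite -et inE => /andP[].
    by rewrite -et setDDr setDv set0U (setIidPr e'e).
  rewrite inE faceX ?face_rankE ?cliqueD1 //; split.
    by apply/eqP/eq_add_S; rewrite -er (cardsD1 t e) te.
  by rewrite face_le ?faceX ?cliqueD1 // imset_f // sub.
rewrite big_imset /=; last first.
  move=> s t se te /(face_inj cl (sub _ se) (sub _ te)) /setP/(_ t).
  by rewrite !inE eqxx te /= andbT => /negbFE/eqP.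
apply: eq_bigr => t te; rewrite face_le ?faceX ?cliqueD1 // imset_f ?sub //.
by rewrite facet_positionE.
Qed.

Variables (gT : finGroupType) (K : {group gT}) (to : {action gT &-> V}).
Hypothesis face_inv : forall e h, clique adj Q e -> h \in K ->
  clique adj Q (to^*%act e h) /\ face (to^*%act e h) = face e.
Hypothesis face_orbit : forall e e', clique adj Q e -> clique adj Q e' ->
  face e = face e' -> exists2 h, h \in K & to^*%act e h = e'.
Hypothesis K_unit : #|K|%:R != 0 :> k.

(** The key is constant on orbits, so the group preserves the signs. *)
Lemma coboundary_act (g : {set V} -> k) e : clique adj Q e ->
  (forall h, h \in K -> coboundary key g (to^*%act e h) =
    coboundary key (fun e' => g (to^*%act e' h)) e).
Proof.
move=> cl h hK.
have keyh s : s \in e -> key (to s h) = key s.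
  move=> se; rewrite /key; congr (nat_of_ord (enum_rank _)).
  have se' : [set s] \subset e by rewrite sub1set.
  have cl1 : clique adj Q [set s].
    by apply: (clique_sub cl se'); apply: (subset_trans se'); case/andP: cl.
  by have [_ <-] := face_inv cl1 hK; congr face; rewrite /= /setact imset_set1.
rewrite /coboundary /= /setact big_imset /=; last by move=> s t _ _; apply: act_inj.
apply: eq_bigr => t te; congr (_ * g _); last first.
  apply/setP => x; rewrite in_setD1; apply/andP/imsetP => [[xt /imsetP[y ye xy]]|[y]].
    by exists y; rewrite // in_setD1 ye andbT; apply: contraNneq xt => <-; apply/eqP.
  by case/setD1P=> yt ye ->; split; [rewrite (inj_eq (act_inj to h)) | apply: (imset_f (fun x => to x h))].
rewrite /sgn; congr (_ ^+ _).
rewrite -[RHS](card_imset _ (act_inj to h)); apply: eq_card => w.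
rewrite !inE; apply/andP/imsetP => [[/imsetP[s se ->]]|[s]].
  by rewrite !keyh // => lt; exists s; rewrite // inE se.
by rewrite inE => /andP[se lt] ->; rewrite !keyh //; split=> //; apply: (imset_f (fun x => to x h)).
Qed.

(** A cocycle of [X] pulls back to the flag complex, has a primitive there, and the
    average of this primitive over [K] descends.  Exactness of the cochains of [X]
    in one degree gives that of the chains by a factorisation of [cokermx]. *)
Lemma quotient_homology_vanishes r :
  exact_at adj key k Q r -> reduced_homology_vanishes le k X r.
Proof.
move=> ex; rewrite /reduced_homology_vanishes.
pose N := faces_of_rank le X r.
have faceN e : clique adj Q e -> #|e| = r -> face e \in N.
  by move=> cl er; rewrite /N faces_of_rankE imset_f // inE cl er eqxx.
have cochain (f : 'cV[k]_#|N|) :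
    exists F : T -> k, forall j, F (enum_val j) = f j 0.
  exists (fun O => if [pick j | enum_val j == O] is Some j then f j 0 else 0) => j.
  case: pickP => [j' /eqP/enum_val_inj-> //|/(_ j)]; by rewrite eqxx.
(* dually: every cocycle, seen as a column vector, is a coboundary *)
have dual (f : 'cV[k]_#|N|) : boundary le k X r *m f = 0 ->
    exists g : {set V} -> k,
      (forall e h, clique adj Q e -> h \in K -> g (to^*%act e h) = g e) /\
      (forall e (j : 'I_#|N|), clique adj Q e -> #|e| = r ->
        enum_val j = face e -> f j 0 = coboundary key g e).
  move=> fcyc; have [F Ff] := cochain f.
  have [|g Fg] := ex (fun e => F (face e)).
    move=> e cl er.
    have eN : face e \in faces_of_rank le X r.+1.
      by rewrite faces_of_rankE imset_f // inE cl er eqxx.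
    have := boundary_coboundary Ff (enum_rankK_in eN eN) cl.
    by rewrite fcyc mxE => <-.
  exists (fun e => #|K|%:R^-1 * \sum_(h in K) g (to^*%act e h)); split.
    move=> e h cl hK; congr (_ * _).
    rewrite (reindex_inj (mulgI h^-1%g)) /=; apply: eq_big => x.
      by rewrite groupMl ?groupV.
    by move=> _; congr g; rewrite actM actK.
  move=> e j cl er je; rewrite -Ff je.
  transitivity (#|K|%:R^-1 * \sum_(h in K) F (face (to^*%act e h))).
    rewrite (eq_bigr (fun=> F (face e))) => [|h hK]; last by case: (face_inv cl hK) => _ ->.
    by rewrite sumr_const -[F _ *+ _]mulr_natl mulKf.
  rewrite (eq_bigr (fun h => coboundary key g (to^*%act e h))); last first.
    move=> h hK; have [cl' _] := face_inv cl hK; apply: Fg => //.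
    by rewrite /= card_setact.
  rewrite (eq_bigr _ (fun h hK => coboundary_act g cl hK)) /coboundary exchange_big /=.
  rewrite mulr_sumr; apply: eq_bigr => t te.
  by rewrite -mulr_sumr mulrCA.
have cokerK i : boundary le k X r *m col i (cokermx (boundary le k X r)) = 0.
  by rewrite colE mulmxA mulmx_coker mul0mx.
rewrite /cycles submxE; apply/eqP; rewrite {}/N in faceN cochain dual.
case: r ex faceN cochain dual cokerK => [|r] ex faceN cochain dual cokerK.
  rewrite mul1mx; apply/matrixP => a i; rewrite [RHS]mxE.
  have [g [_ gP]] := dual _ (cokerK i).
  have [e [cl er ae]] := enum_faceP a.
  have := gP e a cl er ae; rewrite mxE => ->.
  by move/eqP: er; rewrite cards_eq0 => /eqP->; rewrite /coboundary big_set0.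
apply/matrixP => a i; rewrite [RHS]mxE.
have [g [ginv gP]] := dual _ (cokerK i).
pose M := faces_of_rank le X r.
have [G Gg] : exists G : T -> k, forall e, clique adj Q e -> #|e| = r -> G (face e) = g e.
  exists (fun O => if [pick e | clique adj Q e && (face e == O)] is Some e
                   then g e else 0) => e cl er.
  case: pickP => [e' /andP[cl' /eqP ee']|/(_ e)]; last by rewrite cl eqxx.
  by have [h hK <-] := face_orbit cl' cl ee'; rewrite ginv.
pose w : 'cV[k]_#|M| := \col_j G (enum_val j).
have coker_eq : col i (cokermx (boundary le k X r.+1)) = boundary le k X r *m w.
  apply/colP => j; have [e [cl er je]] := enum_faceP j; rewrite (gP e j cl er je).
  rewrite (@boundary_coboundary r w G e _ j je cl); last by move=> j'; rewrite mxE.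
  apply: eq_bigr => t te; rewrite Gg ?cliqueD1 //.
  by apply/eq_add_S; rewrite -er (cardsD1 t e) te.
have : (kermx (boundary le k X r) *m (boundary le k X r *m w)) a 0 = 0.
  by rewrite mulmxA mulmx_ker mul0mx mxE.
rewrite -coker_eq => <-; rewrite mxE [RHS]mxE; apply: eq_bigr => j _.
by congr (_ * _); rewrite [RHS]mxE.
Qed.

End QuotientOfFlagComplex.

(** * Links in families of sets with an exchange property *)

Section ChainsOfSets.

Variable T : finType.
Implicit Types (x y z t : {set T}) (c : {set {set T}}).

Definition comparable_sets x y : bool := (x \subset y) || (y \subset x).
Local Notation adj := comparable_sets.

Lemma comparable_sets_sym : ssrbool.symmetric adj.
Proof. by move=> x y; rewrite /adj orbC. Qed.

Lemma comparable_sets_card x y : adj x y -> (#|x| <= #|y|)%N -> x \subset y.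
Proof.
case/orP=> // yx xy; suff -> : x = y by [].
by apply/eqP; rewrite eq_sym eqEcard yx.
Qed.

Variable W : {set {set T}}.

(** The vertices of the link of the flag [c]. *)
Definition refiners c : {set {set T}} :=
  [set z in W | (z \notin c) && [forall x in c, adj x z]].

Lemma refinersP c z : reflect
  [/\ z \in W, z \notin c & forall x, x \in c -> adj x z] (z \in refiners c).
Proof.
rewrite inE; apply: (iffP and3P) => [[zW zc /forall_inP]|[zW zc h]]; split=> //.
exact/forall_inP.
Qed.

Hypothesis W_exchange : forall x y, x \in W -> y \in W -> x \proper y ->
  exists2 i, i \in y :\: x &
    forall z, z \in W -> x \subset z -> z \subset y -> i |: z \in W.

(** The bottom and the top are included, so that every gap of a flag is bounded on
    both sides by members of the flag. *)
Definition is_flag c : Prop :=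
  [/\ c \subset W, set0 \in c, setT \in c & forall x y, x \in c -> y \in c -> adj x y].

(** With at most [#|T|] members some size between [0] and [#|T|] is skipped. *)
Lemma flag_gap c : is_flag c -> (#|c| <= #|T|)%N ->
  exists x y, [/\ x \in c, y \in c, (#|x|.+1 < #|y|)%N, x \subset y &
    forall t, t \in c -> t \subset x \/ y \subset t].
Proof.
move=> [cW c0 cT cadj] cT_le.
have [s sP] : exists s : 'I_#|T|.+1, [forall t in c, #|t| != s].
  apply/existsP; apply: contraLR cT_le; rewrite negb_exists -ltnNge => /forallP h.
  have sub : [set: 'I_#|T|.+1] \subset (fun t => inord #|t|) @: c.
    apply/subsetP => s _; have := h s.
    rewrite negb_forall_in => /exists_inP[t tc /negPn/eqP ts].
    by apply/imsetP; exists t => //; apply/val_inj; rewrite /= inordK ?ts.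
  have := subset_leq_card sub; rewrite cardsT card_ord => /leq_trans; apply.
  exact: leq_imset_card.
have {}sP t : t \in c -> #|t| != s by move: t; apply/forall_inP.
have P0 : (set0 \in c) && (#|@set0 T| < s)%N.
  by rewrite c0 ltn_neqAle sP // cards0.
have PT : (setT \in c) && (s < #|[set: T]|)%N.
  by rewrite cT ltn_neqAle eq_sym sP // cardsT -ltnS ltn_ord.
have [x /andP[xc xs] xmax] := arg_maxnP (fun x => #|x|) (P0 : [pred t | (t \in c) && (#|t| < s)%N] set0).
have [y /andP[yc ys] ymin] := arg_minnP (fun x => #|x|) (PT : [pred t | (t \in c) && (s < #|t|)%N] setT).
exists x, y; split=> //.
- exact: leq_ltn_trans xs ys.
- by apply: comparable_sets_card; [apply: cadj | apply: ltnW (ltn_trans xs ys)].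
move=> t tc; case: (ltngtP #|t| s) => [ts|ts|/eqP]; last by rewrite (negPf (sP t tc)).
  by left; apply: comparable_sets_card; [apply: cadj | apply: xmax; rewrite /= tc].
by right; apply: comparable_sets_card; [apply: cadj | apply: ymin; rewrite /= tc].
Qed.

Variables (key : {set T} -> nat) (k : fieldType) (U : {set {set T}}).
Hypothesis key_inj : forall s t, s \in U -> t \in U -> s != t -> adj s t ->
  key s != key t.

(** Choose a gap [x < y] and [i] that can be added to [x].  The refiners outside the
    gap or containing [i] form a cone with apex [i |: x].  A set [z] of the gap
    with [i |: z] different from [y] is then added, the small ones first, so that
    its link at that stage is a cone with apex [i |: z].  At most [y :\ i] is left,
    and its link consists of the refiners of a larger flag. *)
Lemma refiners_exact d c : is_flag c -> refiners c \subset U ->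
  (#|c| + d)%N = #|T|.+1 ->
  exact_below adj key k (refiners c) d.
Proof.
elim: d c => [|d IHd] c flc cU cd; first by [].
have [cW c0 cT cadj] := flc.
have [|x [y [xc yc xy sxy gapc]]] := flag_gap flc.
  by rewrite -ltnS -cd -addSnnS leq_addr.
have [] := @W_exchange x y; rewrite ?(subsetP cW) // ?properEcard ?sxy ?(ltnW xy) //.
move=> i /setDP[iy ix] iW.
pose gap z := (x \subset z) && (z \subset y).
have gapQ z : z \in refiners c -> [\/ z \subset x, y \subset z | gap z].
  move=> /refinersP[_ _ h]; rewrite /gap.
  case/orP: (h x xc) => xz; last by constructor 1.
  by case/orP: (h y yc) => yz; [constructor 2 | constructor 3; rewrite xz].
have gap_adj z t : gap z -> t \in refiners c -> ~~ gap t -> adj z t.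
  move=> /andP[xz zy] tQ gt; case: (gapQ t tQ) => [tx|yt|]; last by rewrite (negPf gt).
    by rewrite /adj (subset_trans tx xz) orbT.
  by rewrite /adj (subset_trans zy yt).
have addQ z : z \in W -> gap z -> i |: z != y -> (i |: z \in refiners c) /\ gap (i |: z).
  move=> zW /andP[xz zy] izy.
  have iz_y : i |: z \subset y by rewrite subUset sub1set iy.
  have x_iz : x \subset i |: z by rewrite (subset_trans xz) ?subsetUr.
  split; last by rewrite /gap x_iz.
  apply/refinersP; split=> [||t tc]; first exact: iW.
  - apply/negP => /gapc[/subsetP/(_ i (setU11 _ _))|y_iz]; first exact/negP.
    by rewrite eqEsubset iz_y y_iz in izy.
  - case: (gapc t tc) => [tx|yt]; first by rewrite /adj (subset_trans tx x_iz).
    by rewrite /adj (subset_trans iz_y yt) orbT.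
have ax : i |: x != y.
  by apply: contraTneq xy => <-; rewrite cardsU1 ix add1n ltnn.
have [aQ agap] : (i |: x \in refiners c) /\ gap (i |: x).
  by apply: addQ; rewrite ?(subsetP cW) // /gap subxx.
pose Q0 := [set z in refiners c | ~~ gap z || (i \in z)].
pose Z := [set z in refiners c | [&& gap z, i \notin z & i |: z != y]].
have Q0E z : (z \in Q0) = (z \in refiners c) && (~~ gap z || (i \in z)).
  by rewrite /Q0 in_set.
have ZE z : (z \in Z) = (z \in refiners c) && [&& gap z, i \notin z & i |: z != y].
  by rewrite /Z in_set.
have Q0Z (B : {set {set T}}) : B \subset Z -> Q0 :|: B \subset refiners c.
  move=> /subsetP BZ; apply/subsetP => z /setUP[/setIdP[]//|/BZ /setIdP[]//].
have ex0 (B : {set {set T}}) : B \subset Z -> forall r, exact_at adj key k (Q0 :|: B) r.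
  elim: {B}_.+1 {-2}B (ltnSn #|B|) => // N IHN B BN BZ r.
  have [B0|[z0 z0B]] := set_0Vmem B.
    have QU : Q0 :|: B \subset U by apply: subset_trans cU; apply: Q0Z.
    apply: (exact_cone key_inj comparable_sets_sym QU (a := i |: x)) => [|t].
      by rewrite in_setU Q0E aQ setU11 orbT.
    rewrite B0 setU0 => /setIdP[tQ]; have [gt|gt] /= := boolP (gap t); last first.
      by move=> _ _; apply: gap_adj.
    case/andP: gt => xt ty it _; by rewrite /adj subUset sub1set it xt.
  have [z zB zmax] := arg_maxnP (fun x => #|x|) (z0B : mem B z0).
  have := subsetP BZ z zB; rewrite ZE => /and4P[zQ gz iz izy].
  have [zW _ _] := refinersP _ _ zQ.
  have [izQ gapiz] := addQ z zW gz izy.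
  have izQ0 : i |: z \in Q0 by rewrite Q0E izQ setU11 orbT.
  have B1Z : B :\ z \subset Z by apply: subset_trans BZ; apply: subD1set.
  have zQ' : z \notin Q0 :|: B :\ z by rewrite in_setU Q0E in_setD1 zQ gz (negPf iz) eqxx.
  have BE : Q0 :|: B = z |: (Q0 :|: B :\ z).
    by rewrite setUCA setD1K.
  rewrite BE; apply: (exact_add key_inj comparable_sets_sym) (ltnSn r) => //.
  - by rewrite -BE; apply: subset_trans cU; apply: Q0Z.
  - by move=> r' _; apply: IHN => //; move: BN; rewrite (cardsD1 z) (zB : z \in B).
  move=> r' _; apply: (exact_cone key_inj comparable_sets_sym (a := i |: z)).
  - apply: subset_trans cU; apply: subset_trans (Q0Z _ B1Z).
    by apply/subsetP => t /setIdP[].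
  - by rewrite inE (subsetP (subsetUl _ _)) // /adj subsetUr.
  move=> t /setIdP[/setUP[/setIdP[tQ it]|/setD1P[tz tB]] zt] tiz; last first.
    have {}zt : t \subset z by apply: comparable_sets_card (zmax t tB); rewrite comparable_sets_sym.
    by rewrite /adj (subset_trans zt) ?subsetUr ?orbT.
  have [gt|gt] := boolP (gap t); last exact: gap_adj.
  rewrite gt /= in it; case/orP: zt => [zt|tz]; first by rewrite /adj subUset sub1set it zt.
  by have := subsetP tz i it; rewrite (negPf iz).
pose w := y :\ i.
have wE z : gap z -> i \notin z -> i |: z = y -> z = w.
  by move=> _ iz izy; rewrite /w -izy setU1K.
have QE z : z \in refiners c -> z \in Q0 :|: Z \/ z = w.
  move=> zQ; rewrite in_setU Q0E ZE zQ /=.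
  have [gz|gz] /= := boolP (gap z); last by left.
  have [iz|iz] /= := boolP (i \in z); first by left.
  by have [/wE|] := eqVneq (i |: z) y; [right; auto | left].
have [wQ|wQ] := boolP (w \in refiners c); last first.
  have -> : refiners c = Q0 :|: Z.
    apply/eqP; rewrite eqEsubset (Q0Z _ (subxx _)) andbT; apply/subsetP => z zQ.
    by case: (QE z zQ) => // zw; rewrite -zw zQ in wQ.
  by move=> r _; apply: ex0.
have iw : i \notin w by rewrite !inE eqxx.
have gw : gap w.
  rewrite /gap subD1set andbT; apply/subsetP => t tx; rewrite !inE (subsetP sxy) // andbT.
  by apply: contraNneq ix => <-.
have wN : w \notin Q0 :|: Z by rewrite in_setU Q0E ZE wQ gw (negPf iw) /w setD1K // eqxx.
have QwE : refiners c = w |: (Q0 :|: Z).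
  apply/eqP; rewrite eqEsubset; apply/andP; split; apply/subsetP => z.
    by case/QE => [zQ|->]; rewrite ?setU11 // setU1r.
  by case/setU1P => [->//|]; apply/subsetP/Q0Z.
rewrite {1}QwE; apply: (exact_add key_inj comparable_sets_sym) => //.
- by rewrite -QwE.
- by move=> r _; apply: ex0.
have [wW wc wadj] := refinersP _ _ wQ.
have -> : [set t in Q0 :|: Z | adj w t] = refiners (w |: c).
  apply/setP => t; rewrite inE; apply/andP/refinersP => [[tQ wt]|[tW tc h]].
    have /refinersP[tW tc h] := subsetP (Q0Z _ (subxx _)) t tQ.
    split=> // [|s /setU1P[->//|]]; last exact: h.
    by apply/setU1P => -[tw|]; [rewrite -tw tQ in wN | apply/negP].
  split; last by apply: h; rewrite setU11.
  case: (QE t) => // [|tw]; last by rewrite tw setU11 in tc.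
  apply/refinersP; split=> // [|s sc]; last by apply: h; rewrite setU1r.
  by apply: contra tc; apply: setU1r.
apply: IHd.
- split=> [|||s t].
  + by rewrite subUset sub1set wW.
  + by rewrite setU1r.
  + by rewrite setU1r.
  + case/setU1P=> [->|sc] /setU1P[->|tc]; last exact: cadj.
    * by rewrite /adj subxx.
    * by rewrite comparable_sets_sym; apply: wadj.
    * exact: wadj.
- apply: subset_trans cU; apply/subsetP => t /refinersP[tW tc h].
  apply/refinersP; split=> // [|s sc]; last by apply: h; rewrite setU1r.
  by apply: contra tc; apply: setU1r.
- by rewrite cardsU1 wc -cd add1n addSnnS.
Qed.

End ChainsOfSets.

(** * The wreath product and its rows *)

Section Wreath.

Variables (l m : nat).
Hypothesis l_gt0 : (0 < l)%N.
Local Notation n := (l * m)%N.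
Implicit Types (i j : 'I_n) (g h : 'S_n) (A : {set 'I_n}).

Definition same_row i j : bool := (i %/ l == j %/ l)%N.

Lemma same_row_trans i j j' : same_row i j -> same_row j j' -> same_row i j'.
Proof. by rewrite /same_row => /eqP->. Qed.

Lemma row_lt i : (i %/ l < m)%N.
Proof. by have := ltn_ord i; rewrite [X in (_ < X)%N]mulnC -ltn_divLR. Qed.

Lemma same_row_pos_inj i j : same_row i j -> (i %% l = j %% l)%N -> i = j.
Proof.
by move=> /eqP rij pij; apply/val_inj; rewrite /= (divn_eq i l) (divn_eq j l) rij pij.
Qed.

Lemma cell_proof i j : (i %/ l * l + j %% l < n)%N.
Proof.
have := row_lt i; move: (i %/ l)%N => r rm.
apply: (@leq_trans (r.+1 * l)); first by rewrite mulSn addnC ltn_add2r ltn_mod.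
by rewrite mulnC leq_mul2l rm orbT.
Qed.

(** The element in the row of [i] at the position of [j]. *)
Definition cell i j : 'I_n := Ordinal (cell_proof i j).

Lemma cell_row i j : same_row (cell i j) i.
Proof. by rewrite /same_row /= divnMDl // [(_ %% _ %/ _)%N]divn_small ?addn0 ?ltn_mod. Qed.

Lemma cell_pos i j : (cell i j %% l = j %% l)%N.
Proof. by rewrite /= modnMDl modn_mod. Qed.

Lemma row_leq i j : same_row i j -> (i <= j)%N = (i %% l <= j %% l)%N.
Proof.
by move=> /eqP rij; rewrite {1}(divn_eq i l) {1}(divn_eq j l) rij leq_add2l.
Qed.

Lemma wreathP g :
  reflect (forall i j, same_row (g i) (g j) = same_row i j) (g \in wreath l m).
Proof.
have imp g' : g' \in wreath l m -> forall i j, same_row i j -> same_row (g' i) (g' j).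
  move=> g'G i j ij.
  have Rrow : [set j' : 'I_n | j' %/ l == i %/ l]%N \in wreath_rows l m.
    by apply/imsetP; exists (Ordinal (row_lt i)).
  have := astabs_act [set j' : 'I_n | j' %/ l == i %/ l]%N g'G.
  rewrite Rrow => /imsetP[r _ /setP rE].
  have mem i' : same_row i' i -> (g' i' %/ l == r)%N.
    move=> i'i; have := rE (g' i'); rewrite inE => <-.
    by apply: (imset_f (fun x => aperm x g')); rewrite inE.
  by rewrite /same_row (eqP (mem i _)) ?/same_row // (eqP (mem j _)) ?/same_row // eq_sym.
apply: (iffP idP) => [gG i j|h].
  apply/idP/idP; last exact: imp.
  by move/(imp _ (groupVr gG)); rewrite !permK.
rewrite !inE; apply/subsetP => R /imsetP[r _ ->]; rewrite inE.
have lr : (r * l < n)%N by rewrite mulnC ltn_mul2l l_gt0 ltn_ord.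
pose i0 : 'I_n := Ordinal lr.
have ri0 : (i0 %/ l = r)%N by rewrite /= mulnK.
apply/imsetP; exists (Ordinal (row_lt (g i0))) => //; apply/setP => j; rewrite inE /=.
apply/imsetP/eqP => [[i]|jr].
  rewrite inE /= -ri0 => ii0 ->; apply/eqP; rewrite -/(same_row (g i) (g i0)) h //.
exists (g^-1%g j); last by rewrite /= apermE permKV.
by rewrite inE -ri0 -/(same_row (g^-1%g j) i0) -h permKV /same_row jr.
Qed.

(** This complement of the group acting inside the rows is also the stabiliser in the
    wreath product of the monomial whose exponents are the positions. *)
Definition position_set : {set 'S_n} :=
  [set g in wreath l m | [forall i, g i %% l == i %% l]%N].

Lemma position_group_set : group_set position_set.
Proof.
apply/group_setP; split=> [|g h].
  by apply/setIdP; rewrite group1; split=> //; apply/forallP => i; rewrite perm1.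
move=> /setIdP[gG /forallP gp] /setIdP[hG /forallP hp]; apply/setIdP.
by split; [rewrite groupM | apply/forallP => i; rewrite permM (eqP (hp _))].
Qed.

Canonical position_group : {group 'S_n} := Group position_group_set.

Lemma position_groupP g : reflect
  (g \in wreath l m /\ forall i, (g i %% l = i %% l)%N) (g \in position_group).
Proof.
by apply: (iffP setIdP) => [[gG /forallP h]|[gG h]]; split=> //;
  [move=> i; apply/eqP | apply/forallP => i; rewrite h].
Qed.

Lemma position_group_sub : position_group \subset wreath l m.
Proof. by apply/subsetP => g /position_groupP[]. Qed.

Lemma card_position_class i : (#|[set j : 'I_n | j %% l == i %% l]%N| <= m)%N.
Proof.
rewrite -[X in (_ <= X)%N]card_ord.
rewrite -(@card_in_imset _ _ (fun j => Ordinal (row_lt j))) ?max_card //.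
move=> j j'; rewrite !inE => /eqP ji /eqP j'i [jj'].
by apply: same_row_pos_inj; rewrite ?ji ?j'i // /same_row jj'.
Qed.

(** An element of order [p] would have an orbit with [p] elements, all at the same
    position, whereas only [m] elements share a position. *)
Lemma position_group_card p : prime p -> (m < p)%N -> ~~ (p %| #|position_group|)%N.
Proof.
move=> p_pr mp; apply/negP => /(Cauchy p_pr)[g gH gp].
have [gG pos] := position_groupP _ gH.
have /eqP[] : g != 1%g by rewrite -order_eq1 gp; case: p p_pr {mp gp} => [|[]].
apply/permP => i; rewrite perm1; apply/eqP; apply: contraLR mp => gi.
rewrite -leqNgt; apply: leq_trans (card_position_class i).
have orb : #|orbit 'P <[g]> i| = p.
  have : (#|orbit 'P <[g]> i| %| p)%N by rewrite -[X in (_ %| X)%N]gp dvdn_orbit.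
  case/primeP: (p_pr) => _ pd /pd/orP[/eqP o1|/eqP//].
  have iO := orbit_refl 'P <[g]> i.
  have giO : g i \in orbit 'P <[g]> i.
    by rewrite -[g i]/('P%act i g); apply: mem_orbit; apply: cycle_id.
  by move: giO; rewrite (card_orbit1 o1) inE (negPf gi).
rewrite -orb; apply: subset_leq_card; apply/subsetP => j /orbitP[h hg <-].
have /position_groupP[_ hpos] : h \in position_group.
  by apply: (subsetP _ h hg); rewrite cycle_subG.
by rewrite inE /= hpos.
Qed.

(** A fundamental domain for the permutations inside the rows, closed under union and
    intersection. *)
Definition row_initial : {set {set 'I_n}} :=
  [set A : {set 'I_n} |
     [forall i in A, forall j, same_row j i && (j <= i)%N ==> (j \in A)]].

Lemma row_initialP A : reflect
  (forall i j, i \in A -> same_row j i -> (j <= i)%N -> j \in A)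
  (A \in row_initial).
Proof.
rewrite inE; apply: (iffP forall_inP) => [h i j iA ji lji|h i iA].
  by have /forallP/(_ j) := h i iA; rewrite ji lji.
by apply/forallP => j; apply/implyP => /andP[]; apply: h.
Qed.

(** The least element of the difference can always be added. *)
Lemma row_initial_exchange A B : A \in row_initial -> B \in row_initial ->
  A \proper B -> exists2 i, i \in B :\: A &
    forall C, C \in row_initial -> A \subset C -> C \subset B -> i |: C \in row_initial.
Proof.
move=> AW /row_initialP BW /properP[_ [i0 i0B i0A]].
have P0 : i0 \in [pred i | i \in B :\: A] by rewrite !inE i0A i0B.
have [i /= iBA imin] := arg_minnP (fun i => nat_of_ord i) P0.
exists i => // C /row_initialP CW /subsetP AC CB; apply/row_initialP => x y.
have /setDP[iB iA] := iBA.
case/setU1P=> [->|xC] yx lyx; last by rewrite setU1r // (CW x).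
have [yA|yA] := boolP (y \in A); first by rewrite setU1r ?AC.
have : (i <= y)%N by apply: imin; rewrite /= !inE yA (BW i).
by move=> iy; apply/setU1P; left; apply/val_inj/eqP; rewrite eqn_leq lyx.
Qed.

Lemma row_initial_act A g : A \in row_initial -> g \in position_group ->
  g @: A \in row_initial.
Proof.
move=> /row_initialP AW /position_groupP[/wreathP gG gp]; apply/row_initialP => i j.
move=> /imsetP[i' i'A ->]; rewrite -(permKV g j); move: (g^-1%g j) => j'.
rewrite gG => ji; rewrite row_leq ?gG // !gp -row_leq // => lji.
by apply: imset_f; apply: AW lji.
Qed.

(** Initial segments of a row are determined by their size. *)
Lemma row_initial_eq A B : A \in row_initial -> B \in row_initial ->
  (forall i, #|[set j in A | same_row j i]| = #|[set j in B | same_row j i]|) -> A = B.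
Proof.
suff sub A' B' : A' \in row_initial -> B' \in row_initial ->
  (forall i, #|[set j in A' | same_row j i]| = #|[set j in B' | same_row j i]|) ->
  A' \subset B'.
  by move=> AW BW cAB; apply/eqP; rewrite eqEsubset !sub.
move=> /row_initialP AW /row_initialP BW cAB; apply/subsetP => i iA.
apply: contraT => iB; have /proper_card : [set j in B' | same_row j i] \proper [set j in A' | same_row j i].
  apply/properP; split; last by exists i; rewrite ?inE ?iA ?(negPf iB) /same_row ?eqxx.
  apply/subsetP => j; rewrite !inE => /andP[jB ji]; rewrite ji andbT.
  apply: (AW i) => //; rewrite leqNgt; apply/negP => /ltnW lij.
  by case/negP: iB; apply: (BW j) => //; rewrite /same_row eq_sym.
by rewrite cAB ltnn.
Qed.

Lemma same_row_sym i j : same_row i j = same_row j i.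
Proof. exact: eq_sym. Qed.

(** Keep the effect of [g] on the rows and forget its effect on the positions: the
    images of row-initial sets meet each row in segments of the same size. *)
Lemma row_initial_transport (c : {set {set 'I_n}}) g : g \in wreath l m ->
  {in c, forall A, A \in row_initial} -> {in c, forall A, g @: A \in row_initial} ->
  exists2 h, h \in position_group & {in c, forall A, h @: A = g @: A}.
Proof.
move=> /wreathP gG cW gcW.
have inj : injective (fun i => cell (g i) i).
  move=> i j ij; apply: same_row_pos_inj; last first.
    by rewrite -(cell_pos (g i) i) -(cell_pos (g j) j) ij.
  rewrite -gG; apply: (@same_row_trans _ (cell (g i) i)).
    by rewrite same_row_sym cell_row.
  by rewrite ij cell_row.
pose h := perm inj.
have hg i : same_row (h i) (g i) by rewrite permE cell_row.
have hH : h \in position_group.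
  apply/position_groupP; split; last by move=> i; rewrite permE cell_pos.
  apply/wreathP => i j; rewrite -(gG i j); apply/idP/idP => hij.
    apply: (@same_row_trans _ (h i)); last exact: same_row_trans hij (hg j).
    by rewrite same_row_sym.
  by apply: (same_row_trans (hg i)); apply: (same_row_trans hij); rewrite same_row_sym.
exists h => // A Ac; apply: row_initial_eq; [exact: row_initial_act (cW _ Ac) hH|exact: gcW|].
have cardE (f : 'S_n) i : #|[set j in f @: A | same_row j i]| = #|[set j in A | same_row (f j) i]|.
  rewrite -(card_imset [set j in A | same_row (f j) i] (@perm_inj _ f)).
  apply: eq_card => j; rewrite inE; apply/andP/imsetP => [[/imsetP[j' j'A ->] ji]|[j']].
    by exists j'; rewrite // inE j'A.
  by rewrite inE => /andP[j'A j'i] ->; split=> //; apply: imset_f.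
move=> i; rewrite !cardE; apply: eq_card => j; rewrite !inE; congr (_ && _).
apply/idP/idP; apply: same_row_trans; first by rewrite same_row_sym.
exact: hg.
Qed.

(** Choose [g] minimising the sum of the elements of all members of the chain.  If an
    image were not row-initial, exchanging two elements of a row would decrease
    the sum; the chain condition prevents another member from increasing. *)
Lemma sort_into_row_initial (c : {set {set 'I_n}}) :
  {in c &, forall A B : {set 'I_n}, (A \subset B) || (B \subset A)} ->
  exists2 g, g \in wreath l m & {in c, forall A, g @: A \in row_initial}.
Proof.
move=> cchain; pose wt (g : 'S_n) : nat := (\sum_(A in c) \sum_(i in A) g i)%N.
have [g gG gmin] := @arg_minnP _ 1%g (mem (wreath l m)) wt (group1 _).
exists g => // A Ac; apply/row_initialP => i j /imsetP[i' i'A ->].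
rewrite -(permKV g j); move: (g^-1%g j) => j' {i j}; have /wreathP gG' := gG.
rewrite gG' => ji lji; apply: imset_f; apply: contraT => j'A.
have ltji : (g j' < g i')%N.
  rewrite ltn_neqAle lji andbT; apply: contraNneq j'A => /val_inj/perm_inj->.
  exact: i'A.
pose t := (tperm i' j' * g)%g.
have tG : t \in wreath l m.
  rewrite groupM //; apply/wreathP => x y; rewrite /same_row.
  have rt z : (tperm i' j' z %/ l = z %/ l)%N.
    by case: tpermP => // ->; move: ji; rewrite /same_row => /eqP->.
  by rewrite !rt.
have := gmin t tG; rewrite leqNgt => /negP[].
have tle B : B \in c ->
    (\sum_(x in B) t x + (if (i' \in B) && (j' \notin B) then 1 else 0) <= \sum_(x in B) g x)%N.
  move=> Bc; have iB : (j' \in B) -> (i' \in B).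
    move=> jB; case/orP: (cchain _ _ Ac Bc) => /subsetP sAB; first exact: sAB.
    by case/negP: j'A; apply: sAB.
  have [i'B|i'B] /= := boolP (i' \in B); last first.
    rewrite addn0; apply: eq_leq; apply: eq_bigr => x xB.
    rewrite permM tpermD //; apply: contraNneq i'B; first by move->.
    by move=> jx; apply: iB; rewrite jx.
  have [j'B|j'B] /= := boolP (j' \in B).
    rewrite addn0; apply: eq_leq; rewrite [RHS](reindex_inj (@perm_inj _ (tperm i' j'))) /=.
    apply: eq_big => [x|x _]; last by rewrite permM.
    by case: tpermP => [->|->|//]; rewrite i'B j'B.
  rewrite (bigD1 i') //= [X in (_ <= X)%N](bigD1 i') //= permM tpermL addnAC addn1.
  apply: leq_add ltji _; apply: eq_leq; apply: eq_bigr => x /andP[xB xi].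
  by rewrite permM tpermD // 1?eq_sym //; apply: contraNneq j'B => <-.
rewrite /wt (bigD1 A) //= [X in (_ < X)%N](bigD1 A) //=.
have := tle A Ac; rewrite i'A j'A addn1 => lt1.
apply: (@leq_ltn_trans (\sum_(x in A) t x + \sum_(B in c | B != A) \sum_(x in B) g x)%N).
  rewrite leq_add2l; apply: leq_sum => B /andP[Bc _].
  by apply: leq_trans (tle B Bc); apply: leq_addr.
by rewrite ltn_add2r.
Qed.

End Wreath.

(** * The quotient complex is Cohen-Macaulay *)

Section ChainLemmas.

Variable T : finType.
Implicit Types (A B : {set T}) (E : {set {set T}}).

Definition set_chain E : Prop := {in E &, forall A B : {set T}, comparable_sets A B}.

Lemma comparable_imset (g : {perm T}) A B :
  comparable_sets (g @: A) (g @: B) = comparable_sets A B.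
Proof.
have sub A' B' : (g @: A' \subset g @: B') = (A' \subset B').
  apply/idP/idP; last exact: imsetS.
  move/subsetP => s; apply/subsetP => x xA.
  by have /imsetP[y yB /perm_inj->] := s _ (imset_f g xA).
by rewrite /comparable_sets !sub.
Qed.

(** Comparable sets of equal size are equal. *)
Lemma chain_fixed E (g : {perm T}) A : set_chain E -> A \in E -> g @: A \in E -> g @: A = A.
Proof.
move=> chE AE gAE; have gA : #|g @: A| = #|A| by rewrite card_imset //; apply: perm_inj.
apply/eqP; rewrite eqEsubset; apply/andP; split; apply: comparable_sets_card; rewrite ?gA //; exact: chE.
Qed.

Lemma chain_card E : set_chain E -> (#|E| <= #|T|.+1)%N.
Proof.
move=> chE; rewrite -[X in (_ <= X)%N]card_ord.
rewrite -(@card_in_imset _ _ (fun A => inord #|A| : 'I_#|T|.+1)) ?max_card //.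
move=> A B AE BE /(congr1 val); rewrite /= !inordK ?ltnS ?max_card // => AB.
by apply/eqP; rewrite eqEsubset; apply/andP; split; apply: comparable_sets_card; rewrite ?AB //; exact: chE.
Qed.

End ChainLemmas.

Lemma setU_setD (T : finType) (A B : {set T}) : A \subset B -> A :|: (B :\: A) = B.
Proof. by move=> /setIidPr AB; rewrite -{2}(setID B A) AB. Qed.

Section QuotientComplex.

Variables (l m : nat).
Hypothesis l_gt0 : (0 < l)%N.
Local Notation n := (l * m)%N.
Local Notation G := (wreath l m).
Local Notation H := (position_group l m).
Local Notation W := (row_initial l m).
Local Notation to := (('P^*)^*)%act.
Implicit Types (c e : {set {set 'I_n}}) (g h : 'S_n).

Lemma mem_act c g (A : {set 'I_n}) : (g @: A \in to c g) = (A \in c).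
Proof.
apply/imsetP/idP => [[B Bc]|Ac]; last by exists A.
by move/(act_inj ('P^*)%act)=> ->.
Qed.

Lemma mem_actP c g (B : {set 'I_n}) : reflect (exists2 A, A \in c & B = g @: A) (B \in to c g).
Proof. exact: imsetP. Qed.

Lemma act_setD c e h : to (c :\: e) h = to c h :\: to e h.
Proof.
apply/setP => x; have -> : x = h @: (h^-1%g @: x) by exact: (esym (actKV ('P^*)%act h x)).
by rewrite in_setD !mem_act in_setD.
Qed.

Lemma boolean_order_complexP c : reflect
  [/\ set0 \notin c, setT \notin c & set_chain c] (c \in boolean_order_complex n).
Proof.
rewrite inE; apply: (iffP andP) => [[/forall_inP h1 /forall_inP h2]|[c0 cT ch]]; split.
- by apply/negP => /h1; rewrite eqxx.
- by apply/negP => /h1; rewrite eqxx andbF.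
- by move=> A B /h2/forall_inP h2A /h2A.
- apply/forall_inP => A Ac; apply/andP; split.
    by apply: contraNneq c0 => <-.
  by apply: contraNneq cT => <-.
- by apply/forall_inP => A Ac; apply/forall_inP => B; apply: ch.
Qed.

Lemma set_chain_act c g : set_chain c -> set_chain (to c g).
Proof.
move=> ch A B /mem_actP[A' A'c ->] /mem_actP[B' B'c ->]; rewrite comparable_imset; exact: ch.
Qed.

Lemma imset_setT g : g @: [set: 'I_n] = [set: 'I_n].
Proof.
by apply/setP => x; rewrite !inE -(permKV g x) imset_f.
Qed.

Lemma boolean_order_complex_act c g :
  c \in boolean_order_complex n -> to c g \in boolean_order_complex n.
Proof.
case/boolean_order_complexP => c0 cT ch; apply/boolean_order_complexP; split.
- by rewrite -(imset0 g) mem_act.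
- by rewrite -(imset_setT g) mem_act.
- exact: set_chain_act.
Qed.

Lemma row_initial_orbit c1 c2 : c1 \subset W -> c2 \subset W ->
  orbit to G c1 = orbit to G c2 -> exists2 h, h \in H & to c1 h = c2.
Proof.
move=> /subsetP c1W /subsetP c2W /esym/orbit_eqP/orbitP[g gG gc].
have [|A Ac|h hH hg] := @row_initial_transport l m l_gt0 c1 g gG.
- exact: c1W.
- by apply: c2W; rewrite -gc mem_act.
exists h; rewrite // -gc; exact: eq_in_imset.
Qed.

Section Link.

Variable c : {set {set 'I_n}}.
Hypotheses (cC : c \in boolean_order_complex n) (cW : c \subset W).

Let c' := set0 |: (setT |: c).
Let Q := refiners W c'.
Let face e := orbit to G (c :|: e).
Let X := link (@quotient_le n) (quotient_complex G) (orbit to G c).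
Local Notation adj := (@comparable_sets 'I_n).

Lemma set0_initial : set0 \in W.
Proof. by apply/row_initialP => i j; rewrite inE. Qed.

Lemma setT_initial : setT \in W.
Proof. by apply/row_initialP => i j; rewrite !inE. Qed.

Lemma link_flag : is_flag W c'.
Proof.
have [_ _ ch] := boolean_order_complexP _ cC.
split.
- by rewrite !subUset !sub1set set0_initial setT_initial.
- exact: setU11.
- by rewrite setU1r ?setU11.
- move=> x y; rewrite /comparable_sets.
  move=> /setU1P[->|/setU1P[->|xc]]; first by rewrite sub0set.
    by rewrite subsetT orbT.
  move=> /setU1P[->|/setU1P[->|yc]]; first by rewrite sub0set orbT.
    by rewrite subsetT.
  exact: ch.
Qed.

Lemma link_refinersP (A : {set 'I_n}) : reflect
  [/\ A \in W, A \notin c, A != set0, A != setT & {in c, forall B : {set 'I_n}, adj B A}] (A \in Q).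
Proof.
apply: (iffP (refinersP _ _ _)) => [[AW Ac' h]|[AW Ac A0 AT h]].
  have Bc' B : B \in c -> B \in c' by move=> Bc; rewrite !inE Bc !orbT.
  split=> //; last by move=> B /Bc'; apply: h.
  - by apply: contra Ac'; apply: Bc'.
  - by apply: contraNneq Ac' => ->; rewrite setU11.
  - by apply: contraNneq Ac' => ->; rewrite setU1r ?setU11.
split=> //; first by rewrite !inE negb_or A0 negb_or AT.
move=> B /setU1P[->|/setU1P[->|/h//]]; rewrite /comparable_sets ?sub0set //.
by rewrite subsetT orbT.
Qed.

Lemma link_cliqueP e : reflect
  [/\ [disjoint c & e], c :|: e \subset W & c :|: e \in boolean_order_complex n]
  (clique adj Q e).
Proof.
have [c0 cT ch] := boolean_order_complexP _ cC.
apply: (iffP (cliqueP _ _ _)) => [[eQ eadj]|[dce ceW /boolean_order_complexP[e0 eT che]]].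
  split.
  - rewrite disjoint_sym disjoint_subset; apply/subsetP => A /eQ/link_refinersP[_ Ac _ _ _].
    exact: Ac.
  - by rewrite subUset cW; apply/subsetP => A /eQ/link_refinersP[].
  apply/boolean_order_complexP; split.
  - by rewrite inE negb_or c0; apply/negP => /eQ/link_refinersP[_ _ /eqP].
  - by rewrite inE negb_or cT; apply/negP => /eQ/link_refinersP[_ _ _ /eqP].
  - move=> A B /setUP[Ac|Ae] /setUP[Bc|Be].
    + exact: ch.
    + by have /link_refinersP[_ _ _ _] := eQ B Be; apply.
    + by rewrite comparable_sets_sym; have /link_refinersP[_ _ _ _] := eQ A Ae; apply.
    + have [->|AB] := eqVneq A B; first by rewrite /comparable_sets subxx.
      exact: eadj.
split=> [A Ae|A B Ae Be _]; last by apply: che; rewrite inE ?Ae ?Be orbT.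
apply/link_refinersP; split.
- by apply: (subsetP ceW); rewrite inE Ae orbT.
- by apply: contraTN Ae => Ac; rewrite (disjointFr dce).
- by apply: contraNneq e0 => <-; rewrite inE Ae orbT.
- by apply: contraNneq eT => <-; rewrite inE Ae orbT.
- by move=> B Bc; apply: che; rewrite inE ?Ae ?Bc ?orbT.
Qed.

Lemma clique_chain e : clique adj Q e -> set_chain (c :|: e).
Proof. by case/link_cliqueP => _ _ /boolean_order_complexP[]. Qed.

Lemma cliqueD e : c \subset e -> e \subset W -> e \in boolean_order_complex n ->
  clique adj Q (e :\: c).
Proof.
move=> ce eW eC; apply/link_cliqueP; rewrite setU_setD //.
split=> //; by rewrite -setI_eq0 setIDA setIC -setIDA setDv setI0.
Qed.

Lemma cliqueK e : clique adj Q e -> (c :|: e) :\: c = e.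
Proof.
case/link_cliqueP => dce _ _; rewrite setDUl setDv set0U; apply/setDidPl.
by rewrite disjoint_sym.
Qed.

(** Sizes determine the members of a chain, so a permutation that embeds a chain
    containing [c] into one containing [c] fixes each member of [c]. *)
Lemma face_sub_clique e g (D : {set {set 'I_n}}) : clique adj Q e -> c \subset D -> to D g \subset c :|: e ->
  to c g = c /\ exists2 e' : {set {set 'I_n}}, e' \subset e & to D g = c :|: e'.
Proof.
move=> cl /subsetP cD /subsetP De; have ch := clique_chain cl.
have fix_c (A : {set 'I_n}) : A \in c -> g @: A = A.
  by move=> Ac; apply: (chain_fixed ch); [rewrite inE Ac | apply: De; rewrite mem_act cD].
have cg : to c g = c.
  rewrite -[RHS]imset_id; exact: eq_in_imset.
split=> //; exists (to D g :\: c).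
  apply/subsetP => A /setDP[AD Ac]; have /setUP[Ac'|//] := De A AD.
  by rewrite Ac' in Ac.
rewrite setU_setD //; rewrite -{1}cg; exact/imsetS/subsetP.
Qed.

(** A chain over a conjugate of [c] is moved over [c], sorted into the row-initial
    sets, and then moved back over [c] by a permutation preserving positions. *)
Lemma link_X : X = [set face e | e in clique adj Q].
Proof.
apply/setP => O; rewrite inE; apply/andP/imsetP => [[/imsetP[F FC ->]]|[e cl ->]].
  case/exists_inP => F1 /orbitP[g1 g1G <-] /exists_inP[F2 /orbitP[g2 g2G <-] sF].
  pose F' := to F (g2 * g1^-1)%g.
  have F'C : F' \in boolean_order_complex n by apply: boolean_order_complex_act.
  have cF' : c \subset F'.
    have : to (to c g1) g1^-1%g \subset to (to F g2) g1^-1%g by apply: imsetS.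
    by rewrite actK -actM.
  have [_ _ ch] := boolean_order_complexP _ F'C.
  have [g gG gW] := sort_into_row_initial l_gt0 ch.
  have [|A Ac|h hH hg] := @row_initial_transport l m l_gt0 c g gG.
  - exact/subsetP.
  - by apply: gW; apply: (subsetP cF').
  pose E := to F' (g * h^-1)%g.
  have EC : E \in boolean_order_complex n by apply: boolean_order_complex_act.
  have cE : c \subset E.
    have cgh : to c g = to c h by apply: eq_in_imset => A Ac; apply/esym; exact: hg.
    rewrite /E actM -{1}(actK to h c) -cgh; do 2 apply: imsetS; exact: cF'.
  have EW : E \subset W.
    rewrite /E actM; apply/subsetP => A /mem_actP[B /mem_actP[A' A'F ->] ->].
    by apply: row_initial_act; rewrite ?groupV // gW.
  exists (E :\: c); first exact: cliqueD.
  rewrite /face (setU_setD cE) /E /F' -actM.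
  apply/esym; apply/orbit_eqP; apply: mem_orbit.
  rewrite !groupM ?groupV //; exact: (subsetP (position_group_sub l m)).
have [_ _ ceC] := link_cliqueP _ cl.
split; first exact: imset_f.
apply/exists_inP; exists c; first exact: orbit_refl.
apply/exists_inP; exists (c :|: e); [exact: orbit_refl | exact: subsetUl].
Qed.

Lemma link_face_le e O : clique adj Q e -> O \in X ->
  quotient_le O (face e) = (O \in face @: powerset e).
Proof.
move=> cl; rewrite link_X => /imsetP[e' cl' ->].
apply/exists_inP/imsetP => [[F1 /orbitP[g1 g1G <-]]|[e'']].
  case/exists_inP => F2 /orbitP[g2 g2G <-] sF.
  have sF' : to (c :|: e') (g1 * g2^-1)%g \subset c :|: e.
    have : to (to (c :|: e') g1) g2^-1%g \subset to (to (c :|: e) g2) g2^-1%g.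
      exact: imsetS.
    by rewrite actK -actM.
  have [_ [e'' e''e e''E]] := face_sub_clique cl (subsetUl _ _) sF'.
  exists e''; first by rewrite inE.
  rewrite /face -e''E; apply/esym/orbit_eqP; apply: mem_orbit.
  by rewrite groupM ?groupV.
rewrite inE => e''e fE; exists (c :|: e''); first by rewrite fE orbit_refl.
apply/exists_inP; exists (c :|: e); [exact: orbit_refl | exact: setUS].
Qed.

Lemma sub_clique e e' : clique adj Q e -> e' \subset e -> clique adj Q e'.
Proof.
move=> cl s; apply: (clique_sub cl s); apply: subset_trans s _; by case/andP: cl.
Qed.

Lemma link_face_inj e : clique adj Q e -> {in powerset e &, injective face}.
Proof.
move=> cl e1 e2; rewrite !inE => e1e e2e fE.
have ch := clique_chain cl; have cl1 := sub_clique cl e1e; have cl2 := sub_clique cl e2e.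
have [g gG gE] : exists2 g, g \in G & to (c :|: e1) g = c :|: e2.
  by apply/orbitP; apply/orbit_eqP; rewrite -/(face e2) -fE.
rewrite -(cliqueK cl1) -(cliqueK cl2) -gE; congr (_ :\: _).
rewrite -{1}[c :|: e1]imset_id; apply: eq_in_imset => A Ace1.
apply/esym/(chain_fixed ch); first exact: (subsetP (setUS c e1e)).
by apply: (subsetP (setUS c e2e)); rewrite -gE mem_act.
Qed.

Let K := 'C_H[c | to]%G.

Lemma link_stabP h : h \in K -> [/\ h \in H, to c h = c & h \in G].
Proof.
case/setIP => hH /astab1P hc; split=> //; exact: (subsetP (position_group_sub l m)).
Qed.

Lemma link_face_inv e h : clique adj Q e -> h \in K ->
  clique adj Q (to e h) /\ face (to e h) = face e.
Proof.
move=> cl /link_stabP[hH hc hG]; have [dce ceW ceC] := link_cliqueP _ cl.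
have hce : to (c :|: e) h = c :|: to e h by rewrite -{2}hc; apply: imsetU.
split; last by rewrite /face -hce; apply/orbit_eqP/mem_orbit.
apply/link_cliqueP; rewrite -hce; split; last exact: boolean_order_complex_act.
  rewrite -{1}hc -setI_eq0; apply/eqP/setP => A; rewrite !inE.
  apply/negP => /andP[/mem_actP[B Bc ->]]; rewrite mem_act => Be.
  by rewrite (disjointFr dce) in Be.
apply/subsetP => A /mem_actP[B Bce ->]; apply: row_initial_act => //; exact: (subsetP ceW).
Qed.

Lemma link_face_orbit e e' : clique adj Q e -> clique adj Q e' ->
  face e = face e' -> exists2 h, h \in K & to e h = e'.
Proof.
move=> cl cl' fE; have [_ ceW _] := link_cliqueP _ cl; have [_ ceW' _] := link_cliqueP _ cl'.
have [h hH hE] := row_initial_orbit ceW ceW' fE.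
have hE' : to (c :|: e) h \subset c :|: e' by rewrite hE.
have [hc _] := face_sub_clique cl' (subsetUl _ _) hE'.
exists h; first by apply/setIP; split=> //; apply/astab1P.
by rewrite -(cliqueK cl) -(cliqueK cl') act_setD hE hc.
Qed.

(** The rank of the link is at most the number of members missing to a complete flag,
    because a chain of subsets of an [n]-element set has at most [n + 1] members. *)
Lemma link_homology_vanishes (k : fieldType) r : #|H|%:R != 0 :> k ->
  (r < complex_rank (@quotient_le n) X)%N ->
  reduced_homology_vanishes (@quotient_le n) k X r.
Proof.
move=> H_unit rX; have [c'W c'0 c'T c'ch] := link_flag.
have cadj := @comparable_sets_sym 'I_n.
pose d := (n.+1 - #|c'|)%N.
have dE : (#|c'| + d)%N = n.+1.
  rewrite subnKC // -[X in (_ <= X.+1)%N](card_ord n); apply: chain_card.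
  by move=> A B; apply: c'ch.
apply: (quotient_homology_vanishes link_X link_face_le link_face_inj link_face_inv
  link_face_orbit).
  have /dvdnP[q qE] : (#|K| %| #|H|)%N by apply: cardSg; exact: subsetIl.
  by apply: contraNneq H_unit => K0; rewrite qE natrM K0 mulr0.
have key_inj := face_key link_face_inj cadj.
apply: (refiners_exact (d := d) (row_initial_exchange (l := l) (m := m)) key_inj link_flag) (leq_trans rX _) => //.
  by rewrite dE card_ord.
apply: (complex_rank_le link_X link_face_le link_face_inj) => e cl.
rewrite -(leq_add2l #|c'|) dE.
have dce : c' :&: e = set0.
  apply/setP => A; rewrite in_setI in_set0; apply/negP => /andP[Ac'].
  by case/cliqueP: cl => eQ _ /eQ/refinersP[_ /negP].
have -> : (#|c'| + #|e|)%N = #|c' :|: e| by rewrite cardsU dce cards0 subn0.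
rewrite -[X in (_ <= X.+1)%N](card_ord n); apply: chain_card => A B.
case/cliqueP: cl => eQ eadj.
move=> /setUP[Ac|Ae] /setUP[Bc|Be].
- exact: c'ch.
- by have /refinersP[_ _] := eQ B Be; apply.
- by rewrite comparable_sets_sym; have /refinersP[_ _] := eQ A Ae; apply.
- by have [->|] := eqVneq A B; [rewrite /comparable_sets subxx | apply: eadj].
Qed.

End Link.

Lemma quotient_complex_cohen_macaulay (k : fieldType) : #|H|%:R != 0 :> k ->
  cohen_macaulay_complex (@quotient_le n) k (quotient_complex G).
Proof.
move=> H_unit F /imsetP[c0 c0C ->] r.
have [_ _ ch] := boolean_order_complexP _ c0C.
have [g gG gW] := sort_into_row_initial l_gt0 ch.
have -> : orbit to G c0 = orbit to G (to c0 g).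
  by apply/esym/orbit_eqP/mem_orbit.
apply: link_homology_vanishes => //; first exact: boolean_order_complex_act.
by apply/subsetP => A /mem_actP[B Bc ->]; apply: gW.
Qed.

End QuotientComplex.

(** * Purity of the invariants of the wreath product *)

Lemma generated_idealP (R : comNzRingType) (s : seq R) x :
  generated_ideal s x <-> exists c : nat -> R, x = \sum_(i < size s) c i * s`_i.
Proof.
split=> [[c ->]|[c ->]]; last by exists (fun i => c i).
exists (fun i => if insub i is Some j then c j else 0); apply: eq_bigr => i _.
by rewrite valK.
Qed.

Section MpolyMorphisms.

Variables (n : nat) (k : fieldType).
Local Notation R := {mpoly k[n]}.

Lemma mpoly_rmorph_ext (S : nzRingType) (f g : {rmorphism R -> S}) :
  (forall c, f c%:MP = g c%:MP) -> (forall i, f 'X_i = g 'X_i) -> f =1 g.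
Proof.
move=> fgC fgX p; rewrite [p]mpolyE !rmorph_sum; apply: eq_bigr => m _ /=.
rewrite -mul_mpolyC !rmorphM fgC; congr (_ * _); rewrite mpolyXE_id !rmorph_prod.
by apply: eq_bigr => i _; rewrite !rmorphXn /= fgX.
Qed.

(** Congruence modulo [d] is compatible with sums and products. *)
Lemma mpoly_rmorph_congr (f : {rmorphism R -> R}) (d : R) :
  (forall c, f c%:MP = c%:MP) -> (forall i, exists u, 'X_i - f 'X_i = d * u) ->
  forall p, exists u, p - f p = d * u.
Proof.
move=> fC fX.
pose cong (x y : R) := exists u, x - y = d * u.
have congM x1 y1 x2 y2 : cong x1 y1 -> cong x2 y2 -> cong (x1 * x2) (y1 * y2).
  move=> [u1 e1] [u2 e2]; exists (u1 * x2 + y1 * u2).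
  by rewrite mulrDr mulrA -e1 mulrCA -e2 mulrBl mulrBr addrA subrK.
have congD x1 y1 x2 y2 : cong x1 y1 -> cong x2 y2 -> cong (x1 + x2) (y1 + y2).
  by move=> [u1 e1] [u2 e2]; exists (u1 + u2); rewrite mulrDr -e1 -e2 opprD addrACA.
have cong0 x : cong x x by exists 0; rewrite subrr mulr0.
move=> p; rewrite [p]mpolyE rmorph_sum; apply: (big_ind2 cong) => // m _.
rewrite -mul_mpolyC rmorphM fC; apply: (congM) => //.
rewrite mpolyXE_id rmorph_prod; apply: (big_ind2 cong) => // i _.
rewrite rmorphXn; elim: (m i) => [|e IH]; first by rewrite !expr0.
by rewrite !exprS; apply: congM => //; apply: fX.
Qed.

Definition subst_var (i j : 'I_n) : R -> R :=
  mmap (@mpolyC n k) (fun u => 'X_(if u == i then j else u)).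

HB.instance Definition _ i j := GRing.RMorphism.on (subst_var i j).

Lemma subst_varC i j c : subst_var i j c%:MP = c%:MP.
Proof. by rewrite /subst_var mmapC. Qed.

Lemma subst_varX i j u : subst_var i j 'X_u = 'X_(if u == i then j else u).
Proof. by rewrite /subst_var mmapX mmap1U. Qed.

Lemma subst_var_dvd i j p : subst_var i j p = 0 -> exists u, p = ('X_i - 'X_j) * u.
Proof.
move=> p0; rewrite -[p]subr0 -p0; apply: mpoly_rmorph_congr => [c|u].
  exact: subst_varC.
rewrite /= subst_varX; case: eqP => [->|_]; first by exists 1; rewrite mulr1.
by exists 0; rewrite subrr mulr0.
Qed.

Lemma msymXU (s : 'S_n) i : msym s ('X_i : R) = 'X_(s i).
Proof. by rewrite /msym mmapX mmap1U. Qed.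

Lemma msymC (s : 'S_n) c : msym s (c%:MP : R) = c%:MP.
Proof. by rewrite /msym mmapC. Qed.

Lemma subst_var_tperm i j p : subst_var i j (msym (tperm i j) p) = subst_var i j p.
Proof.
apply: (mpoly_rmorph_ext (f := subst_var i j \o msym (tperm i j)) (g := subst_var i j)) => [c|u] /=.
  by rewrite msymC subst_varC.
rewrite msymXU !subst_varX; case: tpermP => [->|->|_ _].
- by rewrite eqxx; case: eqP.
- by rewrite eqxx; case: eqP => // ->.
- by [].
Qed.

Lemma mpolyC_inj : injective (@mpolyC n k).
Proof. exact: can_inj (@mpolyCK n k). Qed.

Lemma subX_neq0 (i j : 'I_n) : i != j -> 'X_i - 'X_j != 0 :> R.
Proof.
move=> ij; apply/eqP => /(congr1 (mcoeff U_(i))); rewrite mcoeffB !mcoeffXU mcoeff0 eqxx.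
by rewrite eq_sym (negPf ij) subr0 => /eqP; rewrite oner_eq0.
Qed.

Lemma msize_subX (i j : 'I_n) : i != j -> (2 <= msize ('X_i - 'X_j : R))%N.
Proof.
move=> ij; have : U_(i)%MM \in msupp ('X_i - 'X_j : R).
  rewrite mcoeff_msupp mcoeffB !mcoeffXU eqxx [j == i]eq_sym (negPf ij) subr0.
  exact: oner_neq0.
by move/msize_mdeg_lt; rewrite mdeg1.
Qed.

Lemma msizeM_pred (p q : R) : (msize (p * q) <= (msize p + msize q).-1)%N.
Proof.
have [->|p0] := eqVneq p 0; first by rewrite mul0r msize0.
have [->|q0] := eqVneq q 0; first by rewrite mulr0 msize0.
by rewrite msizeM.
Qed.

Definition diff_prod (s : seq ('I_n * 'I_n)) : R := \prod_(ij <- s) ('X_ij.1 - 'X_ij.2).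

Lemma diff_prod_neq0 s : all (fun ij : 'I_n * 'I_n => ij.1 != ij.2) s -> diff_prod s != 0.
Proof.
move/allP => h; rewrite prodf_seq_neq0; apply/allP => ij /h; exact: subX_neq0.
Qed.

Lemma msize_diff_prod s : all (fun ij : 'I_n * 'I_n => ij.1 != ij.2) s -> (size s < msize (diff_prod s))%N.
Proof.
elim: s => [_|ij s IH /= /andP[ij_neq hs]]; first by rewrite /diff_prod big_nil msize1.
rewrite /diff_prod big_cons msizeM ?subX_neq0 //; last exact: diff_prod_neq0.
have := msize_subX ij_neq; have := IH hs; rewrite -/(diff_prod s).
case: (msize (_ - _)) => [|[|a]] // lt _; rewrite !addSn /= ltnS.
by apply: leq_trans lt _; rewrite leq_addl.
Qed.

Lemma subst_diff_prod (i j : 'I_n) s : (i < j)%N -> all (fun ij : 'I_n * 'I_n => ij.1 < ij.2)%N s ->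
  (i, j) \notin s -> subst_var i j (diff_prod s) != 0.
Proof.
move=> lij /allP hs ijs; rewrite rmorph_prod prodf_seq_neq0; apply/allP => -[a b] abs.
rewrite /= rmorphB /= !subst_varX; apply: subX_neq0; apply/eqP => ab.
have := hs _ abs; rewrite /= => lab.
have abij : (a, b) != (i, j) by apply: contraNneq ijs => <-.
move: ab; case: (eqVneq a i) => [ai|ai]; case: (eqVneq b i) => [bi|bi] ab.
- by rewrite ai bi ltnn in lab.
- by rewrite ai ab eqxx in abij.
- by rewrite ab bi ltnNge ltnW in lab.
- by rewrite ab ltnn in lab.
Qed.

(** A polynomial killed by identifying two variables is divisible by their
    difference, and the other differences survive this identification. *)
Lemma diff_prod_dvd s p : uniq s -> all (fun ij : 'I_n * 'I_n => ij.1 < ij.2)%N s ->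
  (forall ij : 'I_n * 'I_n, ij \in s -> subst_var ij.1 ij.2 p = 0) -> exists u, p = diff_prod s * u.
Proof.
elim: s => [|[i j] s IH] /=; first by exists p; rewrite /diff_prod big_nil mul1r.
case/andP=> ijs us /andP[lij hs] h.
have [|u pu] := IH us hs; first by move=> ab abs; apply: h; rewrite inE abs orbT.
have := h (i, j) (mem_head _ _); rewrite pu rmorphM => /eqP.
rewrite mulf_eq0 (negPf (subst_diff_prod lij hs ijs)) /= => /eqP/subst_var_dvd[v ->].
by exists v; rewrite /diff_prod big_cons mulrCA mulrA.
Qed.

End MpolyMorphisms.

Section WreathPurity.

Variables (l m : nat) (k : fieldType).
Hypothesis l_gt0 : (0 < l)%N.
Local Notation n := (l * m)%N.
Local Notation G := (wreath l m).
Local Notation H := (position_group l m).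
Local Notation R := {mpoly k[n]}.

Definition row_pairs : seq ('I_n * 'I_n) :=
  [seq ij : 'I_n * 'I_n <- enum {: 'I_n * 'I_n} | (ij.1 < ij.2)%N && same_row ij.1 ij.2].

Lemma mem_row_pairs (ij : 'I_n * 'I_n) : (ij \in row_pairs) = (ij.1 < ij.2)%N && same_row ij.1 ij.2.
Proof. by rewrite mem_filter mem_enum andbT. Qed.

Lemma row_pairs_lt : all (fun ij : 'I_n * 'I_n => ij.1 < ij.2)%N row_pairs.
Proof. by apply/allP => ij; rewrite mem_row_pairs => /andP[]. Qed.

Lemma row_pairs_neq : all (fun ij : 'I_n * 'I_n => ij.1 != ij.2) row_pairs.
Proof.
by apply: sub_all row_pairs_lt => ij; apply: contraTneq => ->; rewrite ltnn.
Qed.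

Lemma uniq_row_pairs : uniq row_pairs.
Proof. exact/filter_uniq/enum_uniq. Qed.

(** The product of the Vandermonde determinants of the rows. *)
Definition row_vandermonde : R := diff_prod k row_pairs.
Local Notation a := row_vandermonde.

Lemma row_vandermonde_neq0 : a != 0. Proof. exact: diff_prod_neq0 row_pairs_neq. Qed.

(** The sign by which [g] acts on [row_vandermonde].  It is not the signature: it is
    trivial on the permutations that preserve positions. *)
Definition row_sign (g : 'S_n) : k :=
  \prod_(ij <- row_pairs) (if (g ij.1 < g ij.2)%N then 1 else -1).

Lemma msym_row_vandermonde g : g \in G -> msym g a = row_sign g *: a.
Proof.
move=> /(wreathP l_gt0) gG.
pose sg (ij : 'I_n * 'I_n) :=
  if (g ij.1 < g ij.2)%N then (g ij.1, g ij.2) else (g ij.2, g ij.1).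
have sgP (ij : 'I_n * 'I_n) : ij \in row_pairs -> sg ij \in row_pairs.
  rewrite !mem_row_pairs /sg => /andP[lij rij]; case: ifP => /= [->|]; rewrite gG //.
  move/negbT; rewrite -leqNgt leq_eqVlt => /orP[/eqP/val_inj/perm_inj e|->].
    by rewrite e ltnn in lij.
  by rewrite same_row_sym.
have sg_inj : {in row_pairs &, injective sg}.
  move=> [i j] [i' j']; rewrite !mem_row_pairs /sg /= => /andP[lij _] /andP[lij' _].
  case: ifP => _; case: ifP => _ [/perm_inj e1 /perm_inj e2]; rewrite ?e1 ?e2 //;
  by move: lij lij'; rewrite e1 e2 => lt1 lt2; have := ltn_trans lt1 lt2; rewrite ltnn.
rewrite rmorph_prod /row_sign -mul_mpolyC rmorph_prod.
have perm_sg : perm_eq (map sg row_pairs) row_pairs.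
  have u1 : uniq (map sg row_pairs) by rewrite map_inj_in_uniq ?uniq_row_pairs.
  apply: uniq_perm => //; first exact: uniq_row_pairs.
  apply: (uniq_min_size u1 _ _).2; last by rewrite size_map.
  by move=> x /mapP[y yP ->]; apply: sgP.
rewrite -[X in _ = _ * X](perm_big _ perm_sg) big_map -big_split /=.
apply: eq_bigr => ij _; rewrite rmorphB /= !msymXU /sg; case: ifP => _ /=.
  by rewrite rmorph1 mul1r.
by rewrite rmorphN1 mulN1r opprB.
Qed.

Lemma row_signM g h : g \in G -> h \in G -> row_sign (g * h)%g = row_sign g * row_sign h.
Proof.
move=> gG hG; have := msym_row_vandermonde (groupM gG hG).
rewrite msymMm msym_row_vandermonde // msymZ msym_row_vandermonde // scalerA -!mul_mpolyC => /(mulIf row_vandermonde_neq0)/mpolyC_inj.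
by [].
Qed.

Lemma row_sign_sqr g : row_sign g * row_sign g = 1.
Proof.
rewrite /row_sign -big_split big1_seq // => ij _ /=.
by case: ifP => _; rewrite ?mulr1 ?mulrNN ?mulr1.
Qed.

Lemma tperm_wreath (i j : 'I_n) : same_row i j -> tperm i j \in G.
Proof.
move=> ij; apply/(wreathP l_gt0) => x y; rewrite /same_row.
have rt z : (tperm i j z %/ l = z %/ l)%N.
  by case: tpermP => // ->; move: ij; rewrite /same_row => /eqP->.
by rewrite !rt.
Qed.

(** The transposition negates one factor of [row_vandermonde].  Identifying the two
    variables shows that it acts on the product of the others with trivial sign,
    since this product does not vanish under the identification. *)
Lemma row_sign_tperm (ij : 'I_n * 'I_n) : ij \in row_pairs -> row_sign (tperm ij.1 ij.2) = -1.
Proof.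
case: ij => i j ijP; have := ijP; rewrite mem_row_pairs /= => /andP[lij rij].
have aE : a = ('X_i - 'X_j) * diff_prod k (rem (i, j) row_pairs).
  by rewrite /a /diff_prod (perm_big _ (perm_to_rem ijP)) big_cons.
have := msym_row_vandermonde (tperm_wreath rij); rewrite aE msymM msymB !msymXU tpermL tpermR.
rewrite -opprB mulNr -mulrN [X in _ = X]scalerAr.
move/(mulfI (subX_neq0 _ _)); rewrite (neq_ltn i j) lij => /(_ isT).
move/(congr1 (subst_var i j)); rewrite rmorphN /= subst_var_tperm -mul_mpolyC rmorphM /= subst_varC.
rewrite -mulN1r => /mulIf h.
have /h : subst_var i j (diff_prod k (rem (i, j) row_pairs)) != 0.
  apply: subst_diff_prod => //; last by rewrite mem_rem_uniqF // uniq_row_pairs.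
  by apply/allP => x /mem_rem; apply: (allP row_pairs_lt).
by move=> e; apply: (@mpolyC_inj n k); rewrite -e rmorphN1.
Qed.

Definition row_antisym (h : R) : R := \sum_(g in G) row_sign g *: msym g h.

(** Identifying the two variables of a pair makes the terms of [g] and of [g] times
    their transposition cancel.  The group is split into halves, as the sum is to
    vanish in characteristic 2 too. *)
Lemma row_antisym_dvd h : exists u, row_antisym h = a * u.
Proof.
apply: diff_prod_dvd => [||[i j] ijP] /=; [exact: uniq_row_pairs|exact: row_pairs_lt|].
have := ijP; rewrite mem_row_pairs /= => /andP[lij rij].
have tG := tperm_wreath rij; set t := tperm i j in tG.
rewrite /row_antisym (bigID (fun g : 'S_n => (g^-1)%g i < (g^-1)%g j)%N) /= rmorphD /=.
rewrite [X in _ + subst_var i j X](reindex_inj (mulIg t)) /=.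
rewrite [X in _ + subst_var i j X](eq_bigl (fun g : 'S_n => (g \in G) && ((g^-1)%g i < (g^-1)%g j)%N)); last first.
  move=> g; congr (_ && _); first exact: groupMr.
  rewrite invMg tpermV !permM tpermL tpermR -leqNgt leq_eqVlt.
  case: eqP => // /val_inj/perm_inj ji; by rewrite ji ltnn in lij.
rewrite !rmorph_sum -big_split big1 //= => g /andP[gG _].
rewrite msymMm row_signM // (row_sign_tperm ijP) mulrN1 scaleNr rmorphN /=.
by rewrite -!mul_mpolyC !rmorphM /= subst_var_tperm addrN.
Qed.

Lemma msym_row_antisym g h : g \in G -> msym g (row_antisym h) = row_sign g *: row_antisym h.
Proof.
move=> gG; rewrite /row_antisym rmorph_sum scaler_sumr [RHS](reindex_inj (mulIg g)) /=.
apply: eq_big => x; first by rewrite groupMr.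
by move=> xG; rewrite /= msymZ -msymMm row_signM // scalerA mulrCA row_sign_sqr mulr1.
Qed.

Lemma row_antisymM f h : (forall g, g \in G -> msym g f = f) -> row_antisym (f * h) = f * row_antisym h.
Proof.
move=> fG; rewrite /row_antisym mulr_sumr; apply: eq_bigr => g gG.
by rewrite msymM fG // scalerAr.
Qed.

Lemma row_antisym_sum (I : finType) (F : I -> R) : row_antisym (\sum_i F i) = \sum_i row_antisym (F i).
Proof.
rewrite /row_antisym exchange_big; apply: eq_bigr => g _.
by rewrite rmorph_sum scaler_sumr.
Qed.

Definition position_mnm : 'X_{1..n} := [multinom (i %% l)%N | i < n].

Lemma card_lower_row (j : 'I_n) : #|[set i : 'I_n | (i < j)%N && same_row i j]| = (j %% l)%N.
Proof.
have bound (t : 'I_(j %% l)) : (j %/ l * l + t < n)%N.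
  apply: ltn_trans (ltn_ord j); rewrite [X in (_ < X)%N](divn_eq j l) ltn_add2l.
  exact: ltn_ord.
have div_f (t : 'I_(j %% l)) : ((j %/ l * l + t) %/ l = j %/ l)%N.
  rewrite divnMDl // [(t %/ l)%N]divn_small ?addn0 //; apply: (ltn_trans (ltn_ord t)).
  by rewrite ltn_mod.
pose f t := Ordinal (bound t).
have f_inj : injective f by move=> t t' /(congr1 val)/= /addnI/val_inj.
have -> : [set i : 'I_n | (i < j)%N && same_row i j] = f @: [set: 'I_(j %% l)].
  apply/setP => i; rewrite inE; apply/andP/imsetP => [[lij /eqP rij]|[t _ ->]].
    have lt : (i %% l < j %% l)%N.
      by move: lij; rewrite {1}(divn_eq i l) {1}(divn_eq j l) rij ltn_add2l.
    by exists (Ordinal lt) => //; apply/val_inj; rewrite /= -rij -divn_eq.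
  rewrite /same_row /= div_f; split=> //.
  by rewrite [X in (_ < X)%N](divn_eq j l) ltn_add2l ltn_ord.
by rewrite card_imset // cardsT card_ord.
Qed.

(** The position of [j] counts the pairs in its row with larger element [j]. *)
Lemma mdeg_position_mnm : mdeg position_mnm = size row_pairs.
Proof.
rewrite mdegE size_filter -sum1_count big_enum_cond [RHS]big_mkcond /=.
pose F (i j : 'I_n) := (if (i < j)%N && same_row i j then 1 else 0)%N.
rewrite [RHS](eq_bigr (fun p => F p.1 p.2)) => [|p _]; last by [].
rewrite -(pair_bigA _ F) /=.
rewrite exchange_big; apply: eq_bigr => j _; rewrite mnmE /F -big_mkcond sum1_card.
by rewrite -card_lower_row; apply: eq_card => i; rewrite inE.
Qed.

(** Both sides have the same degree, so the quotient by [a] is a constant.  It is not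
    zero, because the coefficient of the monomial itself is the order of its
    stabiliser [H], on which the sign is trivial. *)
Lemma row_antisym_position : #|H|%:R != 0 :> k ->
  exists2 c : k, c != 0 & row_antisym 'X_[position_mnm] = c *: a.
Proof.
move=> H_unit; have [u au] := row_antisym_dvd 'X_[position_mnm].
have signH h : h \in H -> row_sign h = 1.
  case/position_groupP => /(wreathP l_gt0) hG hp; rewrite /row_sign big1_seq // => ij /=.
  rewrite mem_row_pairs => /andP[lij rij].
  have := lij; rewrite !ltnNge !row_leq ?hG 1?same_row_sym // !hp => ->.
  by [].
have coefE : (row_antisym 'X_[position_mnm])@_position_mnm = #|H|%:R.
  rewrite /row_antisym raddf_sum /= -sum1_card natr_sum [RHS]big_mkcond [LHS]big_mkcond /=.
  apply: eq_bigr => g _; case: ifP => gG; last first.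
    by rewrite ifN //; apply: contraFN gG => /position_groupP[].
  rewrite mcoeffZ mcoeff_sym mcoeffX; case: ifP => [gH|/negbT gH].
    rewrite signH // mul1r; case: eqP => // -[]; apply/mnmP => i.
    by rewrite !mnmE; case/position_groupP: gH.
  case: eqP => [e|]; last by rewrite mulr0.
  case/negP: gH; apply/position_groupP; split=> // i.
  by have := congr1 (fun m : 'X_{1..n} => m i) e; rewrite !mnmE.
have u0 : u != 0.
  apply: contraNneq H_unit => u0; rewrite -coefE au u0 mulr0 mcoeff0. by [].
have : (msize (row_antisym 'X_[position_mnm]) <= (size row_pairs).+1)%N.
  rewrite -mdeg_position_mnm /row_antisym; apply: leq_trans (msize_sum _ _ _) _.
  apply/bigmax_leqP_seq => g _ _; apply: leq_trans (msizeZ_le _ _) _.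
  by rewrite msymX msizeX mdeg_mperm.
rewrite au msizeM ?row_vandermonde_neq0 // => le1.
have := msize_diff_prod k row_pairs_neq; rewrite -/a => lt1.
have /msize1_polyC uE : (msize u <= 1)%N.
  move: le1 lt1; move: (msize a) (msize u) (size row_pairs) => x y z.
  by case: y => [|y] //; rewrite addnS /= => xy zx; move: (leq_trans (leq_add zx (leqnn y)) xy);
     rewrite addSn ltnS -[X in (_ <= X)%N]addn0 leq_add2l.
exists (u@_0); last by rewrite {1}uE mulrC mul_mpolyC.
by apply: contraNneq u0 => e; rewrite uE e mpolyC0.
Qed.

(** Multiply the given combination by the monomial of positions and antisymmetrise:
    the invariant factors come out of the sum, and division by [a] leaves
    invariant coefficients. *)
Lemma wreath_purity (s : seq (invariant_ring k G)) (y : invariant_ring k G) :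
  #|H|%:R != 0 :> k ->
  generated_ideal (map (@invariant_val _ _ _) s) (y : R) -> generated_ideal s y.
Proof.
move=> H_unit /generated_idealP[g]; rewrite size_map => yE.
have inv (x : invariant_ring k G) h : h \in G -> msym h (x : R) = x.
  by case: x => x /= /invariantP; apply.
have [c c0 cE] := row_antisym_position H_unit.
have [u uE] := choice (fun i => row_antisym_dvd ('X_[position_mnm] * g i)).
have uinv i : c^-1 *: u i \in invariant_pred G.
  apply/invariantP => h hG; rewrite msymZ; congr (_ *: _).
  apply: (mulfI row_vandermonde_neq0); have := msym_row_antisym ('X_[position_mnm] * g i) hG.
  rewrite uE msymM msym_row_vandermonde // -scalerAl => /(congr1 (fun p => row_sign h *: p)).
  by rewrite !scalerA row_sign_sqr !scale1r.
apply/generated_idealP; exists (fun i => InvariantRing (uinv i)); apply: val_inj.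
rewrite raddf_sum; apply: (mulfI (row_vandermonde_neq0)); apply: (scalerI c0).
transitivity (row_antisym ('X_[position_mnm] * (y : R))).
  rewrite ['X_[_] * _]mulrC row_antisymM; last exact: inv.
  by rewrite cE -scalerAr [in RHS]mulrC.
rewrite {1}yE mulr_sumr row_antisym_sum mulr_sumr scaler_sumr; apply: eq_bigr => i _.
rewrite (nth_map 0) // mulrA [_ * (s`_i : R)]mulrC row_antisymM ?uE; last by apply: inv.
rewrite [RHS](_ : _ = c *: (a * ((c^-1 *: u i) * (s`_i : R)))) //.
by rewrite -scalerAl -scalerAr scalerA mulfV // scale1r mulrC -mulrA.
Qed.

End WreathPurity.

(** * Noetherian rings of polynomials and of invariants *)

Section Ideals.

Variable R : comNzRingType.
Implicit Types (I : R -> Prop) (s t : seq R).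

Lemma ideal_sum I (T : Type) (r : seq T) (P : pred T) (F : T -> R) :
  ideal I -> (forall i, P i -> I (F i)) -> I (\sum_(i <- r | P i) F i).
Proof. by case=> I0 ID _ h; apply: big_ind. Qed.

Lemma idealN I x : ideal I -> I x -> I (- x).
Proof. by case=> _ _ IM Ix; rewrite -mulN1r; apply: IM. Qed.

Lemma idealB I x y : ideal I -> I x -> I y -> I (x - y).
Proof. by move=> Iid Ix Iy; case: (Iid) => _ ID _; apply: ID => //; apply: idealN. Qed.

Lemma generated_ideal_ideal s : ideal (generated_ideal s).
Proof.
split=> [|x y [c ->] [d ->]|a x [c ->]].
- by exists (fun=> 0); rewrite big1 // => i _; rewrite mul0r.
- by exists (fun i => c i + d i); rewrite -big_split; apply: eq_bigr => i _; rewrite mulrDl.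
- by exists (fun i => a * c i); rewrite mulr_sumr; apply: eq_bigr => i _; rewrite mulrA.
Qed.

Lemma mem_generated s x : x \in s -> generated_ideal s x.
Proof.
move=> xs; apply/generated_idealP; exists (fun i => (i == index x s)%:R).
have lt : (index x s < size s)%N by rewrite index_mem.
rewrite (bigD1 (Ordinal lt)) //= eqxx mul1r nth_index // big1 ?addr0 // => i ne.
by rewrite (_ : _ == _ = false) ?mul0r //; apply: contraNF ne => /eqP e; apply/eqP/val_inj.
Qed.

Lemma generated_min I s x : ideal I -> (forall y, y \in s -> I y) ->
  generated_ideal s x -> I x.
Proof.
move=> Iid sI [c ->]; apply: ideal_sum => // i _; case: Iid => _ _; apply.
by apply: sI; rewrite mem_nth.
Qed.

Lemma generated_sub s t x : {subset s <= t} -> generated_ideal s x -> generated_ideal t x.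
Proof.
move=> st; apply: generated_min; first exact: generated_ideal_ideal.
by move=> y /st; apply: mem_generated.
Qed.

(** A finite set of combinations of elements of [J] involves finitely many of them. *)
Lemma finitely_generated_subset (J : R -> Prop) s :
  (forall x, x \in s -> exists2 t, (forall y, y \in t -> J y) & generated_ideal t x) ->
  exists2 t, (forall y, y \in t -> J y) & forall x, generated_ideal s x -> generated_ideal t x.
Proof.
move=> h; suff [t tJ ts] : exists2 t, (forall y, y \in t -> J y) &
    forall x, x \in s -> generated_ideal t x.
  exists t => // x; apply: generated_min => //; exact: generated_ideal_ideal.
elim: s h => [|x s IH] h; first by exists [::].
have [|t tJ ts] := IH; first by move=> y ys; apply: h; rewrite inE ys orbT.
have [t' t'J xt'] := h x (mem_head _ _).
exists (t' ++ t) => y; first by rewrite mem_cat => /orP[/t'J|/tJ].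
rewrite inE => /predU1P[->|/ts yt]; [apply: generated_sub xt'|apply: generated_sub yt];
  by move=> z zt; rewrite mem_cat zt ?orbT.
Qed.

End Ideals.

Lemma nondecreasing_subsequence (f : nat -> nat) : exists phi : nat -> nat,
  (forall i j, (i < j)%N -> (phi i < phi j)%N) /\
  (forall i j, (i <= j)%N -> (f (phi i) <= f (phi j))%N).
Proof.
have least N : exists i, (N <= i)%N /\ forall j, (N <= j)%N -> (f i <= f j)%N.
  have [i iN] : exists i, (N <= i)%N by exists N.
  elim/ltn_ind: {i}(f i) {-2}i (erefl (f i)) iN => v IH i fi iN.
  have [h|] := pselect (forall j, (N <= j)%N -> (f i <= f j)%N); first by exists i.
  move=> /existsNP[j /not_implyP[Nj /negP]]; rewrite -ltnNge fi => lt.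
  exact: IH lt j (erefl _) Nj.
have [mn mnP] := choice least.
pose phi := fix phi i := if i is i'.+1 then mn (phi i').+1 else mn 0%N.
have phiS i : (phi i < phi i.+1)%N by have [] := mnP (phi i).+1.
have phi_lt i j : (i < j)%N -> (phi i < phi j)%N.
  exact: (homo_ltn ltn_trans phiS).
exists phi; split=> // i j; rewrite leq_eqVlt => /predU1P[->//|ij].
case: i ij => [|i] ij /=; first by have [_] := mnP 0%N; apply.
have [_] := mnP (phi i).+1; apply; apply: leq_trans (phi_lt _ _ ij).
by apply: ltnW; rewrite ltnS; apply: phi_lt.
Qed.

Lemma dickson n (u : nat -> 'X_{1..n}) : exists i j, (i < j)%N /\ (u i <= u j)%MM.
Proof.
suff [phi [phi_lt phi_le]] : exists phi : nat -> nat,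
    (forall i j, (i < j)%N -> (phi i < phi j)%N) /\
    (forall c, c \in enum 'I_n -> forall i j, (i <= j)%N -> (u (phi i) c <= u (phi j) c)%N).
  exists (phi 0%N), (phi 1%N); split; first exact: phi_lt.
  by apply/mnm_lepP => c; apply: phi_le; rewrite // mem_enum.
elim: (enum _) => [|c s [phi [phi_lt phi_le]]]; first by exists id.
have [psi [psi_lt psi_le]] := nondecreasing_subsequence (fun i => u (phi i) c).
exists (phi \o psi); split=> [i j ij|c']; first by apply/phi_lt/psi_lt.
rewrite inE => /predU1P[->|c's] i j ij /=; first exact: psi_le.
apply: phi_le => //; move: ij; rewrite leq_eqVlt => /predU1P[->//|/psi_lt]; exact: ltnW.
Qed.

(** Hilbert's argument: if [I] is not finitely generated, choose successively elements
    of [I] outside the ideal of the previous ones with least leading monomial.  By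
    Dickson's lemma a leading monomial divides a later one, and cancelling it
    contradicts minimality. *)
Lemma mpoly_noetherian n (k : fieldType) : noetherian {mpoly k[n]}.
Proof.
move=> I Iid; apply: contrapT => /forallNP noI.
have step (s : seq {mpoly k[n]}) : exists f, (forall x, x \in s -> I x) ->
    [/\ I f, ~ generated_ideal s f &
      forall g, I g -> ~ generated_ideal s g -> (mlead f <= mlead g)%O].
  have [sI|] := pselect (forall x, x \in s -> I x); last by exists 0.
  have /existsNP[f0 f0P] := noI s.
  have {f0P}[If0 nf0] : I f0 /\ ~ generated_ideal s f0.
    have gI := @generated_min _ I s f0 Iid sI.
    by split; [apply: contrapT => nI | move=> gf]; apply: f0P; split=> // /gI.
  elim/(@ltmwf n): {f0}(mlead f0) {-2}f0 (erefl (mlead f0)) If0 nf0 => m IH f fm If nf.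
  have [h|] := pselect (forall g, I g -> ~ generated_ideal s g -> (mlead f <= mlead g)%O).
    by exists f.
  move=> /existsNP[g /not_implyP[Ig /not_implyP[ng /negP]]].
  rewrite -Order.TotalTheory.ltNge fm => lt; exact: IH lt g (erefl _) Ig ng.
have [next nextP] := choice step.
pose S := fix S i := if i is i'.+1 then rcons (S i') (next (S i')) else [::].
have SI i : forall x, x \in S i -> I x.
  elim: i => [|i IH] //= x; rewrite mem_rcons inE => /predU1P[->|/IH//].
  by have [] := nextP _ IH.
have Smem i j : (i < j)%N -> next (S i) \in S j.
  elim: j => // j IH; rewrite ltnS leq_eqVlt mem_rcons inE => /predU1P[->|/IH->].
    by rewrite eqxx.
  by rewrite orbT.
have [i [j [ij le_ij]]] := dickson (fun i => mlead (next (S i))).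
have [Ifi nfi _] := nextP _ (SI i); have [Ifj nfj minj] := nextP _ (SI j).
set fi := next (S i) in le_ij Ifi nfi *; set fj := next (S j) in le_ij Ifj nfj minj *.
have gen_id (s : seq {mpoly k[n]}) := generated_ideal_ideal s.
have nz (s : seq {mpoly k[n]}) f : ~ generated_ideal s f -> f != 0.
  by move=> nf; apply/eqP => f0; apply: nf; rewrite f0; case: (gen_id s).
have fi0 := nz _ _ nfi; have fj0 := nz _ _ nfj.
pose q := (mleadc fj / mleadc fi) *: 'X_[mlead fj - mlead fi] : {mpoly k[n]}.
have q0 : q != 0.
  rewrite scaler_eq0 mulf_eq0 invr_eq0 !mleadc_eq0 (negPf fi0) (negPf fj0) /=.
  by rewrite -msize_poly_eq0 msizeX.
have leadq : mlead (q * fi) = mlead fj.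
  rewrite mleadM // mleadZ ?mleadXm ?submK //.
  by rewrite mulf_neq0 ?invr_eq0 ?mleadc_eq0.
have leadcq : (q * fi)@_(mlead fj) = mleadc fj.
  have leadcq' : mleadc q = mleadc fj / mleadc fi.
    by rewrite /q mleadcZE mleadXm mcoeffX eqxx mulr1.
  by rewrite -[in LHS]leadq mleadM // mleadcM leadcq' divfK ?mleadc_eq0.
pose h := fj - q * fi.
have Ih : I h by apply: idealB => //; case: Iid => _ _; apply.
have qgen : generated_ideal (S j) (q * fi).
  by case: (gen_id (S j)) => _ _; apply; apply/mem_generated/Smem.
have nh : ~ generated_ideal (S j) h.
  move=> gh; apply: nfj; rewrite -[fj](subrK (q * fi)).
  by case: (gen_id (S j)) => _ + _; apply.
have h0 := nz _ _ nh.
have le_h : (mlead h <= mlead fj)%O.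
  apply: Order.POrderTheory.le_trans (mleadB_le _ _) _.
  by rewrite leadq Order.JoinTheory.joinxx.
have eq_h : mlead h = mlead fj.
  by apply/Order.POrderTheory.le_anti; rewrite le_h minj.
case/eqP: h0; apply/eqP; rewrite -mleadc_eq0 eq_h mcoeffB leadcq subrr eqxx //.
Qed.

Section PureInvariants.

Variables (n : nat) (k : fieldType) (G : {group 'S_n}).
Local Notation R := {mpoly k[n]}.
Local Notation A := (invariant_ring k G).
Local Notation v := (@invariant_val n k G).

(** The extension of a finitely generated ideal to the polynomial ring contracts back
    to this ideal. *)
Definition pure_invariants : Prop := forall (s : seq A) (y : A),
  generated_ideal (map v s) (v y) -> generated_ideal s y.

Hypothesis pureA : pure_invariants.

Lemma invariant_ring_noetherian : noetherian A.
Proof.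
move=> I Iid.
pose vI (x : R) := exists2 y : A, I y & x = v y.
pose J x := exists2 t, (forall y, y \in t -> vI y) & generated_ideal t x.
have Jid : ideal J.
  split=> [|x y [t tI xt] [t' t'I yt']|a x [t tI xt]].
  - by exists [::] => //; case: (generated_ideal_ideal ([::] : seq R)).
  - exists (t ++ t') => [z|]; first by rewrite mem_cat => /orP[/tI|/t'I].
    case: (generated_ideal_ideal (t ++ t')) => _ + _; apply.
      by apply: generated_sub xt => z zt; rewrite mem_cat zt.
    by apply: generated_sub yt' => z zt; rewrite mem_cat zt orbT.
  - by exists t => //; case: (generated_ideal_ideal t) => _ _; apply.
have [s sJ] := mpoly_noetherian Jid.
have [|t tI ts] := @finitely_generated_subset _ vI s.
  by move=> x xs; apply/sJ/mem_generated.
have [t' t'I tt'] : exists2 t' : seq A, (forall y, y \in t' -> I y) & t = map v t'.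
  elim: t tI {ts} => [|x t IH] tI; first by exists [::].
  have [|t' t'I ->] := IH; first by move=> y yt; apply: tI; rewrite inE yt orbT.
  have [y Iy ->] := tI x (mem_head _ _).
  by exists (y :: t') => // z; rewrite inE => /predU1P[->//|/t'I].
exists t' => x; split; last exact: generated_min.
move=> Ix; apply: pureA; rewrite -tt'; apply: ts; apply/sJ.
exists [:: v x] => [y|]; first by rewrite inE => /eqP->; exists x.
by apply: mem_generated; rewrite inE.
Qed.

End PureInvariants.

(** * Primes, regular sequences and dimension *)

Section Primes.

Variable R : comNzRingType.
Implicit Types (I J P Q S : R -> Prop) (s : seq R).

Definition add_principal I x : R -> Prop := fun y => exists i r, I i /\ y = i + r * x.

Lemma add_principal_ideal I x : ideal I -> ideal (add_principal I x).
Proof.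
move=> [I0 ID IM]; split=> [|y z [i [r [Ii ->]]] [j [t [Ij ->]]]|a y [i [r [Ii ->]]]].
- by exists 0, 0; rewrite mul0r addr0.
- by exists (i + j), (r + t); rewrite mulrDl addrACA; split=> //; apply: ID.
- by exists (a * i), (a * r); rewrite mulrDr mulrA; split=> //; apply: IM.
Qed.

Lemma add_principal_sub I x y : I y -> add_principal I x y.
Proof. by move=> Iy; exists y, 0; rewrite mul0r addr0. Qed.

Lemma add_principal_mem I x : ideal I -> add_principal I x x.
Proof. by case=> I0 _ _; exists 0, 1; rewrite mul1r add0r. Qed.

(** Zorn's lemma.  The empty set is admitted besides the good ideals, because an empty
    chain has an empty union. *)
Lemma exists_maximal_avoiding I S : ideal I -> (forall x, S x -> ~ I x) ->
  exists Q, [/\ ideal Q, ideal_le I Q, forall x, S x -> ~ Q x &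
    forall J, ideal J -> ideal_le Q J -> (forall x, S x -> ~ J x) -> ideal_le J Q].
Proof.
move=> Iid IS; case: (Iid) => I0 _ _.
pose good J := [/\ ideal J, ideal_le I J & forall x, S x -> ~ J x].
have [F Fgood Fchain|Q [QP Qmax]] :=
    @classical_sets.Zorn_bigcup R (fun J => (forall x, ~ J x) \/ good J).
  have [[J FJ [x Jx]]|none] := pselect (exists2 J, F J & exists x, J x); last first.
    by left=> x [J FJ Jx]; apply: none; exists J => //; exists x.
  have Fid K y : F K -> K y -> good K by move=> FK Ky; case: (Fgood K FK) => [/(_ y)|].
  right; split; first split.
  - by exists J => //; have [_ IJ _] := Fid J x FJ Jx; apply: IJ.
  - move=> y z [K FK Ky] [L FL Lz].
    have [[_ KD _] _ _] := Fid K y FK Ky; have [[_ LD _] _ _] := Fid L z FL Lz.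
    case: (Fchain K L FK FL) => s; [exists L|exists K] => //.
      by apply: LD => //; apply: s.
    by apply: KD => //; apply: s.
  - move=> a y [K FK Ky]; exists K => //; have [[_ _ KM] _ _] := Fid K y FK Ky; exact: KM.
  - by move=> y Iy; exists J => //; have [_ IJ _] := Fid J x FJ Jx; apply: IJ.
  - move=> y Sy [K FK Ky]; have [_ _ h] := Fid K y FK Ky; exact: (h y Sy).
have [Qid IQ QS] : good Q.
  case: QP => // Q0; exfalso; apply: (Qmax I); last by right; split.
  by split=> [x /Q0//|/(_ 0 I0)]; apply: Q0.
exists Q; split=> // J Jid QJ JS; apply: contrapT => nJQ.
apply: (Qmax J); first by split.
by right; split=> // x /IQ; apply: QJ.
Qed.

Lemma exists_prime_avoiding I S : ideal I -> S 1 -> (forall x y, S x -> S y -> S (x * y)) ->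
  (forall x, S x -> ~ I x) ->
  exists Q, [/\ prime_ideal Q, ideal_le I Q & forall x, S x -> ~ Q x].
Proof.
move=> Iid S1 SM IS; have [Q [Qid IQ QS Qmax]] := exists_maximal_avoiding Iid IS.
exists Q; split=> //; split=> //; first exact: QS.
have meets x : ~ Q x -> exists q r, Q q /\ S (q + r * x).
  move=> Qx; apply: contrapT => none; apply: Qx.
  apply: (Qmax (add_principal Q x)); [exact: add_principal_ideal| | |exact: add_principal_mem].
    by move=> y; apply: add_principal_sub.
  by move=> y Sy [q [r [Qq yE]]]; apply: none; exists q, r; rewrite -yE.
move=> x y Qxy; apply: contrapT => /not_orP[/meets[q [r [Qq Sx]]] /meets[q' [r' [Qq' Sy]]]].
apply: (QS _ (SM _ _ Sx Sy)); case: Qid => _ QD QM.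
rewrite mulrDl; apply: (QD); first by rewrite mulrC; apply: QM.
rewrite mulrDr; apply: QD; first exact: QM.
by rewrite mulrACA; apply: QM.
Qed.

Lemma exists_maximal_ideal I : ideal I -> ~ I 1 -> exists2 M, maximal_ideal M & ideal_le I M.
Proof.
move=> Iid I1; have [|M [Mid IM M1 Mmax]] := @exists_maximal_avoiding I (eq 1) Iid.
  by move=> x <-.
exists M => //; split=> //; first exact: M1.
by move=> J Jid J1 MJ; apply: Mmax => // x <-.
Qed.

Lemma maximal_bezout P x : maximal_ideal P -> ~ P x -> exists q r, P q /\ 1 = q + r * x.
Proof.
move=> [Pid P1 Pmax] Px; apply: contrapT => none; apply: Px.
apply: (Pmax (add_principal P x)); [exact: add_principal_ideal|exact: none| |].
  by move=> y; apply: add_principal_sub.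
exact: add_principal_mem.
Qed.

Lemma maximal_prime P : maximal_ideal P -> prime_ideal P.
Proof.
move=> Pmax; have [Pid P1 _] := Pmax; split=> // x y Pxy.
have [|Px] := pselect (P x); [by left|right].
have [q [r [Pq e]]] := maximal_bezout Pmax Px; case: Pid => _ PD PM.
rewrite -[y]mul1r e mulrDl -mulrA; apply: PD; last exact: PM.
by rewrite mulrC; apply: PM.
Qed.

Lemma prime_expn Q x e : prime_ideal Q -> Q (x ^+ e) -> Q x.
Proof.
move=> [_ Q1 QP]; elim: e => [|e IH]; first by rewrite expr0.
by rewrite exprS => /QP[].
Qed.

(** Descend along the sequence.  If the prime [Q] contains the first [e + 1] elements,
    the products of a power of the last of them and an element outside [Q] avoid
    the ideal of the first [e], by regularity; a prime avoiding these products
    contains that ideal and lies strictly below [Q]. *)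
Lemma regular_chain P s : prime_ideal P -> (forall x, x \in s -> P x) ->
  regular_sequence s -> prime_chain_below P (size s).
Proof.
move=> Pprime sP [reg _].
suff [Q [Qprime Qlt QP _]] : exists Q : nat -> R -> Prop,
    [/\ forall i, (i <= size s)%N -> prime_ideal (Q i),
        forall i, (i < size s)%N -> ideal_le (Q i) (Q i.+1) /\ ~ ideal_le (Q i.+1) (Q i),
        forall x, Q (size s) x <-> P x
      & ideal_le (generated_ideal (take (size s - size s) s)) (Q 0%N)].
  by exists Q.
move: {1 3 4 5 7}(size s) (leqnn (size s)) => j; elim: j => [|j IH] js.
  exists (fun=> P); split=> // x; rewrite subn0 take_size.
  by apply: generated_min => //; case: Pprime.
have [Q [Qprime Qlt QP sQ]] := IH (ltnW js).
pose e := (size s - j.+1)%N.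
have eS : (e.+1 = size s - j)%N by rewrite /e subnSK.
have es : (e < size s)%N by rewrite /e -subSn // subSS leq_subr.
rewrite -eS in sQ; pose x := s`_e; pose I := generated_ideal (take e s).
have [Q0id Q01 Q0P] := Qprime 0%N isT.
have xQ0 : Q 0%N x.
  apply/sQ/mem_generated; rewrite (take_nth 0) // mem_rcons mem_head //.
have IQ0 : ideal_le I (Q 0%N).
  move=> y Iy; apply: sQ; apply: generated_sub Iy => z.
  by rewrite (take_nth 0) // mem_rcons inE => ->; rewrite orbT.
have reg_exp t r : I (x ^+ r * t) -> I t.
  elim: r => [|r IHr]; first by rewrite mul1r.
  by rewrite exprS -mulrA => /(reg e _ es)/IHr.
have [||y y' [t [r [Qt ->]]] [t' [r' [Qt' ->]]]|y [t [r [Qt ->]]] /reg_exp/IQ0//|] :=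
   @exists_prime_avoiding I (fun y => exists t r, ~ Q 0%N t /\ y = x ^+ r * t).
- exact: generated_ideal_ideal.
- by exists 1, 0%N; rewrite mul1r.
- exists (t * t'), (r + r')%N; rewrite exprD mulrACA; split=> // /Q0P.
  by case.
move=> Q' [Q'prime IQ' Q'S].
exists (fun i => if i is i'.+1 then Q i' else Q'); split.
- by case=> [|i] // ij; apply: Qprime.
- case=> [|i] ij; last exact: Qlt.
  split=> [y Q'y|/(_ x xQ0) Q'x].
    by apply: contrapT => Qy; apply: (Q'S y) => //; exists y, 0%N; rewrite mul1r.
  by apply: (Q'S x) => //; exists 1, 1%N; rewrite expr1 mulr1.
- exact: QP.
- exact: IQ'.
Qed.

(** The value at [a] of a polynomial with exponents below [N], written as a polynomial
    in the first element with coefficients that are polynomials in the others. *)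
Fixpoint nested_eval N (a : seq R) (c : seq nat -> R) : R :=
  if a is x :: a' then \sum_(j < N) x ^+ j * nested_eval N a' (fun w => c (nat_of_ord j :: w))
  else c [::].

Lemma nested_eval0 N a c :
  (forall w, size w = size a -> all (fun j => j < N)%N w -> c w = 0) -> nested_eval N a c = 0.
Proof.
elim: a c => [|x a IH] c h /=; first exact: h.
rewrite big1 // => j _; rewrite IH ?mulr0 // => w sw wN; apply: h => /=; first by rewrite sw.
by rewrite ltn_ord.
Qed.

(** Elements [a_i] separating the successive primes of a chain are independent: in a
    relation the lowest power of [a_0] can be cancelled modulo [Q_0], and the
    relation then holds modulo [Q_1], which contains [a_0]. *)
Lemma nested_eval_prime_chain N a (Q : nat -> R -> Prop) c :
  (forall i, (i <= size a)%N -> prime_ideal (Q i)) ->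
  (forall i, (i < size a)%N -> [/\ ideal_le (Q i) (Q i.+1), Q i.+1 a`_i & ~ Q i a`_i]) ->
  (forall w, c w = 0 \/ exists u, u * c w = 1) ->
  Q 0%N (nested_eval N a c) ->
  forall w, size w = size a -> all (fun j => j < N)%N w -> c w = 0.
Proof.
elim: a Q c => [|x a IH] Q c Qprime Qlt cunit /=.
  move=> Qc [] // _ _; case: (cunit [::]) => // -[u uc].
  have [[_ _ QM] Q1 _] := Qprime 0%N isT; case: Q1; rewrite -uc; exact: QM.
move=> Qev; have [Q0id Q01 Q0P] := Qprime 0%N isT.
have [Q01le xQ1 xQ0] := Qlt 0%N isT; have [Q1id _ _] := Qprime 1%N isT.
pose g j := nested_eval N a (fun w => c (j :: w)).
have coef0 j : (j < N)%N -> forall w, size w = size a -> all (fun j => j < N)%N w -> c (j :: w) = 0.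
  elim/ltn_ind: j => j IHj jN.
  apply: (IH (fun i => Q i.+1) (fun w => c (j :: w))) => [i ia|i ia|w|].
  - exact: Qprime.
  - exact: (Qlt i.+1).
  - exact: cunit.
  rewrite -/(g j).
  have gj0 i : (i < j)%N -> g i = 0.
    by move=> ij; apply: nested_eval0 => w; apply: IHj => //; apply: ltn_trans jN.
  pose h := \sum_(i < N | (j < i)%N) x ^+ (i - j.+1) * g i.
  have ev : nested_eval N (x :: a) c = x ^+ j * (g j + x * h).
    rewrite /= (bigD1 (Ordinal jN)) //= mulrDr; congr (_ + _).
    rewrite mulrA -exprSr /h mulr_sumr [RHS]big_mkcond [LHS]big_mkcond /=.
    apply: eq_bigr => i _; rewrite -/(g i) -val_eqE /=.
    case: (ltngtP i j) => //= ij; first by rewrite gj0 ?mulr0.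
    by rewrite mulrA -exprD subnKC.
  have /Q01le Qgh : Q 0%N (g j + x * h).
    by move: Qev; rewrite [X in Q 0%N X]ev => /Q0P[/prime_expn|//] => /(_ (Qprime 0%N isT)).
  rewrite -[g j](addrK (x * h)); apply: idealB => //.
  by rewrite mulrC; case: Q1id => _ _; apply.
by case=> [|j w] //= [sw] /andP[jN wN]; apply: coef0.
Qed.

Fixpoint words N r : seq (seq nat) :=
  if r is r'.+1 then [seq j :: w | j <- iota 0 N, w <- words N r'] else [:: [::]].

Fixpoint power_word (a : seq R) (w : seq nat) : R :=
  if a is x :: a' then if w is j :: w' then x ^+ j * power_word a' w' else 1 else 1.

Lemma nested_evalE N a c :
  nested_eval N a c = \sum_(w <- words N (size a)) c w * power_word a w.
Proof.
elim: a c => [|x a IH] c /=; first by rewrite big_seq1 mulr1.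
rewrite big_allpairs_dep -[X in _ = \sum_(i <- iota 0 X) _](subn0 N) -/(index_iota 0 N) big_mkord.
apply: eq_bigr => j _; rewrite IH mulr_sumr; apply: eq_bigr => w _.
by rewrite mulrCA.
Qed.

End Primes.

Lemma size_words N r : size (words N r) = (N ^ r)%N.
Proof. by elim: r => //= r IH; rewrite size_allpairs size_iota IH expnS. Qed.

Lemma mem_words N r w : w \in words N r -> size w = r /\ all (fun j => j < N)%N w.
Proof.
elim: r w => [|r IH] w /=; first by rewrite inE => /eqP->.
case/allpairsP => -[j v] /= [jN /IH[sv vN] ->] /=; rewrite sv vN andbT; split=> //.
by move: jN; rewrite mem_iota add0n.
Qed.

Lemma uniq_words N r : uniq (words N r).
Proof.
elim: r => //= r IH; apply: allpairs_uniq => //; first exact: iota_uniq.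
by move=> [j w] [j' w'] _ _ /= [-> ->].
Qed.

Section AlgebraicDependence.

Variables (n : nat) (k : fieldType).
Local Notation R := {mpoly k[n]}.

Lemma card_bmultinom b : (#|{: 'X_{1..n < b}}| <= b ^ n)%N.
Proof.
case: b => [|b].
  have -> : #|{: 'X_{1..n < 0}}| = 0%N; last by [].
  by apply: eq_card0 => m; have := bmdeg m; rewrite ltn0.
pose f (m : 'X_{1..n < b.+1}) : {ffun 'I_n -> 'I_b.+1} := [ffun i => inord (m i)].
rewrite -[X in (_ <= X ^ _)%N](card_ord b.+1) -[X in (_ <= _ ^ X)%N](card_ord n) -card_ffun.
apply: (leq_card f) => m m' /ffunP fE; apply/val_inj/mnmP => i.
have bnd (m0 : 'X_{1..n < b.+1}) : (m0 i < b.+1)%N.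
  by apply: leq_ltn_trans (bmdeg m0); rewrite mdegE (bigD1 i) //= leq_addr.
by have := congr1 val (fE i); rewrite !ffunE /= !inordK.
Qed.

Lemma msize_power_word (E N : nat) (a : seq R) w : (forall f, f \in a -> msize f <= E)%N ->
  size w = size a -> all (fun j => j < N)%N w -> (msize (power_word a w) <= size a * (N * E).+1 + 1)%N.
Proof.
elim: a w => [|f a IH] [|j w] aE //; first by rewrite msize1.
move=> [sw] /andP[jN wN].
suff: (msize (f ^+ j * power_word a w) <= (size a).+1 * (N * E).+1 + 1)%N by [].
apply: (@leq_trans (msize (f ^+ j) + msize (power_word a w))%N); first exact: leq_trans (msizeM_pred _ _) (leq_pred _).
have le_a : (msize (power_word a w) <= size a * (N * E).+1 + 1)%N.
  by apply: IH => // g ga; apply: aE; rewrite inE ga orbT.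
suff le_f : (msize (f ^+ j) <= (N * E).+1)%N.
  by apply: leq_trans (leq_add le_f le_a) _; rewrite addnA -mulSn.
have fE : (msize f <= E)%N by apply: aE; rewrite mem_head.
apply: (@leq_trans (j * E).+1); last by rewrite ltnS leq_mul2r (ltnW jN) orbT.
elim: j {jN} => [|j IHj]; first by rewrite expr0 msize1.
rewrite exprS; apply: (@leq_trans (msize f + msize (f ^+ j))%N); first exact: leq_trans (msizeM_pred _ _) (leq_pred _).
by apply: leq_trans (leq_add fE IHj) _; rewrite addnS -mulSn.
Qed.

(** There are [N ^ (n + 1)] products with exponents below [N], in a space of dimension
    at most [(N * C) ^ n] for a constant [C]. *)
Lemma algebraic_dependence (a : seq R) : size a = n.+1 ->
  exists N (c : seq nat -> k),
    (exists2 w, w \in words N n.+1 & c w != 0) /\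
    \sum_(w <- words N n.+1) c w *: power_word a w = 0.
Proof.
move=> sa; pose E := \max_(f <- a) msize f.
have aE f : f \in a -> (msize f <= E)%N.
  by move=> fa; rewrite /E (big_rem f fa) /= leq_maxl.
(* Every product of the [a_i] with exponents below [N] has size at most [b], hence
fewer than [(N * C) ^ n] monomials are available to it, and [C ^ n < N]. *)
pose C := (n.+1 * E.+1 + 1)%N; pose N := (C ^ n).+1; pose b := (n.+1 * (N * E).+1 + 1)%N.
have bNC : (b <= N * C)%N.
  rewrite /b /C mulnDr muln1; apply: leq_add; last by [].
  by rewrite mulnCA leq_mul2l /= mulnS -[X in (X < _)%N]add0n ltn_add2r.
have lt : (#|{: 'X_{1..n < b}}| < size (words N n.+1))%N.
  rewrite size_words; apply: leq_ltn_trans (card_bmultinom b) _.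
  apply: (@leq_ltn_trans ((N * C) ^ n)).
    by elim: (n) => // i IH; rewrite !expnS leq_mul.
  by rewrite expnMn expnS mulnC ltn_mul2r expn_gt0 /N /=.
have [W WE] : exists W, W = words N n.+1 by exists (words N n.+1).
have uW : uniq W by rewrite WE uniq_words.
have memW w : w \in W -> size w = n.+1 /\ all (fun j => j < N)%N w.
  by rewrite WE => /mem_words.
rewrite -WE in lt.
pose M := \matrix_(i < size W, j < #|{: 'X_{1..n < b}}|)
  (power_word a (nth [::] W i))@_(enum_val j : 'X_{1..n < b}).
have /rowV0Pn[u /sub_kermxP uM u0] : kermx M != 0.
  rewrite -mxrank_eq0 mxrank_ker subn_eq0 -ltnNge.
  exact: leq_ltn_trans (rank_leq_col M) lt.
pose c w := if insub (index w W) is Some i then u 0 i else 0.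
have cE (i : 'I_(size W)) : c (nth [::] W i) = u 0 i.
  rewrite /c index_uniq // (_ : insub (i : nat) = Some i) //.
  by rewrite valK.
exists N, c; rewrite -WE; split.
  have /existsP[i ui] : [exists i, u 0 i != 0].
    apply: contraNT u0; rewrite negb_exists => /forallP h; apply/eqP/rowP => i.
    by rewrite mxE; apply/eqP; have := h i; rewrite negbK.
  by exists (nth [::] W i); rewrite ?mem_nth ?cE.
rewrite (big_nth [::]) big_mkord; apply/mpolyP => m; rewrite raddf_sum mcoeff0 /=.
have [mb|mb] := ltnP (mdeg m) b; last first.
  rewrite big1 // => i _; rewrite mcoeffZ.
  have [sw wN] := memW _ (mem_nth [::] (ltn_ord i)).
  rewrite memN_msupp_eq0 ?mulr0 //; apply: msize_mdeg_ge; apply: leq_trans mb.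
  by rewrite /b -sa; apply: msize_power_word => //; rewrite sw sa.
pose j := enum_rank (BMultinom mb).
transitivity ((u *m M) 0 j); last by rewrite uM mxE.
rewrite mxE; apply: eq_bigr => i _; rewrite mcoeffZ cE mxE enum_rankK //.
Qed.

End AlgebraicDependence.

Section InvariantDimension.

Variables (n : nat) (k : fieldType) (G : {group 'S_n}).
Local Notation R := {mpoly k[n]}.
Local Notation A := (invariant_ring k G).
Local Notation v := (@invariant_val n k G).

Lemma const_invariant (c : k) : c%:MP \in invariant_pred (k := k) G.
Proof. by apply/invariantP => s _; rewrite msymC. Qed.

Definition invariant_const (c : k) : A := InvariantRing (const_invariant c).

Lemma invariant_valM (x y : A) : v (x * y) = v x * v y.
Proof. exact: (rmorphM (\val : A -> R)). Qed.

Lemma invariant_valX (x : A) e : v (x ^+ e) = v x ^+ e.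
Proof. exact: (rmorphXn (\val : A -> R)). Qed.

Lemma val_power_word (a : seq A) w : v (power_word a w) = power_word (map v a) w.
Proof.
elim: a w => [|x a IH] [|j w] //=.
by have := invariant_valM (x ^+ j) (power_word a w); rewrite invariant_valX IH.
Qed.

Lemma invariant_chain_length P d : prime_chain_below (R := A) P d -> (d <= n)%N.
Proof.
case=> Q [Qprime Qlt _]; rewrite leqNgt; apply/negP => nd.
have pick i : exists x, (i < n.+1)%N -> Q i.+1 x /\ ~ Q i x.
  have [iN|] := ltnP i n.+1; last by exists 0.
  have [_ nle] := Qlt i (leq_trans iN nd).
  move/existsNP: nle => [x /not_implyP[? ?]]; by exists x.
have [f fP] := choice pick.
pose a := mkseq f n.+1; have sa : size a = n.+1 by rewrite size_mkseq.
have [|N [c [[w wW cw] cE]]] := @algebraic_dependence n k (map v a).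
  by rewrite size_map.
have [sw wN] := mem_words wW.
pose cA w := invariant_const (c w).
have /(congr1 v) : cA w = 0.
  apply: (@nested_eval_prime_chain _ N a Q cA) => [i ia|i ia|w'||//|//].
  - by apply: Qprime; apply: leq_trans ia _; rewrite sa.
  - rewrite sa in ia; have [le _] := Qlt i (leq_trans ia nd).
    by rewrite nth_mkseq //; have [] := fP i ia.
  - have [c0|c0] := eqVneq (c w') 0; [left|right]; first by apply: val_inj; rewrite /= c0 mpolyC0.
    by exists (invariant_const (c w')^-1); apply: val_inj; rewrite /= -mpolyCM mulVf.
  - suff -> : nested_eval N a cA = 0 by have [[]] := Qprime 0%N isT.
    rewrite nested_evalE sa; apply: val_inj; rewrite raddf_sum; apply: (etrans _ cE).
    apply: eq_bigr => w' _; rewrite -mul_mpolyC -val_power_word //.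
  - by rewrite sa.
by rewrite /= => /mpolyC_inj/eqP; rewrite (negPf cw).
Qed.

End InvariantDimension.

(** * Residue fields of polynomial rings *)

(** An inductive predicate gives induction on the elements of the algebra generated by
    the [us] over the image of [f]. *)
Inductive in_subalgebra (D K : nzRingType) (f : D -> K) (us : seq K) : K -> Prop :=
| in_subalgebra_const d : in_subalgebra f us (f d)
| in_subalgebra_gen u : u \in us -> in_subalgebra f us u
| in_subalgebra_add x y :
    in_subalgebra f us x -> in_subalgebra f us y -> in_subalgebra f us (x + y)
| in_subalgebra_mul x y :
    in_subalgebra f us x -> in_subalgebra f us y -> in_subalgebra f us (x * y).

(** Over a domain this is algebraicity over its field of fractions. *)
Definition algebraic_over (D K : nzRingType) (f : D -> K) (u : K) : Prop :=
  exists2 p : {poly D}, p != 0 & root (map_poly f p) u.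

Lemma count_lt (T : eqType) (a b : pred T) (s : seq T) x :
  subpred a b -> x \in s -> b x -> ~~ a x -> (count a s < count b s)%N.
Proof.
move=> ab xs bx ax; elim: s xs => //= y s IH; rewrite inE => /predU1P[<-|/IH lt].
  by rewrite bx (negPf ax) add0n add1n ltnS sub_count.
by rewrite -addnS leq_add //; case ay: (a y) => //; rewrite ab.
Qed.

Section LeadingCoefficient.

Variables (D : idomainType) (K : comNzRingType) (f : {rmorphism D -> K}).
Hypothesis f_inj : injective f.

(** With [a] the leading coefficient and [d + 1] the degree of [p], the polynomial
    [a ^ d p(X / a)] is monic with coefficients in [D] and vanishes at [a u]. *)
Lemma integral_lead_coef (p : {poly D}) u : p != 0 -> root (map_poly f p) u ->
  integralOver f (f (lead_coef p) * u).
Proof.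
move=> p0; rewrite rootE => pu; set a := lead_coef p.
have sp : size (map_poly f p) = size p.
  by apply: size_map_inj_poly => //; rewrite rmorph0.
have [d dE] : exists d, size p = d.+2.
  case sE : (size p) => [|[|d]]; [| |by exists d].
    by move/eqP: sE; rewrite size_poly_eq0 (negPf p0).
  move/eqP: sE => /size_poly1P[c c0 pE]; move: pu; rewrite pE map_polyC hornerC.
  by rewrite -(rmorph0 f) (inj_eq f_inj) (negPf c0).
pose q := 'X^(d.+1) + \poly_(j < d.+1) (p`_j * a ^+ (d - j)).
exists q.
  by rewrite monicE lead_coefDl ?lead_coefXn // size_polyXn ltnS size_poly.
rewrite rootE rmorphD /= map_polyXn hornerD hornerXn.
have -> : map_poly f (\poly_(j < d.+1) (p`_j * a ^+ (d - j))) =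
    \poly_(j < d.+1) f (p`_j * a ^+ (d - j)).
  apply/polyP => i; rewrite coef_map !coef_poly; case: ifP => // _; exact: rmorph0.
rewrite horner_poly; move: pu; rewrite horner_coef sp dE big_ord_recr /= => /eqP pu.
have aE : a = p`_d.+1 by rewrite /a lead_coefE dE.
apply/eqP; rewrite exprMn; transitivity (f a ^+ d * (\sum_(i < d.+1) (map_poly f p)`_i * u ^+ i
   + (map_poly f p)`_d.+1 * u ^+ d.+1)); last by rewrite pu mulr0.
rewrite mulrDr addrC mulr_sumr; congr (_ + _).
  apply: eq_bigr => i _; rewrite coef_map rmorphM rmorphXn exprMn mulrA.
  rewrite -[f p`_i * _ * _]mulrA -exprD subnK; last by rewrite -ltnS.
  by rewrite mulrA [f a ^+ d * _]mulrC.
by rewrite coef_map -aE mulrA -exprSr.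
Qed.

End LeadingCoefficient.

Section Zariski.

Variable K : comNzRingType.
Hypothesis K_field : forall y : K, y != 0 -> exists z, z * y = 1.
Variable us : seq K.

Lemma one_addX_neq0 (D : idomainType) (a : {poly D}) : a != 0 ->
  size (1 + a * 'X) = (size a).+1.
Proof.
move=> a0; rewrite addrC size_addl size_mulX // size_poly1 ltnS lt0n size_poly_eq0.
exact: a0.
Qed.

(** The polynomial [1 + a X] is comaximal with [a] and with every power of [a], but it
    is not a unit. *)
Lemma one_addX_ndvd (D : idomainType) (a w : {poly D}) e : a != 0 ->
  a ^+ e <> (1 + a * 'X) * w.
Proof.
move=> a0 ae; set b := 1 + a * 'X in ae.
have [t bt] : exists t, b * t = 1.
  pose S := \sum_(i < e) (b - 1) ^+ (e.-1 - i) * (-1) ^+ i.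
  have := subrXX (b - 1) (-1) e; rewrite opprK subrK => h.
  have h2 : (b - 1) ^+ e = b * (w * 'X^e).
    by rewrite mulrA -ae -exprMn /b addrC addKr.
  exists ((-1) ^+ e * (w * 'X^e - \sum_(i < e) (b - 1) ^+ (e.-1 - i) * (-1) ^+ i)).
  rewrite mulrCA mulrBr -h -h2 opprB addrC subrK -expr2 -exprM mulnC exprM.
  by rewrite sqrrN expr1n expr1n.
have b0 : b != 0 by apply/eqP => b0; move/eqP: bt; rewrite b0 mul0r eq_sym oner_eq0.
have t0 : t != 0 by apply/eqP => t0; move/eqP: bt; rewrite t0 mulr0 eq_sym oner_eq0.
have := congr1 (size : {poly D} -> nat) bt; rewrite size_mul // size_poly1 one_addX_neq0 //.
have : (0 < size a)%N by rewrite lt0n size_poly_eq0.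
have : (0 < size t)%N by rewrite lt0n size_poly_eq0.
by case: (size a) (size t) => [|x] [|y] //= _ _; rewrite !addSn !addnS.
Qed.

(** A polynomial [a] multiplies all generators, hence a power of [a] any element of the
    field, into the integral elements.  For the inverse of [1 + a X] this makes
    [1 + a X] divide a power of [a]. *)
Lemma not_all_algebraic_over_poly (D : idomainType) (f : {rmorphism {poly D} -> K}) :
  injective f -> (forall y, in_subalgebra f us y) ->
  ~ (forall u, u \in us -> algebraic_over f u).
Proof.
move=> f_inj gen alg.
have [a a0 aint] : exists2 a, a != 0 & forall u, u \in us -> integralOver f (f a * u).
  elim: us alg => [|u s IH] alg; first by exists 1; rewrite ?oner_neq0.
  have [|a a0 aint] := IH; first by move=> v vs; apply: alg; rewrite inE vs orbT.
  have [p p0 pu] := alg u (mem_head _ _).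
  exists (a * lead_coef p); first by rewrite mulf_neq0 ?lead_coef_eq0.
  move=> v; rewrite inE rmorphM => /predU1P[->|vs].
    by rewrite -mulrA; apply: integral_mul; [exact: integral_id | exact: integral_lead_coef].
  by rewrite [f a * _]mulrC -mulrA; apply: integral_mul; [exact: integral_id | exact: aint].
have aint' y : exists N, integralOver f (f a ^+ N * y).
  elim: (gen y) => {y} [d|u us_u|x y _ [N xN] _ [N' yN']|x y _ [N xN] _ [N' yN']].
  - by exists 0%N; rewrite mul1r; apply: integral_id.
  - by exists 1%N; rewrite expr1; apply: aint.
  - exists (N + N')%N; rewrite mulrDr exprD; apply: integral_add.
      rewrite [f a ^+ N * _]mulrC -mulrA; apply: integral_mul => //.
      by rewrite -rmorphXn; apply: integral_id.
    rewrite -mulrA; apply: integral_mul => //.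
    by rewrite -rmorphXn; apply: integral_id.
  - by exists (N + N')%N; rewrite exprD mulrACA; apply: integral_mul.
pose b : {poly D} := 1 + a * 'X.
have b0 : b != 0 by rewrite -size_poly_eq0 one_addX_neq0.
have [y yb] : exists z, z * f b = 1.
  by apply: K_field; rewrite -(rmorph0 f) (inj_eq f_inj).
have [N [P Pmonic]] := aint' y; rewrite rootE horner_coef.
have sP : size (map_poly f P) = size P.
  by apply: size_map_inj_poly => //; rewrite rmorph0.
have [d dE] : exists d, size P = d.+1.
  case sE : (size P) => [|d]; last by exists d.
  by move/eqP: sE; rewrite size_poly_eq0 (negPf (monic_neq0 Pmonic)).
rewrite sP dE big_ord_recr /=.
have Pd : P`_d = 1 by move/monicP: Pmonic; rewrite lead_coefE dE.
have fPd : f P`_d = 1 by rewrite Pd rmorph1.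
have cPd : (map_poly f P)`_d = 1 by rewrite coef_map; exact: fPd.
rewrite cPd mul1r => /eqP/(congr1 (fun x => x * f b ^+ d)).
rewrite mul0r mulrDl mulr_suml.
have ybX i : (i <= d)%N -> (f a ^+ N * y) ^+ i * f b ^+ d = f (a ^+ (N * i) * b ^+ (d - i)).
  move=> id; rewrite rmorphM !rmorphXn -{1}(subnKC id) exprD mulrA -exprMn -mulrA yb mulr1.
  by rewrite -exprM.
rewrite ybX // subnn mulr1 (eq_bigr (fun i : 'I_d => f (P`_i * (a ^+ (N * i) * b ^+ (d - i.+1)) * b))).
  rewrite -rmorph_sum -rmorphD -(rmorph0 f) => /f_inj.
  rewrite -mulr_suml addrC => /eqP; rewrite addr_eq0 -mulNr mulrC => /eqP.
  exact: one_addX_ndvd.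
move=> i _; rewrite coef_map -[LHS]mulrA ybX ?(ltnW (ltn_ord i)) //.
apply: (etrans (esym (rmorphM f _ _))); congr (f _).
by rewrite -!mulrA; congr (_ * (_ * _)); rewrite -exprSr subnSK.
Qed.

(** Adjoining a transcendental generator to the ring of coefficients decreases the
    number of the generators that are not algebraic, until all are algebraic over
    a polynomial ring. *)
Lemma generators_algebraic (D : idomainType) (f : {rmorphism D -> K}) :
  injective f -> (forall y, in_subalgebra f us y) ->
  forall u, u \in us -> algebraic_over f u.
Proof.
pose nonalg (E : idomainType) (g : E -> K) u := ~~ `[<algebraic_over g u>].
have [c cnt] : exists c, (count (nonalg D f) us < c)%N by exists (count (nonalg D f) us).+1.
elim: c D f cnt => // c IH D f cnt f_inj gen.
have [all_alg|/existsNP[u /not_implyP[u_us u_trans]]] :=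
  pselect (forall u, u \in us -> algebraic_over f u); first exact: all_alg.
have cfu : commr_rmorph f u by move=> x; apply: mulrC.
pose g : {rmorphism {poly D} -> K} := horner_morph cfu.
have gE p : g p = (map_poly f p).[u] by [].
have gC d : g d%:P = f d by rewrite gE map_polyC hornerC.
have g_inj : injective g.
  apply: raddf_inj => p pu; have {}pu : (map_poly f p).[u] = 0 by exact: pu.
  apply/eqP; apply: contra_notT u_trans => p0.
  by exists p; rewrite // rootE pu.
have g_gen y : in_subalgebra g us y.
  elim: (gen y) => {y} [d|v|x y _ + _|x y _ + _].
  - rewrite -gC; exact: in_subalgebra_const.
  - exact: in_subalgebra_gen.
  - exact: in_subalgebra_add.
  - exact: in_subalgebra_mul.
have g_alg v : algebraic_over f v -> algebraic_over g v.
  case=> p p0 pv; exists (map_poly polyC p).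
    by rewrite map_poly_eq0_id0 // polyC_eq0 lead_coef_eq0.
  rewrite -map_poly_comp (eq_map_poly (g := f)) //=.
case: (not_all_algebraic_over_poly g_inj g_gen); apply: IH => //.
apply: leq_trans (cnt : (_ <= c)%N); apply: (@count_lt _ _ _ _ u) => // [v||].
- by rewrite /nonalg; apply: contra => /asboolP/g_alg/asboolP.
- by rewrite /nonalg; apply/asboolPn.
- rewrite negbK; apply/asboolP; exists ('X - 'X%:P).
    exact: monic_neq0 (monicXsubC _).
  by rewrite rmorphB /= map_polyX map_polyC /= -/(g 'X) gE map_polyX hornerX root_XsubC.
Qed.

End Zariski.

Section ResidueField.

Variables (R : comNzRingType) (M : R -> Prop).
Hypothesis M_max : maximal_ideal M.

Definition ideal_mem : {pred R} := fun x => `[<M x>].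

Lemma ideal_mem_closed : idealr_closed ideal_mem.
Proof.
have [[M0 MD MM] M1 _] := M_max; split.
- exact/asboolP.
- exact/asboolP.
- move=> a x y /asboolP Mx /asboolP My; apply/asboolP; apply: MD => //; exact: MM.
Qed.

HB.instance Definition _ := isIdealr.Build R ideal_mem ideal_mem_closed.

Definition residue_field := {ideal_quot ideal_mem}.
Definition residue : {rmorphism R -> residue_field} := \pi_residue_field%qT.

Lemma residue_eq0 x : residue x = 0 <-> M x.
Proof.
have := Quotient.idealrBE ideal_mem x 0; rewrite subr0.
rewrite /residue -[\pi_residue_field%qT 0]/(residue 0) (rmorph0 residue) => e.
split=> [x0|Mx]; first by apply/asboolP; change (x \in ideal_mem); rewrite e; apply/eqP.
by apply/eqP; rewrite -e; apply/asboolP.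
Qed.

Lemma residueP (y : residue_field) : exists x, residue x = y.
Proof. by exists (generic_quotient.repr y); exact: generic_quotient.reprK. Qed.

Lemma residue_field_inv (y : residue_field) : y != 0 -> exists z, z * y = 1.
Proof.
have [x <-] := residueP y => /eqP x0.
have [|q [r [Mq e]]] := maximal_bezout M_max (x := x); first by move/residue_eq0.
exists (residue r); rewrite -rmorphM; apply/eqP; rewrite -subr_eq0 -(rmorph1 residue) -rmorphB.
by apply/eqP/residue_eq0; rewrite e opprD addrCA subrr addr0; apply: idealN => //; case: M_max.
Qed.

End ResidueField.

(** Zariski's lemma: a field that is finitely generated as an algebra is algebraic. *)
Lemma zariski_maximal n (k : fieldType) (M : {mpoly k[n]} -> Prop) : maximal_ideal M ->
  forall i, exists2 q : {poly k}, q != 0 & M (map_poly (@mpolyC n k) q).['X_i].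
Proof.
move=> M_max i; pose res := residue M_max.
pose f : {rmorphism k -> residue_field M_max} := res \o @mpolyC n k.
pose us := [seq res 'X_j | j <- enum 'I_n].
have gen y : in_subalgebra f us y.
  have [p <-] := residueP y; rewrite -/res [p]mpolyE rmorph_sum.
  have c0 : in_subalgebra f us 0 by rewrite -(rmorph0 f); apply: in_subalgebra_const.
  apply: (big_ind (in_subalgebra f us)) => // [x z|m _]; first exact: in_subalgebra_add.
  rewrite -mul_mpolyC rmorphM; apply: in_subalgebra_mul.
    exact: (in_subalgebra_const f us p@_m).
  have c1 : in_subalgebra f us 1 by rewrite -(rmorph1 f); apply: in_subalgebra_const.
  rewrite mpolyXE_id rmorph_prod; apply: (big_ind (in_subalgebra f us)) => // [x z|j _].
    exact: in_subalgebra_mul.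
  rewrite rmorphXn; elim: (m j) => [|e IH]; first by rewrite expr0.
  rewrite exprS; apply: in_subalgebra_mul => //; apply: in_subalgebra_gen.
  by apply: map_f; rewrite mem_enum.
have [||q q0 qi] := @generators_algebraic _ (@residue_field_inv _ _ M_max) us k f _ gen (res 'X_i).
- exact: fmorph_inj.
- by apply: map_f; rewrite mem_enum.
exists q => //; apply/(residue_eq0 M_max); rewrite -/res.
move: qi; rewrite rootE => /eqP <-; rewrite -horner_map /= -map_poly_comp //.
Qed.

(** * Symmetric polynomials in univariate values *)

Section DegreeBound.

Variables (n : nat) (k : fieldType).
Local Notation R := {mpoly k[n]}.

Definition deg_le (e : nat) (p : R) : Prop := forall m, m \in msupp p -> (mdeg m <= e)%N.

Lemma deg_le_msize e p : deg_le e p <-> (msize p <= e.+1)%N.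
Proof.
split=> [h|pe m /msize_mdeg_lt lt]; last by rewrite -ltnS (leq_trans lt pe).
rewrite msizeE; apply/bigmax_leqP_seq => m mp _; rewrite ltnS; exact: h.
Qed.

Lemma deg_leW e e' p : (e <= e')%N -> deg_le e p -> deg_le e' p.
Proof. by move=> ee h m /h me; apply: leq_trans ee. Qed.

Lemma deg_leM e e' p q : deg_le e p -> deg_le e' q -> deg_le (e + e') (p * q).
Proof.
move=> /deg_le_msize pe /deg_le_msize qe; apply/deg_le_msize.
apply: leq_trans (msizeM_pred p q) _; move: pe qe; move: (msize p) (msize q); lia.
Qed.

Lemma deg_leD e p q : deg_le e p -> deg_le e q -> deg_le e (p + q).
Proof. by move=> pe qe m /msuppD_le; rewrite mem_cat => /orP[/pe|/qe]. Qed.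

Lemma deg_le0 e : deg_le e 0.
Proof. by move=> m; rewrite msupp0. Qed.

Lemma deg_leC e c : deg_le e c%:MP.
Proof.
by move=> m; rewrite msuppC; case: eqP => // _; rewrite inE => /eqP->; rewrite mdeg0.
Qed.

Lemma deg_le_sum e (I : Type) (r : seq I) (P : pred I) (F : I -> R) :
  (forall i, P i -> deg_le e (F i)) -> deg_le e (\sum_(i <- r | P i) F i).
Proof.
move=> h; apply: (big_ind (deg_le e)) => //; [exact: deg_le0 | exact: deg_leD].
Qed.

Lemma deg_leX m : deg_le (mdeg m) 'X_[m].
Proof. by move=> m'; rewrite msuppX inE => /eqP->. Qed.

Lemma deg_leXn e p t : deg_le e p -> deg_le (e * t) (p ^+ t).
Proof.
move=> pe; elim: t => [|t IH]; first by rewrite expr0 -mpolyC1; apply: deg_leC.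
by rewrite exprS mulnS; apply: deg_leM.
Qed.

Definition supported (C : 'X_{1..n} -> Prop) (p : R) : Prop :=
  forall m, m \in msupp p -> C m.

Lemma supportedM (C1 C2 C3 : 'X_{1..n} -> Prop) p q :
  (forall m1 m2, C1 m1 -> C2 m2 -> C3 (m1 + m2)%MM) ->
  supported C1 p -> supported C2 q -> supported C3 (p * q).
Proof.
move=> h hp hq m /msuppM_le /allpairsP[[m1 m2] /= [m1p m2q ->]].
by apply: h; [apply: hp | apply: hq].
Qed.

Lemma supportedD C p q : supported C p -> supported C q -> supported C (p + q).
Proof. by move=> hp hq m /msuppD_le; rewrite mem_cat => /orP[/hp|/hq]. Qed.

Lemma supportedN C p : supported C p -> supported C (- p).
Proof. by move=> hp m; rewrite (perm_mem (msuppN p)); apply: hp. Qed.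

Lemma supported0 C : supported C 0.
Proof. by move=> m; rewrite msupp0. Qed.

Lemma supportedC (C : 'X_{1..n} -> Prop) c : C 0%MM -> supported C c%:MP.
Proof. by move=> C0 m; rewrite msuppC; case: eqP => // _; rewrite inE => /eqP->. Qed.

End DegreeBound.

Section SymmetricRegularSequence.

Variables (n : nat) (k : fieldType) (q : {poly k}) (d : nat).
Hypotheses (q_monic : q \is monic) (q_size : size q = d.+1) (d_gt0 : (0 < d)%N).
Local Notation R := {mpoly k[n]}.

Definition var_value (i : 'I_n) : R := (map_poly (@mpolyC n k) q).['X_i].
Local Notation z := var_value.

Definition tail_poly (i : nat) : {poly R} :=
  \prod_(j <- drop i (enum 'I_n)) ('X - (z j)%:P).
Local Notation F := tail_poly.

(** Up to sign, the elementary symmetric polynomial of degree [n - j] in the [z_i]. *)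
Definition sym_coef (j : nat) : R := (F 0)`_j.
Local Notation f := sym_coef.

Definition sym_deg (j : nat) : nat := (d * (n - j))%N.
Local Notation D := sym_deg.

Lemma sym_deg_gt0 (j : 'I_n) : (0 < D j)%N.
Proof. by rewrite muln_gt0 d_gt0 subn_gt0 ltn_ord. Qed.

Lemma size_tail_poly i : size (F i) = (n - i).+1.
Proof. by rewrite /F size_prod_XsubC size_drop size_enum_ord. Qed.

Lemma tail_poly_lead i : (F i)`_(n - i) = 1.
Proof.
have /monicP := monic_prod_XsubC (drop i (enum 'I_n)) xpredT z.
by rewrite lead_coefE size_tail_poly.
Qed.

Lemma tail_polyS (i : 'I_n) : F i = ('X - (z i)%:P) * F i.+1.
Proof.
have dropE : drop i (enum 'I_n) = i :: drop i.+1 (enum 'I_n).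
  by rewrite (drop_nth i) ?nth_ord_enum // size_enum_ord.
by rewrite /F dropE big_cons.
Qed.

Lemma var_value_sum i : z i = \sum_(t < d.+1) q`_t *: 'X_i ^+ t.
Proof.
rewrite /z (@horner_coef_wide _ d.+1) ?(leq_trans (size_poly _ _)) ?q_size //.
by apply: eq_bigr => t _; rewrite coef_map -mul_mpolyC.
Qed.

Lemma msym_var_value (s : 'S_n) i : msym s (z i) = z (s i).
Proof.
rewrite !var_value_sum rmorph_sum; apply: eq_bigr => t _.
by rewrite /= msymZ rmorphXn /= msymXU.
Qed.

Lemma msym_sym_coef (s : 'S_n) j : msym s (f j) = f j.
Proof.
have FE : map_poly (msym s) (F 0) = F 0.
  rewrite /F drop0 rmorph_prod [LHS]big_enum [RHS]big_enum /=.
  rewrite [RHS](reindex_inj (@perm_inj _ s)) /=; apply: eq_bigr => i _.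
  by rewrite rmorphB /= map_polyX map_polyC /= msym_var_value.
by rewrite /f -[in RHS]FE coef_map.
Qed.

Lemma sym_coef_ideal (M : R -> Prop) j : ideal M -> (forall i, M (z i)) -> (j < n)%N -> M (f j).
Proof.
move=> Mid Mz; have [M0 MD MM] := Mid.
suff h s t : (t < size s)%N -> M (\prod_(i <- s) ('X - (z i)%:P))`_t.
  by move=> jn; rewrite /f /F drop0; apply: h; rewrite size_enum_ord.
elim: s t => // i s IH t /=; rewrite ltnS => ts.
rewrite big_cons mulrBl coefB coefXM coefCM; apply: idealB => //; last first.
  by rewrite mulrC; apply: MM.
by case: t ts => //= t ts; apply: IH.
Qed.

Lemma deg_le_var_value i : deg_le d (z i).
Proof.
rewrite var_value_sum; apply: deg_le_sum => t _; rewrite -mul_mpolyC.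
apply: (@deg_leM _ _ 0 d); first exact: deg_leC.
apply: (@deg_leW _ _ (1 * t)); first by rewrite mul1n -ltnS.
by apply: deg_leXn; rewrite -(mdeg1 i); apply: deg_leX.
Qed.

Definition only_var (i : 'I_n) (m : 'X_{1..n}) : Prop := forall u, u != i -> m u = 0%N.

(** Reduction modulo the [sym_coef] to the shape [C] that never exceeds the degree
    [e]; without this bound the later induction on the degree would not work. *)
Definition reducible (C : 'X_{1..n} -> Prop) (e : nat) (p : R) : Prop :=
  exists (g : 'I_n -> R) (r : R),
  [/\ p = \sum_(j < n) f j * g j + r,
      forall j : 'I_n, g j = 0 \/ (D j <= e)%N /\ deg_le (e - D j) (g j),
      deg_le e r & supported C r].

Lemma reducible_supported C e p : deg_le e p -> supported C p -> reducible C e p.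
Proof.
move=> pe pC; exists (fun=> 0), p; split=> //; last by left.
by rewrite big1 ?add0r // => j _; rewrite mulr0.
Qed.

Lemma reducible_sym_coef C e (j : 'I_n) : (D j <= e)%N -> reducible C e (f j).
Proof.
move=> je; exists (fun i => (i == j)%:R), 0; split.
- rewrite addr0 (bigD1 j) //= eqxx mulr1 big1 ?addr0 // => i /negPf->.
  by rewrite mulr0.
- move=> i; case: eqP => [->|_]; [right|by left].
  by split=> //; rewrite -mpolyC1; apply: deg_leC.
- exact: deg_le0.
- exact: supported0.
Qed.

Lemma reducibleD C e p p' : reducible C e p -> reducible C e p' -> reducible C e (p + p').
Proof.
move=> [g [r [-> gD re rC]]] [g' [r' [-> gD' re' rC']]].
exists (fun j => g j + g' j), (r + r'); split.
- rewrite addrACA -big_split; congr (_ + _); apply: eq_bigr => j _ /=.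
  by rewrite mulrDr.
- move=> j; case: (gD j) (gD' j) => [->|[je ge]] [->|[je' ge']].
  + by left; rewrite addr0.
  + by right; rewrite add0r.
  + by right; rewrite addr0.
  + by right; split=> //; apply: deg_leD.
- exact: deg_leD.
- exact: supportedD.
Qed.

Lemma reducibleM C1 C2 C3 e e' h p :
  (forall m1 m2, C1 m1 -> C2 m2 -> C3 (m1 + m2)%MM) ->
  deg_le e' h -> supported C1 h -> reducible C2 e p -> reducible C3 (e' + e) (h * p).
Proof.
move=> C123 he hC [g [r [-> gD re rC]]]; exists (fun j => h * g j), (h * r); split.
- by rewrite mulrDr mulr_sumr; congr (_ + _); apply: eq_bigr => j _; rewrite mulrCA.
- move=> j; case: (gD j) => [->|[je ge]]; [left; exact: mulr0|right].
  split; first exact: leq_trans je (leq_addl _ _).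
  by rewrite -addnBA //; apply: deg_leM.
- exact: deg_leM.
- exact: supportedM hC rC.
Qed.

Lemma reducibleN C e p : reducible C e p -> reducible C e (- p).
Proof.
move=> [g [r [-> gD re rC]]]; exists (fun j => - g j), (- r); split.
- by rewrite opprD -sumrN; congr (_ + _); apply: eq_bigr => j _; rewrite mulrN.
- move=> j; case: (gD j) => [->|[je ge]]; [left; exact: oppr0|right].
  by split=> // m; rewrite (perm_mem (msuppN _)); apply: ge.
- by move=> m; rewrite (perm_mem (msuppN _)); apply: re.
- exact: supportedN.
Qed.

Lemma reducible_sum C e (I : Type) (r : seq I) (P : pred I) (G : I -> R) :
  (forall i, P i -> reducible C e (G i)) -> reducible C e (\sum_(i <- r | P i) G i).
Proof.
move=> h; apply: (big_ind (reducible C e)) => //; last exact: reducibleD.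
by apply: reducible_supported; [exact: deg_le0 | exact: supported0].
Qed.

Definition below (i : nat) (m : 'X_{1..n}) : Prop := forall u : 'I_n, (i <= u)%N -> m u = 0%N.

Lemma supported_Xn (C : 'X_{1..n} -> Prop) i t : C (U_(i) *+ t)%MM -> supported C ('X_i ^+ t : R).
Proof. by move=> Ct m; rewrite mpolyXn msuppX inE => /eqP->. Qed.

Lemma supportedZ (C : 'X_{1..n} -> Prop) c (p : R) : supported C p -> supported C (c *: p).
Proof. by move=> pC m mp; apply: pC; exact: msuppZ_le mp. Qed.

Lemma supported_var_value i t : supported (only_var i) (z i ^+ t).
Proof.
have base : supported (only_var i) (z i).
  rewrite var_value_sum; apply: (big_ind (supported (only_var i))).
  - exact: supported0.
  - exact: supportedD.
  move=> e _; apply: supportedZ; apply: supported_Xn => u ui.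
  by rewrite mulmnE mnm1E eq_sym (negPf ui).
elim: t => [|t IH]; first by rewrite expr0 -mpolyC1; apply: supportedC => u; rewrite mnmE.
rewrite exprS; apply: supportedM base IH => m1 m2 h1 h2 u ui.
by rewrite mnmDE h1 ?h2.
Qed.

(** Comparing coefficients in [F_i = (X - z_i) F_(i+1)] expresses those of [F_(i+1)]
    by those of [F_i], from the top coefficient downwards.  The coefficients of
    [F_0] are the [sym_coef]. *)
Lemma tail_poly_reducible i c : (i <= n)%N -> (c < n - i \/ c = n - i)%N ->
  reducible (below i) (d * (n - i - c)) (F i)`_c.
Proof.
elim: i c => [|i IHi] c ilen cn.
  rewrite !subn0 in cn *; case: cn => [cn|->].
    exact: (@reducible_sym_coef _ _ (Ordinal cn)).
  have := tail_poly_lead 0; rewrite subn0 => ->; rewrite -mpolyC1.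
  apply: reducible_supported; [exact: deg_leC | apply: supportedC => u _; exact: mnmE].
move: {2}(n - i.+1 - c)%N (erefl (n - i.+1 - c)%N) => r; elim: r c cn => [|r IHr] c cn rE.
  have -> : c = (n - i.+1)%N by move: cn rE; lia.
  rewrite tail_poly_lead -mpolyC1.
  apply: reducible_supported; [exact: deg_leC | apply: supportedC => u _; exact: mnmE].
pose i' := Ordinal ilen.
have -> : (F i.+1)`_c = (F i)`_c.+1 + z i' * (F i.+1)`_c.+1.
  by rewrite (tail_polyS i') /= mulrBl coefB coefXM coefCM /= subrK.
apply: reducibleD.
  have [|g [r' [-> gD re rC]]] := IHi c.+1 (ltnW ilen); first by move: cn rE; lia.
  have eE : (n - i - c.+1 = n - i.+1 - c)%N by lia.
  rewrite eE in gD re; exists g, r'; split=> // m mr u iu.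
  by apply: (rC m mr); apply: ltnW.
have -> : (d * (n - i.+1 - c) = d + d * (n - i.+1 - c.+1))%N.
  by rewrite -mulnS; congr (_ * _)%N; lia.
apply: (@reducibleM (only_var i') (below i.+1) (below i.+1)).
- move=> m1 m2 h1 h2 u iu; rewrite mnmDE h2 // h1 //.
  by apply: contraTneq iu => ->; rewrite -leqNgt.
- exact: deg_le_var_value.
- by rewrite -[z i']expr1; apply: supported_var_value.
- by apply: IHr; move: cn rE; lia.
Qed.

Definition top_reduced (i : 'I_n) (m : 'X_{1..n}) : Prop :=
  (forall u : 'I_n, (i < u)%N -> m u = 0%N) /\ (m i < D i)%N.

(** The relation [F_i(z_i) = 0] is monic in [z_i], with coefficients that reduce to
    polynomials in the previous variables; and [z_i ^ (n - i)] has leading term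
    [x_i ^ D_i]. *)
Lemma var_power_reducible (i : 'I_n) : reducible (top_reduced i) (D i) ('X_i ^+ D i).
Proof.
have ltin := ltn_ord i.
pose Q := q ^+ (n - i).
have Qmonic : Q \is monic by apply: monic_exp.
have Qsize : size Q = (D i).+1.
  rewrite -(prednK (_ : 0 < size Q)%N) ?lt0n ?size_poly_eq0 ?monic_neq0 //.
  by rewrite size_exp q_size.
have zE : z i ^+ (n - i) = 'X_i ^+ D i + \sum_(t < D i) Q`_t *: 'X_i ^+ t.
  have -> : z i ^+ (n - i) = (map_poly (@mpolyC n k) Q).['X_i].
    by rewrite /Q rmorphXn /= horner_exp.
  rewrite (@horner_coef_wide _ (D i).+1) ?(leq_trans (size_poly _ _)) ?Qsize //.
  have Qlead : Q`_(D i) = 1 by move/monicP: Qmonic; rewrite lead_coefE Qsize.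
  rewrite big_ord_recr [RHS]addrC /=; congr (_ + _).
    by apply: eq_bigr => t _; rewrite coef_map -mul_mpolyC.
  by rewrite coef_map /= Qlead mpolyC1 mul1r.
have root0 : z i ^+ (n - i) = - \sum_(c < n - i) (F i)`_c * z i ^+ c.
  apply/eqP; rewrite -addr_eq0 addrC; apply/eqP.
  transitivity (F i).[z i]; last by rewrite tail_polyS hornerM hornerXsubC subrr mul0r.
  rewrite (@horner_coef_wide _ (n - i).+1) ?size_tail_poly //.
  by rewrite big_ord_recr /= tail_poly_lead mul1r.
have -> : 'X_i ^+ D i = - \sum_(c < n - i) (F i)`_c * z i ^+ c
    - \sum_(t < D i) Q`_t *: 'X_i ^+ t.
  by rewrite -root0 zE addrK.
apply: reducibleD; apply: reducibleN; apply: reducible_sum => c _.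
  have -> : D i = (d * c + d * (n - i - c))%N.
    by rewrite -mulnDr /D; congr (_ * _)%N; have := ltn_ord c; lia.
  rewrite mulrC; have tc := @tail_poly_reducible i c (ltnW ltin) (or_introl (ltn_ord c)).
  pose C1 (m : 'X_{1..n}) := only_var i m /\ (m i <= d * c)%N.
  apply: (@reducibleM C1 (below i) (top_reduced i)) tc.
  - move=> m1 m2 [h1 h1i] h2; split=> [u iu|].
      by rewrite mnmDE h1 ?h2 // ?(ltnW iu) //; apply: contraTneq iu => ->; rewrite ltnn.
    rewrite mnmDE (h2 i) // addn0; apply: leq_ltn_trans h1i _.
    by rewrite /D ltn_mul2l d_gt0 ltn_ord.
  - by apply: deg_leXn; apply: deg_le_var_value.
  - move=> m mz; split; first exact: supported_var_value mz.
    have := deg_leXn (t := c) (@deg_le_var_value i) mz; apply: leq_trans.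
    by rewrite mdegE (bigD1 i) //= leq_addr.
apply: reducible_supported.
  rewrite -mul_mpolyC; apply: (@deg_leM _ _ 0 (D i)); first exact: deg_leC.
  apply: (@deg_leW _ _ (1 * c)); first by rewrite mul1n ltnW.
  by apply: deg_leXn; rewrite -(mdeg1 i); apply: deg_leX.
apply: supportedZ; apply: supported_Xn; split=> [u iu|].
  by rewrite mulmnE mnm1E; case: eqP => // e; rewrite e ltnn in iu.
by rewrite mulmnE mnm1E eqxx mul1n.
Qed.

End SymmetricRegularSequence.

(** * A basis adapted to a regular sequence *)

(** The relations [f_red] let every power [x_i ^ D_i] be traded for the [f_j], so that
    the [x_i ^ a_i] with [a_i < D_i] generate over the polynomials in the [f_j].
    Sending [x ^ m] to the product of the [x_i ^ (m_i mod D_i) f_i ^ (m_i / D_i)]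
    turns multiplication by [x_i ^ D_i] into multiplication by [f_i]; when this
    map is bijective, the [f_i] are as regular as the [x_i ^ D_i]. *)
Section StandardBasis.

Variables (n : nat) (k : fieldType).
Local Notation R := {mpoly k[n]}.
Variables (f : 'I_n -> R) (D : 'I_n -> nat).
Hypothesis D_gt0 : forall i, (0 < D i)%N.
Hypothesis f_red : forall i, exists (g : 'I_n -> R) (r : R),
  [/\ 'X_i ^+ D i = \sum_j f j * g j + r,
      forall j, g j = 0 \/ (D j <= D i)%N /\ deg_le (D i - D j) (g j),
      deg_le (D i) r & supported (fun m => (forall u : 'I_n, (i < u)%N -> m u = 0%N) /\ (m i < D i)%N) r].

Definition std_elt (m : 'X_{1..n}) : R :=
  \prod_i ('X_i ^+ (m i %% D i) * f i ^+ (m i %/ D i)).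

Definition std_map (p : R) : R := \sum_(m <- msupp p) p@_m *: std_elt m.

Lemma std_map_wide b p : (msize p <= b)%N ->
  std_map p = \sum_(m : 'X_{1..n < b}) p@_m *: std_elt m.
Proof.
move=> pb; pose I : subFinType _ := 'X_{1..n < b}.
rewrite /std_map (big_mksub I) //=; first last.
- by move=> m /msize_mdeg_lt lt; apply: leq_trans pb.
- by rewrite msupp_uniq.
by rewrite big_rmcond //= => i /memN_msupp_eq0->; rewrite scale0r.
Qed.

Lemma std_mapD p p' : std_map (p + p') = std_map p + std_map p'.
Proof.
pose b := (msize p + msize p' + msize (p + p'))%N.
rewrite !(@std_map_wide b) /b; try lia.
by rewrite -big_split; apply: eq_bigr => m _; rewrite /= mcoeffD scalerDl.
Qed.

Lemma std_mapZ c p : std_map (c *: p) = c *: std_map p.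
Proof.
pose b := (msize p + msize (c *: p))%N.
rewrite !(@std_map_wide b) /b; try lia.
by rewrite scaler_sumr; apply: eq_bigr => m _; rewrite mcoeffZ scalerA.
Qed.

Lemma std_map0 : std_map 0 = 0.
Proof. by have := std_mapZ 0 0; rewrite !scale0r. Qed.

Lemma std_map_sum (I : Type) (r : seq I) (P : pred I) (G : I -> R) :
  std_map (\sum_(i <- r | P i) G i) = \sum_(i <- r | P i) std_map (G i).
Proof. exact: (big_morph std_map std_mapD std_map0). Qed.

Lemma std_mapX m : std_map 'X_[m] = std_elt m.
Proof. by rewrite /std_map msuppX big_seq1 mcoeffX eqxx scale1r. Qed.

Lemma std_elt_shift m i : std_elt (m + U_(i) *+ D i)%MM = f i * std_elt m.
Proof.
rewrite /std_elt (bigD1 i) //= [in RHS](bigD1 i) //= mulrA; congr (_ * _).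
  rewrite mnmDE mulmnE mnm1E eqxx mul1n modnDr divnDr ?dvdnn // divnn D_gt0 addn1.
  by rewrite exprS mulrCA.
apply: eq_bigr => j ji; rewrite mnmDE mulmnE mnm1E eq_sym (negPf ji) mul0n addn0.
by [].
Qed.

Lemma std_map_shift i p : std_map ('X_i ^+ D i * p) = f i * std_map p.
Proof.
rewrite [p]mpolyE mulr_sumr !std_map_sum mulr_sumr; apply: eq_bigr => m _.
by rewrite -scalerAr !std_mapZ mpolyXn mulrC -mpolyXD !std_mapX std_elt_shift scalerAr.
Qed.

Lemma std_elt_id (m : 'X_{1..n}) : (forall i, m i < D i)%N -> std_elt m = 'X_[m].
Proof.
move=> mD; rewrite mpolyXE_id; apply: eq_bigr => i _.
by rewrite modn_small // divn_small // expr0 mulr1.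
Qed.

Definition std_hit e p := exists2 p', deg_le e p' & std_map p' = p.

Lemma std_hitD e p1 p2 : std_hit e p1 -> std_hit e p2 -> std_hit e (p1 + p2).
Proof.
move=> [p1' d1 <-] [p2' d2 <-]; exists (p1' + p2'); [exact: deg_leD | exact: std_mapD].
Qed.

Lemma std_hit0 e : std_hit e 0.
Proof. by exists 0; [exact: deg_le0 | exact: std_map0]. Qed.

Lemma std_hitZ e c p : std_hit e p -> std_hit e (c *: p).
Proof.
move=> [p' d' <-]; exists (c *: p'); last exact: std_mapZ.
by move=> m mp; apply: d'; have := @msuppZ_le _ _ c p' m; apply.
Qed.

Lemma std_hit_shift e i p : (D i <= e)%N -> std_hit (e - D i) p -> std_hit e (f i * p).
Proof.
move=> ie [p' d' <-]; exists ('X_i ^+ D i * p'); last exact: std_map_shift.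
rewrite -(subnKC ie); apply: deg_leM => //; apply: (@deg_leW _ _ (1 * D i)).
  by rewrite mul1n.
by apply: deg_leXn; rewrite -(mdeg1 i); apply: deg_leX.
Qed.

Lemma std_hit_mpoly e p : (forall m, m \in msupp p -> std_hit e 'X_[m]) -> std_hit e p.
Proof.
move=> h; rewrite [p]mpolyE big_seq; apply: (big_ind (std_hit e)).
- exact: std_hit0.
- exact: std_hitD.
- by move=> m /h; apply: std_hitZ.
Qed.

(** Induction on the degree [e].  For monomials of degree at most [e], those whose
    exponents from index [i] on are below [D] are reached, by induction on [i] and
    then on the exponent of the variable that is being reduced. *)
Lemma std_map_surj e p : deg_le e p -> std_hit e p.
Proof.
elim/ltn_ind: e p => e IH.
have hitX (m : 'X_{1..n}) : (mdeg m <= e)%N -> std_hit e 'X_[m].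
  have step i : (i <= n)%N -> forall m : 'X_{1..n}, (mdeg m <= e)%N ->
      (forall j : 'I_n, (i <= j)%N -> (m j < D j)%N) -> std_hit e 'X_[m].
    elim: i => [|i IHi] ilen m0 me small.
      exists 'X_[m0]; first exact: deg_leW me (@deg_leX _ _ _).
      by rewrite std_mapX std_elt_id // => j; apply: small.
    pose i' := Ordinal ilen.
    elim/ltn_ind: {m0}(m0 i') {-2}m0 (erefl (m0 i')) me small => v IHv m0 mv me small.
    have [lt|ge] := ltnP (m0 i') (D i').
      apply: IHi => // [|j]; first exact: ltnW.
      rewrite leq_eqVlt => /orP[/eqP ij|]; last exact: small.
      by have -> : j = i' by apply/val_inj.
    pose m1 := (m0 - U_(i') *+ D i')%MM.
    have m0E : m0 = (U_(i') *+ D i' + m1)%MM.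
      rewrite addmC submK //; apply/mnm_lepP => u; rewrite mulmnE mnm1E.
      by case: eqP => [<-|_]; rewrite ?mul1n ?mul0n.
    have mdegE0 : mdeg m0 = (D i' + mdeg m1)%N.
      by rewrite {1}m0E mdegD mdegMn mdeg1 mul1n.
    have [g [r [XE gD re rC]]] := f_red i'.
    rewrite m0E mpolyXD -mpolyXn XE mulrDl mulr_suml; apply: std_hitD.
      apply: (big_ind (std_hit e)) => [||j _]; [exact: std_hit0 | exact: std_hitD |].
      case: (gD j) => [->|[ji gj]]; first by rewrite mulr0 mul0r; apply: std_hit0.
      have je : (D j <= e)%N by lia.
      rewrite -mulrA; apply: std_hit_shift => //; apply: IH.
        by have := D_gt0 j; lia.
      apply: (@deg_leW _ _ (D i' - D j + mdeg m1)); first by lia.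
      by apply: deg_leM => //; apply: deg_leX.
    rewrite [r]mpolyE mulr_suml big_seq.
    apply: (big_ind (std_hit e)) => [||mu mu_r]; [exact: std_hit0 | exact: std_hitD |].
    rewrite -scalerAl -mpolyXD; apply: std_hitZ.
    have [mu0 mui] := rC mu mu_r; have mue := re mu mu_r.
    have m0i : m0 i' = (D i' + m1 i')%N.
      by rewrite m0E mnmDE mulmnE mnm1E eqxx mul1n.
    apply: (IHv (mu i' + m1 i')%N).
    - by rewrite -mv m0i ltn_add2r.
    - by rewrite mnmDE.
    - by rewrite mdegD; lia.
    - move=> j ij; rewrite mnmDE mu0 // add0n.
      apply: leq_ltn_trans (small j ij).
      by rewrite [in X in (_ <= X)%N]m0E mnmDE leq_addl.
  by move=> me; apply: (step n (leqnn n)) => // j; rewrite leqNgt ltn_ord.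
by move=> p pe; apply: std_hit_mpoly => m /pe; apply: hitX.
Qed.

(** A surjective endomorphism of the finite-dimensional space of polynomials of
    bounded degree is injective. *)
Lemma std_map_inj p : std_map p = 0 -> p = 0.
Proof.
move=> p0; pose b := (msize p).+1; pose I := {: 'X_{1..n < b}}.
have pb : (msize p <= b)%N by rewrite leqnSn.
pose N := \matrix_(i < #|I|, j < #|I|) (std_elt (enum_val i : 'X_{1..n < b}))@_(enum_val j : 'X_{1..n < b}).
have sumE (p' : R) (j : 'I_#|I|) : (msize p' <= b)%N ->
    (std_map p')@_(enum_val j : 'X_{1..n < b}) =
    ((\row_i p'@_(enum_val i : 'X_{1..n < b})) *m N) 0 j.
  move=> p'b; rewrite (std_map_wide p'b) raddf_sum mxE /=.
  rewrite (reindex (@enum_val _ I)) /=; last exact: onW_bij (@enum_val_bij _).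
  by apply: eq_bigr => i _; rewrite mcoeffZ !mxE.
have hit (j : 'I_#|I|) : exists u : 'rV[k]_#|I|, u *m N = delta_mx 0 j.
  have mb : deg_le b.-1 ('X_[enum_val j : 'X_{1..n < b}] : R).
    apply: deg_leW (@deg_leX _ _ _); have := bmdeg (enum_val j : 'X_{1..n < b}); lia.
  have [p' /deg_le_msize p'b p'E] := std_map_surj mb.
  exists (\row_i p'@_(enum_val i : 'X_{1..n < b})); apply/rowP => j'.
  rewrite -sumE // p'E mcoeffX !mxE eqxx /= eq_sym.
  by rewrite -bmeqP (inj_eq enum_val_inj).
have [P PN] : exists P : 'M_#|I|, P *m N = 1%:M.
  have [u uN] := choice hit.
  exists (\matrix_j u j); apply/row_matrixP => j.
  by rewrite row_mul rowK uN row1.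
have NP := mulmx1C PN.
pose v : 'rV_#|I| := \row_i p@_(enum_val i : 'X_{1..n < b}).
have v0 : v = 0.
  rewrite -[v]mulmx1 -NP mulmxA.
  have -> : v *m N = 0 by apply/rowP => j; rewrite -sumE // p0 mcoeff0 mxE.
  by rewrite mul0mx.
apply/mpolyP => m; rewrite mcoeff0.
have [mb|mb] := ltnP (mdeg m) b; last first.
  by apply/memN_msupp_eq0/msize_mdeg_ge/(leq_trans pb).
have := congr1 (fun w : 'rV_#|I| => w 0 (enum_rank (BMultinom mb))) v0.
by rewrite !mxE enum_rankK.
Qed.

(** Through [std_map] this becomes a statement on the ideal of the [x_j ^ D_j] with
    [j < i], where membership is read off the exponents of each monomial, and
    multiplication by [x_i ^ D_i] does not affect these exponents. *)
Lemma std_regular (fs : seq R) (i : 'I_n) y : size fs = n -> (forall j : 'I_n, fs`_j = f j) ->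
  generated_ideal (take i fs) (f i * y) -> generated_ideal (take i fs) y.
Proof.
move=> fs_size fsE.
have ltin := ltn_ord i.
have take_size_i : size (take i fs) = i by rewrite size_take fs_size ltin.
have gen_id := generated_ideal_ideal (take i fs).
have memf (j : 'I_n) : (j < i)%N -> generated_ideal (take i fs) (f j).
  move=> ji; apply: mem_generated; rewrite -fsE -(nth_take 0 ji).
  by apply: mem_nth; rewrite take_size_i.
have surj p : exists p', std_map p' = p.
  by have [p' _ <-] := @std_map_surj (msize p) p (proj2 (deg_le_msize _ _) (leqnSn _)); exists p'.
have [y' <-] := surj y.
case/generated_idealP => g; rewrite take_size_i => gE.
have [g' g'E] := choice (fun j => surj (g j)).
pose w j := widen_ord (ltnW ltin) j : 'I_n.
have XE : 'X_i ^+ D i * y' = \sum_(j < i) 'X_(w j) ^+ D (w j) * g' j.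
  apply/eqP; rewrite -subr_eq0; apply/eqP/std_map_inj.
  rewrite std_mapD -scaleN1r std_mapZ scaleN1r std_map_shift gE std_map_sum.
  apply/eqP; rewrite subr_eq0; apply/eqP/eq_bigr => j _.
  by rewrite std_map_shift g'E nth_take // -[LHS]mulrC (fsE (w j)).
rewrite /std_map big_seq; apply: ideal_sum => // m my.
have : (m + U_(i) *+ D i)%MM \in msupp ('X_i ^+ D i * y').
  by rewrite mcoeff_msupp mpolyXn mulrC addmC mcoeffMX -mcoeff_msupp.
rewrite XE => /msupp_sum_le/flattenP[s /mapP[j _ ->]] /msuppM_le/allpairsP[[m1 m2] /= [m1P _ mE]].
move: m1P; rewrite mpolyXn msuppX inE => /eqP m1E.
have ji : w j != i by rewrite neq_ltn /= ltn_ord.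
have mj : (D (w j) <= m (w j))%N.
  have := congr1 (fun mm : 'X_{1..n} => mm (w j)) mE.
  rewrite m1E !mnmDE !mulmnE !mnm1E eqxx eq_sym (negPf ji) mul0n addn0 mul1n => ->.
  exact: leq_addr.
have mE' : m = ((m - U_(w j) *+ D (w j)) + U_(w j) *+ D (w j))%MM.
  rewrite submK //; apply/mnm_lepP => u; rewrite mulmnE mnm1E.
  by case: eqP => [<-|_]; rewrite ?mul1n ?mul0n.
rewrite mE' std_elt_shift mulrC -mul_mpolyC; case: (gen_id) => _ _ IM; apply: (IM).
by apply: IM; apply: memf; rewrite /= ltn_ord.
Qed.

End StandardBasis.

(** * Pure rings of invariants are Cohen-Macaulay *)

Section PureInvariantsCohenMacaulay.

Variables (n : nat) (k : fieldType) (G : {group 'S_n}).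
Local Notation R := {mpoly k[n]}.
Local Notation A := (invariant_ring k G).
Local Notation v := (@invariant_val n k G).
Hypothesis pureA : pure_invariants k G.

Lemma generated_val (s : seq A) y : generated_ideal s y -> generated_ideal (map v s) (v y).
Proof.
case/generated_idealP => c ->; apply/generated_idealP; exists (fun i => v (c i)).
rewrite size_map -[v _]/(\val _) raddf_sum; apply: eq_bigr => i _.
by rewrite (nth_map 0) //; apply: invariant_valM.
Qed.

(** By purity the extension of a proper ideal is proper. *)
Lemma maximal_lying_over (P : A -> Prop) : maximal_ideal P ->
  exists2 M, maximal_ideal M & forall x : A, M (v x) -> P x.
Proof.
move=> [Pid P1 Pmax].
pose J x := exists2 t : seq A, (forall y, y \in t -> P y) & generated_ideal (map v t) x.
have Jid : ideal J.
  split=> [|x y [t tP xt] [t' t'P yt']|a x [t tP xt]].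
  - by exists [::] => //; case: (generated_ideal_ideal ([::] : seq R)).
  - exists (t ++ t') => [z|]; first by rewrite mem_cat => /orP[/tP|/t'P].
    rewrite map_cat; case: (generated_ideal_ideal (map v t ++ map v t')) => _ + _; apply.
      by apply: generated_sub xt => z zt; rewrite mem_cat zt.
    by apply: generated_sub yt' => z zt; rewrite mem_cat zt orbT.
  - by exists t => //; case: (generated_ideal_ideal (map v t)) => _ _; apply.
have [|M Mmax JM] := exists_maximal_ideal Jid.
  move=> [t tP]; rewrite -[1]/(v 1) => /pureA gen1; apply: P1.
  exact: generated_min gen1.
have [[M0 MD MM] M1 _] := Mmax.
exists M => // x Mx; apply: (Pmax (fun y => M (v y))) => // [|y Py].
  split=> // [y z My Mz|a y My]; last by rewrite invariant_valM; apply: MM.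
  by rewrite -[v _]/(\val y + \val z); apply: MD.
by apply: JM; exists [:: y] => [z|]; [rewrite inE => /eqP-> | apply: mem_generated; rewrite inE].
Qed.

(** The factor ['X] makes the degree positive when there are no variables. *)
Lemma common_annihilator (M : R -> Prop) : maximal_ideal M ->
  exists (q : {poly k}) d, [/\ q \is monic, size q = d.+1, (0 < d)%N &
    forall i, M (var_value q i)].
Proof.
move=> Mmax; have [[M0 MD MM] M1 _] := Mmax.
have [Q QP] : exists Q : 'I_n -> {poly k}, forall i, Q i != 0 /\ M (var_value (Q i) i).
  have ex i : exists q, q != 0 /\ M (var_value q i).
    by have [q q0 qM] := zariski_maximal Mmax i; exists q.
  by have [Q QP] := choice ex; exists Q.
pose q0 := 'X * \prod_i Q i.
have prod0 : \prod_i Q i != 0 by apply/prodf_neq0 => i _; have [] := QP i.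
have q00 : q0 != 0 by rewrite mulf_neq0 ?polyX_eq0.
have lc0 : (lead_coef q0)^-1 != 0 by rewrite invr_eq0 lead_coef_eq0.
have sq : size ((lead_coef q0)^-1 *: q0) = (size (\prod_i Q i)).+1.
  by rewrite size_scale // /q0 mulrC size_mulX.
exists ((lead_coef q0)^-1 *: q0), (size (\prod_i Q i)); split=> // [||i].
- by rewrite monicE lead_coefZ mulVf ?lead_coef_eq0.
- by rewrite lt0n size_poly_eq0.
have [_ MQi] := QP i; rewrite /var_value /q0 (bigD1 i) //= mulrCA scalerAr.
rewrite rmorphM hornerM mulrC; exact: MM.
Qed.

Lemma maximal_regular_sequence (P : A -> Prop) : maximal_ideal P -> regular_sequence_in P n.
Proof.
move=> Pmax; have [M Mmax MP] := maximal_lying_over Pmax.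
have [q [d [q_monic q_size d_gt0 Mq]]] := common_annihilator Mmax.
have [Mid _ _] := Mmax; have [Pid P1 _] := Pmax.
have f_inv j : sym_coef n q j \in invariant_pred G.
  by apply/invariantP => s _; apply: (msym_sym_coef q_size).
pose ts := mkseq (fun j => InvariantRing (f_inv j) : A) n.
have ts_size : size ts = n by rewrite size_mkseq.
have vts : map v ts = mkseq (sym_coef n q) n by rewrite -map_comp.
have tsP x : x \in ts -> P x.
  case/mapP => j; rewrite mem_iota add0n => /andP[_ jn] ->; apply: MP => /=.
  by apply: sym_coef_ideal.
exists ts; split=> //; split; last first.
  by move=> gen1; apply: P1; apply: generated_min gen1.
move=> i y; rewrite ts_size => ltin gen; apply: pureA; rewrite map_take vts.
apply: (@std_regular n k (fun j => sym_coef n q j) (fun j => sym_deg n d j) _ _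
   (mkseq (sym_coef n q) n) (Ordinal ltin)).
- exact: sym_deg_gt0.
- exact: var_power_reducible.
- by rewrite size_mkseq.
- by move=> j; rewrite nth_mkseq.
have := generated_val gen; rewrite map_take vts invariant_valM nth_mkseq //.
Qed.

(** A maximal ideal contains a regular sequence of length [n], every regular sequence
    in it yields a chain of primes of the same length, and no chain is longer than
    [n]; so height and depth both equal [n]. *)
Theorem pure_invariants_cohen_macaulay : cohen_macaulay_ring A.
Proof.
split; first exact: invariant_ring_noetherian.
move=> P Pmax; have Pprime := maximal_prime Pmax; exists n.
have reg_chain e : regular_sequence_in P e -> prime_chain_below P e.
  by case=> s [<- sreg sP]; apply: regular_chain.
have regn := maximal_regular_sequence Pmax.
split; split=> [|e].
- exact: reg_chain.
- exact: invariant_chain_length.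
- exact: regn.
- by move/reg_chain/invariant_chain_length.
Qed.

End PureInvariantsCohenMacaulay.

Theorem proposition3p2 (l m p : nat) (k : fieldType)
    (l_gt0 : (0 < l)%N) (m_gt0 : (0 < m)%N)
    (p_prime : prime p) (m_lt_p : (m < p)%N) (char_k : p \in [pchar k]%R) :
  cohen_macaulay_complex (@quotient_le (l * m)) k
    (quotient_complex (wreath l m)) /\
  cohen_macaulay_ring (invariant_ring k (wreath l m)).
Proof.
have H_unit : #|position_group l m|%:R != 0 :> k.
  by rewrite -(dvdn_pcharf char_k); apply: position_group_card.
split; first exact: quotient_complex_cohen_macaulay.
by apply: pure_invariants_cohen_macaulay => s y; apply: wreath_purity.
Qed.
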